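(* Let $f\in L_2(\Omega)$ be given. Consider the mixed hybrid formulation: find $\boldsymbol M\in H(\mathrm{dDiv},\mathcal T;\mathbb S)$, $u\in L_2(\Omega)$, and $\boldsymbol\psi\in H^{3/2,1/2}_0(\mathcal S)$ such that \[ (\mathcal C^{-1}\boldsymbol M,\boldsymbol{\delta M})-(u,\operatorname{div}\operatorname{\mathbf{div}}\boldsymbol{\delta M})_{\mathcal T}-\langle\boldsymbol\psi,\boldsymbol{\delta M}\rangle_{\mathcal S}=0, \] \[ -(\operatorname{div}\operatorname{\mathbf{div}}\boldsymbol M,\delta u)_{\mathcal T}-\langle\boldsymbol{\delta\psi},\boldsymbol M\rangle_{\mathcal S}=-(f,\delta u) \] holds for any $\boldsymbol{\delta M}\in H(\mathrm{dDiv},\mathcal T;\mathbb S)$, $\delta u\in L_2(\Omega)$, and $\boldsymbol{\delta\psi}\in H^{3/2,1/2}_0(\mathcal S)$. This problem is well posed (it has exactly one solution, depending continuously on $f$). Its solution $(\boldsymbol M,u,\boldsymbol\psi)$ satisfies \[ \|\boldsymbol M\|_{\mathrm{dDiv},\mathcal T}+\|u\|+\|\boldsymbol\psi\|_{3/2,1/2,\mathcal S}\le C\|f\| \] with a constant $C$ that is independent of $f$ and $\mathcal T$. Furthermore, $u\in H^2_0(\Omega)$, $\boldsymbol M=\mathcal C D^2u$, $\boldsymbol\psi=\gamma_2(u)$, and $u$, $\boldsymbol M$ solve the Kirchhoff–Love problem \[ \operatorname{div}\operatorname{\mathbf{div}}\boldsymbol M=f,\quad \boldsymbol M=\mathcal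 C D^2u\ \text{ in }\Omega,\qquad u=\partial_nu=0\ \text{ on }\Gamma. \]
   Context: $\Omega\subset\mathbb R^2$ is a bounded, simply connected Lipschitz polygon with boundary $\Gamma=\partial\Omega$; $\partial_n$ is the exterior normal derivative. $\mathbb S$ is the space of symmetric $2\times2$ real matrices; $\mathcal C$ is a symmetric, (uniformly) positive definite $L_\infty$ tensor field on $\Omega$, acting pointwise as a linear map $\mathbb S\to\mathbb S$, with pointwise inverse $\mathcal C^{-1}$. $D^2$ is the Hessian and $\operatorname{\mathbf{div}}$ the row-wise divergence of tensors. $(\cdot,\cdot)$, $\|\cdot\|$ are the $L_2(\Omega)$ inner product and norm. $\|v\|_2^2:=\|v\|^2+\|D^2v\|^2$ on $H^2(\Omega)$. For a domain $\omega$, $H(\mathrm{dDiv},\omega;\mathbb S):=\{\boldsymbol M\in L_2(\omega;\mathbb S):\operatorname{div}\operatorname{\mathbf{div}}\boldsymbol M\in L_2(\omega)\}$ with $\|\boldsymbol M\|_{\mathrm{dDiv},\omega}^2:=\|\boldsymbol M\|_{L_2(\omega)}^2+\|\operatorname{div}\operatorname{\mathbf{div}}\boldsymbol M\|_{L_2(\omega)}^2$. $H^2_0(\Omega)$ is the subspace of $H^2(\Omega)$ with vanishing trace and normal derivative on $\Gamma$. $\mathcal T$ is a regular (conforming) mesh of shape-regular triangles $T$ covering $\Omega$, with skeleton $\mathcal S=\bigcup_{T\in\mathcal T}\partial T$. $(\cdot,\cdot)_{\mathcal T}$ is the sum of elementwise $L_2$ inner products, with differential operators taken elementwise. $H(\mathrm{dDiv},\mathcal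 T;\mathbb S):=\prod_{T\in\mathcal T}H(\mathrm{dDiv},T;\mathbb S)$ (piecewise tensor functions), with $\|\boldsymbol M\|_{\mathrm{dDiv},\mathcal T}^2=\sum_T\|\boldsymbol M\|_{\mathrm{dDiv},T}^2$. Trace operator $\gamma_2:H^2(\Omega)\to H(\mathrm{dDiv},\mathcal T;\mathbb S)^*$, $\langle\gamma_2(v),\boldsymbol Q\rangle_{\mathcal S}:=(D^2v,\boldsymbol Q)-(v,\operatorname{div}\operatorname{\mathbf{div}}\boldsymbol Q)_{\mathcal T}$. Trace space $H^{3/2,1/2}_0(\mathcal S):=\gamma_2(H^2_0(\Omega))$ with norm $\|\boldsymbol\psi\|_{3/2,1/2,\mathcal S}:=\inf\{\|v\|_2: v\in H^2(\Omega),\ \gamma_2(v)=\boldsymbol\psi\}$; $\langle\boldsymbol\psi,\boldsymbol Q\rangle_{\mathcal S}$ is the action of the functional $\boldsymbol\psi$ on $\boldsymbol Q\in H(\mathrm{dDiv},\mathcal T;\mathbb S)$. *)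

(* Defs.v *)
(* Omega is a subset of the plane R * R, for an
   arbitrary R : realType.  Elements of L2-type spaces are represented by
   functions on R * R; only their values on the domain in question matter, and
   they are identified when equal almost everywhere there. *)
From HB Require Import structures.
From mathcomp Require Import all_boot all_order all_algebra.
From mathcomp Require Import all_classical all_reals all_analysis.

Set Implicit Arguments.
Unset Strict Implicit.
Unset Printing Implicit Defensive.

Import Order.TTheory GRing.Theory Num.Theory numFieldNormedType.Exports.

Local Open Scope classical_set_scope.
Local Open Scope ring_scope.

Section Geometry.
Context {R : realType}.
Implicit Types (A Omega : set (R * R)) (a b c x : R * R).

Definition dot a b : R := a.1 * b.1 + a.2 * b.2.

(* The library norm of R * R is the maximum norm; lengths use this one. *)
Definition elen a : R := Num.sqrt (dot a a).

Definition rot90 a : R * R := (- a.2, a.1).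

Definition seg_pt a b (s : R) : R * R := a + s *: (b - a).

Definition closed_seg a b : set (R * R) := seg_pt a b @` `[0, 1].

Definition open_seg a b : set (R * R) := seg_pt a b @` `]0, 1[.

Definition bdry A : set (R * R) := closure A `\` interior A.

(* Near every boundary point, in a suitable orthonormal frame, Omega is the set
   of points lying strictly below the graph of a Lipschitz function. *)
Definition lipschitz_boundary Omega : Prop :=
  forall x, bdry Omega x ->
    exists (d : R * R) (r k : R) (g : R -> R),
      [/\ elen d = 1, 0 < r,
          forall s t, `|g s - g t| <= k * `|s - t| &
          forall s t, `|s| < r -> `|t| < r ->
            (Omega (x + s *: rot90 d + t *: d) <-> t < g s)].

Definition simply_connected Omega : Prop :=
  connected Omega /\
  forall gam : R -> R * R,
    {within `[0, 1], continuous gam} ->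
    (forall t, 0 <= t <= 1 -> Omega (gam t)) -> gam 0 = gam 1 ->
    exists H : R * R -> R * R,
      [/\ {within `[0, 1] `*` `[0, 1], continuous H},
          forall s t, 0 <= s <= 1 -> 0 <= t <= 1 -> Omega (H (s, t)),
          forall t, 0 <= t <= 1 -> H (0, t) = gam t /\ H (1, t) = gam 0 &
          forall s, 0 <= s <= 1 -> H (s, 0) = gam 0 /\ H (s, 1) = gam 0].

(* The edge E k joins (E k).1 to (E k).2; the edges decompose the boundary
   without overlapping. *)
Definition polygonal_boundary Omega m (E : 'I_m -> (R * R) * (R * R)) : Prop :=
  [/\ forall k, (E k).1 <> (E k).2,
      bdry Omega = \bigcup_k closed_seg (E k).1 (E k).2 &
      forall k l, k != l ->
        open_seg (E k).1 (E k).2 `&` closed_seg (E l).1 (E l).2 = set0].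

Record lipschitz_polygon Omega m (E : 'I_m -> (R * R) * (R * R)) : Prop := {
  polygon_nonempty : Omega !=set0;
  polygon_open : open Omega;
  polygon_bounded : bounded_set Omega;
  polygon_simply_connected : simply_connected Omega;
  polygon_lipschitz : lipschitz_boundary Omega;
  polygon_edges : polygonal_boundary Omega E }.

(* Of the two unit vectors orthogonal to the edge from a to b, the one that
   points out of Omega at the midpoint of the edge. *)
Definition ext_normal Omega a b : R * R :=
  let nu := (elen (b - a))^-1 *: rot90 (b - a) in
  if `[< \forall t \near (0 : R)^'+, ~ Omega (seg_pt a b 2^-1 + t *: nu) >]
  then nu else - nu.

Definition triangle := 'I_3 -> R * R.

Definition bary_pt (V : triangle) (w : 'I_3 -> R) : R * R :=
  \sum_(i < 3) w i *: V i.

Definition nondegenerate (V : triangle) : Prop :=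
  dot (rot90 (V (inord 1) - V ord0)) (V (inord 2) - V ord0) != 0.

Definition open_tri (V : triangle) : set (R * R) :=
  [set x | exists w : 'I_3 -> R,
     [/\ forall i, 0 < w i, \sum_(i < 3) w i = 1 & x = bary_pt V w]].

Definition closed_tri (V : triangle) : set (R * R) :=
  [set x | exists w : 'I_3 -> R,
     [/\ forall i, 0 <= w i, \sum_(i < 3) w i = 1 & x = bary_pt V w]].

(* Two distinct elements are disjoint, or meet exactly in a common vertex, or
   meet exactly in a common edge. *)
Definition conforming N (T : 'I_N -> triangle) : Prop :=
  forall k l, k != l ->
    [\/ closed_tri (T k) `&` closed_tri (T l) = set0,
        exists i j, T k i = T l j /\
          closed_tri (T k) `&` closed_tri (T l) = [set T k i] |
        exists i i' j j',
          [/\ i != i', T k i = T l j, T k i' = T l j' &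
              closed_tri (T k) `&` closed_tri (T l)
                = closed_seg (T k i) (T k i')]].

(* Every element contains a Euclidean ball of radius rho with
   diameter <= kappa * rho. *)
Definition shape_regular (kappa : R) N (T : 'I_N -> triangle) : Prop :=
  forall k, exists c (rho : R),
    [/\ 0 < rho,
        forall x, elen (x - c) <= rho -> closed_tri (T k) x &
        forall i j, elen (T k i - T k j) <= kappa * rho].

Record regular_mesh Omega (kappa : R) N (T : 'I_N -> triangle) : Prop := {
  mesh_nondegenerate : forall k, nondegenerate (T k);
  mesh_covers : \bigcup_k closed_tri (T k) = closure Omega;
  mesh_conforming : conforming T;
  mesh_shape_regular : shape_regular kappa T }.

End Geometry.

Section Spaces.
Context {R : realType}.
Implicit Types (om Omega : set (R * R)) (f g u v phi : R * R -> R)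
  (M Q : R * R -> 'M[R]_2).

Definition leb2 := ((@lebesgue_measure R) \x (@lebesgue_measure R))%E.

Definition L2 om f : Prop := f \_ om \in Lfun leb2 2%:E.

Definition ip om f g : R := \int[leb2]_(x in om) (f x * g x).

Definition norm_L2 om f : R := Num.sqrt (ip om f f).

Definition frob (A B : 'M[R]_2) : R := \sum_i \sum_j A i j * B i j.

Definition symm (A : 'M[R]_2) : Prop := A^T = A.

Definition L2S om M : Prop :=
  (forall x, om x -> symm (M x)) /\ forall i j, L2 om (fun x => M x i j).

Definition ipS om M Q : R := \int[leb2]_(x in om) frob (M x) (Q x).

Definition norm_L2S om M : R := Num.sqrt (ipS om M M).

Definition evec (i : 'I_2) : R * R := ((i == ord0)%:R, (i != ord0)%:R).

Definition pd (i : 'I_2) phi : R * R -> R := 'D_(evec i) phi.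

(* C^oo on the whole plane: all iterated partial derivatives exist and are
   continuous. *)
Definition smooth phi : Prop :=
  forall s : seq 'I_2, let g := foldr pd phi s in
    continuous g /\ forall x i, derivable g x (evec i).

Definition test om phi : Prop :=
  [/\ smooth phi, compact (closure [set x | phi x != 0]) &
      closure [set x | phi x != 0] `<=` om].

Definition chess phi : R * R -> 'M[R]_2 :=
  fun x => \matrix_(i, j) pd i (pd j phi) x.

(* Distributional derivatives that belong to L2. *)
Definition is_wpd om (i : 'I_2) v g : Prop :=
  L2 om g /\ forall phi, test om phi -> ip om v (pd i phi) = - ip om g phi.

Definition is_hess om v M : Prop :=
  L2S om M /\
  forall phi, test om phi -> forall i j,
    ip om v (pd i (pd j phi)) = ip om (fun x => M x i j) phi.

(* g is div div M on om, in the sense of distributions. *)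
Definition is_dDiv om M g : Prop :=
  L2 om g /\ forall phi, test om phi -> ipS om M (chess phi) = ip om g phi.

(* A representative of the (a.e. unique) Hessian, resp. of div div M, on om. *)
Definition hess om v : R * R -> 'M[R]_2 := get [set M | is_hess om v M].

Definition dDiv om M : R * R -> R := get [set g | is_dDiv om M g].

Definition H2 om v : Prop :=
  [/\ L2 om v, forall i, exists g, is_wpd om i v g & exists M, is_hess om v M].

Definition norm2 om v : R :=
  Num.sqrt (norm_L2 om v ^+ 2 + norm_L2S om (hess om v) ^+ 2).

Definition HdDiv om M : Prop := L2S om M /\ exists g, is_dDiv om M g.

Definition norm_dDiv om M : R :=
  Num.sqrt (norm_L2S om M ^+ 2 + norm_L2 om (dDiv om M) ^+ 2).

Section Boundary.
Context (Omega : set (R * R)) (m : nat) (E : 'I_m -> (R * R) * (R * R)).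

(* Functions on the boundary are given edge by edge, since the normal derivative
   of a smooth function has no single value at a vertex. *)
Definition on_edge (g : 'I_m -> R * R -> R) (k : 'I_m) (s : R) : R :=
  g k (seg_pt (E k).1 (E k).2 s).

Definition L2_bdry (g : 'I_m -> R * R -> R) : Prop :=
  forall k, on_edge g k \_ `[0, 1] \in Lfun (@lebesgue_measure R) 2%:E.

(* L2 norm with respect to arc length. *)
Definition norm_bdry (g : 'I_m -> R * R -> R) : R :=
  Num.sqrt (\sum_k elen ((E k).2 - (E k).1) *
    \int[lebesgue_measure]_(s in `[0, 1]) (on_edge g k s) ^+ 2).

(* (g0, g1) are the trace and the exterior normal derivative of v on the boundary:
   the values at v of the continuous extension to H^2 of the map
   phi |-> (phi, D_n phi), defined for phi smooth up to the boundary. *)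
Definition cauchy_trace v (g0 g1 : 'I_m -> R * R -> R) : Prop :=
  [/\ L2_bdry g0, L2_bdry g1 &
    exists phi : nat -> R * R -> R,
      [/\ forall n, smooth (phi n),
          (fun n => norm2 Omega (fun x => v x - phi n x)) @ \oo --> (0 : R),
          (fun n => norm_bdry (fun k x => phi n x - g0 k x))
             @ \oo --> (0 : R) &
          (fun n => norm_bdry (fun k x =>
             'D_(ext_normal Omega (E k).1 (E k).2) (phi n) x - g1 k x))
             @ \oo --> (0 : R)]].

Definition H20 v : Prop :=
  H2 Omega v /\ cauchy_trace v (fun _ _ => 0) (fun _ _ => 0).

Section Mesh.
Context (N : nat) (T : 'I_N -> @triangle R).

Definition HdDivT M : Prop :=
  L2S Omega M /\ forall k, HdDiv (open_tri (T k)) M.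

Definition norm_dDivT M : R :=
  Num.sqrt (\sum_k norm_dDiv (open_tri (T k)) M ^+ 2).

(* (v, div div M)_T *)
Definition ip_dDivT v M : R :=
  \sum_k ip (open_tri (T k)) v (dDiv (open_tri (T k)) M).

(* gamma2 v is a functional on HdDivT; its values elsewhere are irrelevant, and
   functionals are compared by eq_dual. *)
Definition gamma2 v : (R * R -> 'M[R]_2) -> R :=
  fun Q => ipS Omega (hess Omega v) Q - ip_dDivT v Q.

Definition eq_dual (psi psi' : (R * R -> 'M[R]_2) -> R) : Prop :=
  forall Q, HdDivT Q -> psi Q = psi' Q.

(* H^{3/2,1/2}_0 of the skeleton and its norm. *)
Definition H3212 (psi : (R * R -> 'M[R]_2) -> R) : Prop :=
  exists2 v, H20 v & eq_dual (gamma2 v) psi.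

Definition norm3212 (psi : (R * R -> 'M[R]_2) -> R) : R :=
  inf [set r | exists v, [/\ H2 Omega v, eq_dual (gamma2 v) psi &
                             r = norm2 Omega v]].

Section Problem.
(* C x is a linear map of symmetric matrices; its values on the other matrices
   are irrelevant. *)
Context (C : R * R -> {linear 'M[R]_2 -> 'M[R]_2}).

(* Pointwise inverse on the symmetric matrices. *)
Definition Cinv (x : R * R) (A : 'M[R]_2) : 'M[R]_2 :=
  get [set B | symm B /\ C x B = A].

Record elasticity_tensor : Prop := {
  elast_measurable : forall A, symm A -> forall i j,
    measurable_fun Omega (fun x => C x A i j);
  elast_symm : {ae leb2, forall x, Omega x ->
    forall A, symm A -> symm (C x A)};
  elast_bounded : exists c : R, {ae leb2, forall x, Omega x ->
    forall A, symm A -> frob (C x A) (C x A) <= c * frob A A};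
  elast_selfadjoint : {ae leb2, forall x, Omega x ->
    forall A B, symm A -> symm B -> frob (C x A) B = frob A (C x B)};
  elast_posdef : exists2 c : R, 0 < c & {ae leb2, forall x, Omega x ->
    forall A, symm A -> c * frob A A <= frob (C x A) A} }.

Definition is_solution f M u psi : Prop :=
  [/\ HdDivT M, L2 Omega u, H3212 psi,
      forall dM, HdDivT dM ->
        ipS Omega (fun x => Cinv x (M x)) dM - ip_dDivT u dM - psi dM = 0 &
      forall du dpsi, L2 Omega du -> H3212 dpsi ->
        - ip_dDivT du M - dpsi M = - ip Omega f du].

Definition sol_norm M u psi : R :=
  norm_dDivT M + norm_L2 Omega u + norm3212 psi.

(* Exactly one solution for every f, depending continuously on f. *)
Definition well_posed : Prop :=
  [/\ forall f, L2 Omega f -> exists M u psi, is_solution f M u psi,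
      forall f M u psi M' u' psi', L2 Omega f ->
        is_solution f M u psi -> is_solution f M' u' psi' ->
        [/\ {ae leb2, forall x, Omega x -> M x = M' x},
            {ae leb2, forall x, Omega x -> u x = u' x} &
            eq_dual psi psi'] &
      exists L : R, forall f f' M u psi M' u' psi',
        L2 Omega f -> L2 Omega f' ->
        is_solution f M u psi -> is_solution f' M' u' psi' ->
        sol_norm (fun x => M x - M' x) (fun x => u x - u' x)
                 (fun Q => psi Q - psi' Q)
          <= L * norm_L2 Omega (fun x => f x - f' x)].

Definition kirchhoff_love f u M : Prop :=
  [/\ is_dDiv Omega M f,
      {ae leb2, forall x, Omega x -> M x = C x (hess Omega u x)} &
      cauchy_trace u (fun _ _ => 0) (fun _ _ => 0)].

End Problem.
End Mesh.
End Boundary.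
End Spaces.

(* Main.v *)
(* For [u] and [v] in [H^2_0] the energy [(C D^2 u, D^2 v)] is coercive, because
   [H^2_0] satisfies a Poincare inequality: a horizontal chord of [Omega] starts
   on an edge, where the value and the gradient of [u] vanish.  Riesz's theorem
   gives [u] with [(C D^2 u, D^2 v) = (f, v)] for all [v] in [H^2_0], and then
   [(C D^2 u, u, gamma_2 u)] solves the mixed problem, since the definition of
   [gamma_2] turns the first equation into an identity.  Only the Poincare and
   ellipticity constants enter the estimate, so it does not depend on the mesh.

   The space [H^2_0] is complete because the gradient of a smooth function is
   bounded in [L_2] by the function and its Hessian: from every point of a
   triangle one can move a fixed distance along two side directions without
   leaving the triangle, and on such a segment a one-dimensional inequality
   applies.

   For uniqueness, testing a solution with zero load by itself gives [M = 0];
   testing with the stress field of the Kirchhoff-Love solution for the load [u]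
   gives [u = 0], and [psi = 0] follows. *)
Require Import Defs.
From HB Require Import structures.
From mathcomp Require Import all_boot all_order all_algebra.
From mathcomp Require Import all_classical all_reals all_analysis.
From mathcomp Require Import measurable_realfun ring lra.

Set Implicit Arguments.
Unset Strict Implicit.
Unset Printing Implicit Defensive.

Import Order.TTheory GRing.Theory Num.Theory numFieldNormedType.Exports.

Local Open Scope classical_set_scope.
Local Open Scope ring_scope.

(** * Square integrable functions *)

Section SquareIntegrable.
Context d (T : measurableType d) (R : realType).
Variable mu : {measure set T -> \bar R}.
Variable D : set T.
Hypothesis mD : measurable D.
Implicit Types f g h : T -> R.

(** Elements of [L2] are functions, not classes, and [hess], [dDiv] and [Cinv] are values of a
    choice operator. Identities therefore hold almost everywhere, and the Hilbert space arguments
    run on predicates closed under linear combinations, with forms that are only semidefinite.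
    Boundary conditions are encoded by approximation: smooth functions converge together with their
    Hessians, and their data on the edges tend to zero. So each inequality is proved for smooth
    functions with a boundary term that disappears in the limit. [H2] also asks for weak first
    derivatives, which [norm2] does not contain; the gradient estimate supplies them. Its constant
    depends on the mesh, but it decides only membership in [H20] and enters no bound. The tensor
    field is known to behave only off a null set, where its pointwise inverse is a mere choice. The
    inverse is therefore built as an operator on square integrable fields, and compared with [Cinv]
    almost everywhere afterwards. The one fact needed about the skeleton is that traces of [H20]
    annihilate Kirchhoff-Love stress fields. *)

Definition sqint f :=
  measurable_fun D f /\ mu.-integrable D (EFin \o (fun x => f x ^+ 2)).

Lemma sqint_Lfun f : f \_ D \in Lfun mu 2%:E <-> sqint f.
Proof.
split=> [ff|[mf if2]].
  have mf : measurable_fun D f.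
    apply/(measurable_restrictT _ mD).
    by move: ff; rewrite inE => /andP[]; rewrite inE.
  split => //.
  apply/(integrable_mkcond _ mD).
  have := Lfun2_integrable_sqr ff; apply: eq_integrable => // x _ /=.
  by rewrite /patch; case: ifPn => //= _; rewrite expr0n.
rewrite inE; apply/andP; split; rewrite inE/=; first exact/(measurable_restrictT _ mD).
rewrite /finite_norm unlock /= poweR_lty//.
move/(integrable_mkcond _ mD)/integrableP : if2 => [_].
apply: le_lt_trans; rewrite le_eqVlt; apply/orP; left; apply/eqP.
apply: eq_integral => x _; rewrite /= /patch; case: ifPn => xD.
  by rewrite powR_mulrn//= real_normK ?num_real// ger0_norm// sqr_ge0.
by rewrite normr0 abse0 powR0.
Qed.

Lemma sqint_integrable_mul f g : sqint f -> sqint g ->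
  mu.-integrable D (EFin \o (fun x => f x * g x)).
Proof.
move=> [mf if2] [mg ig2].
apply: (le_integrable mD _ _ (integrableD mD if2 ig2)).
  by apply/measurable_EFinP; exact: measurable_funM.
move=> x Dx; rewrite /= lee_fin normrM [leRHS]ger0_norm; last first.
  by rewrite addr_ge0 ?sqr_ge0.
rewrite -[f x ^+ 2]real_normK ?num_real// -[g x ^+ 2]real_normK ?num_real//.
have := sqr_ge0 (`|f x| - `|g x|); nra.
Qed.

Lemma sqint_le f g : measurable_fun D f -> sqint g ->
  (forall x, D x -> `|f x| <= `|g x|) -> sqint f.
Proof.
move=> mf [mg ig2] fg; split => //.
apply: (le_integrable mD _ _ ig2).
  by apply/measurable_EFinP; exact: measurable_funX.
move=> x Dx /=; rewrite lee_fin !normrX.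
by rewrite lerXn2r ?nnegrE ?fg.
Qed.

Lemma sqintD f g : sqint f -> sqint g -> sqint (fun x => f x + g x).
Proof.
move=> sf sg; have ifg := sqint_integrable_mul sf sg.
case: sf sg => mf if2 [mg ig2]; split; first exact: measurable_funD.
have ifg2 := integrableZl mD 2 ifg.
have := integrableD mD (integrableD mD if2 ifg2) ig2.
by apply: eq_integrable => // x _ /=; rewrite -EFinM -!EFinD; congr (_%:E); ring.
Qed.

Lemma sqintZ (c : R) f : sqint f -> sqint (fun x => c * f x).
Proof.
move=> [mf if2]; split; first exact: measurable_funM.
have := integrableZl mD (c ^+ 2) if2.
by apply: eq_integrable => // x _ /=; rewrite -EFinM; congr (_%:E); ring.
Qed.

Lemma sqintB f g : sqint f -> sqint g -> sqint (fun x => f x - g x).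
Proof.
move=> sf /(sqintZ (-1)) sg; have := sqintD sf sg.
by under [X in sqint X -> _]eq_fun do rewrite mulN1r.
Qed.

Lemma sqint0 : sqint (fun=> 0).
Proof.
split; first exact: measurable_cst.
by under eq_fun do rewrite /= expr0n/=; exact: integrable0.
Qed.

Lemma sqint_sum (I : Type) (s : seq I) (F : I -> T -> R) :
  (forall i, sqint (F i)) -> sqint (fun x => \sum_(i <- s) F i x).
Proof.
move=> sF; elim: s => [|i s IHs].
  by under eq_fun do rewrite big_nil; exact: sqint0.
by under eq_fun do rewrite big_cons; exact: sqintD.
Qed.

Lemma eq_sqint f g : (forall x, D x -> f x = g x) -> sqint f -> sqint g.
Proof.
move=> fg [mf if2]; split; first by apply: eq_measurable_fun mf => x /[!inE] /fg.
by apply: eq_integrable if2 => // x /[!inE] /fg /= ->.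
Qed.

(** Stated for a general measure so that one development serves segments and the plane; [ip om] is
    convertible to [inn leb2 om]. *)
Definition inn f g : R := \int[mu]_(x in D) (f x * g x).

Lemma innC f g : inn f g = inn g f.
Proof. by apply: eq_Rintegral => x _; rewrite mulrC. Qed.

Lemma innDl f g h : sqint f -> sqint g -> sqint h ->
  inn (fun x => f x + g x) h = inn f h + inn g h.
Proof.
move=> sf sg sh; rewrite /inn.
under eq_Rintegral => x _ do rewrite mulrDl.
by rewrite RintegralD//; exact: sqint_integrable_mul.
Qed.

Lemma innZl (c : R) f h : sqint f -> sqint h ->
  inn (fun x => c * f x) h = c * inn f h.
Proof.
move=> sf sh; rewrite /inn.
under eq_Rintegral => x _ do rewrite -mulrA.
by rewrite RintegralZl//; exact: sqint_integrable_mul.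
Qed.

Lemma innBl f g h : sqint f -> sqint g -> sqint h ->
  inn (fun x => f x - g x) h = inn f h - inn g h.
Proof.
move=> sf sg sh; rewrite /inn.
under eq_Rintegral => x _ do rewrite mulrBl.
by rewrite RintegralB//; exact: sqint_integrable_mul.
Qed.

Lemma innDr f g h : sqint f -> sqint g -> sqint h ->
  inn h (fun x => f x + g x) = inn h f + inn h g.
Proof. by move=> *; rewrite !(innC h) innDl. Qed.

Lemma innZr (c : R) f h : sqint f -> sqint h ->
  inn h (fun x => c * f x) = c * inn h f.
Proof. by move=> *; rewrite !(innC h) innZl. Qed.

Lemma innBr f g h : sqint f -> sqint g -> sqint h ->
  inn h (fun x => f x - g x) = inn h f - inn h g.
Proof. by move=> *; rewrite !(innC h) innBl. Qed.

Lemma innB f g h k : sqint f -> sqint g -> sqint h -> sqint k ->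
  inn f g - inn h k = \int[mu]_(x in D) (f x * g x - h x * k x).
Proof. by move=> *; rewrite /inn RintegralB//; exact: sqint_integrable_mul. Qed.

Lemma inn_ge0 f : 0 <= inn f f.
Proof. by apply: Rintegral_ge0 => x _; rewrite -expr2 sqr_ge0. Qed.

Lemma eq_inn f g h k : (forall x, D x -> f x = g x) ->
  (forall x, D x -> h x = k x) -> inn f h = inn g k.
Proof.
by move=> fg hk; apply: eq_Rintegral => x /[!inE] xD; rewrite fg// hk.
Qed.

(** The squared norm of [f - t g] is a nonnegative quadratic polynomial in [t]. Its minimum gives
    the claim; when [inn g g = 0] it is affine in [t], so its slope must vanish. *)
Lemma cauchy_schwarz f g : sqint f -> sqint g ->
  inn f g ^+ 2 <= inn f f * inn g g.
Proof.
move=> sf sg.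
have H t : 0 <= inn f f - t * 2 * inn f g + t ^+ 2 * inn g g.
  have stg := sqintZ t sg.
  have := inn_ge0 (fun x => f x - t * g x).
  rewrite innBl//; last exact: sqintB.
  rewrite !innBr// !(innZr t)// !(innZl t)// (innC g f); nra.
have := inn_ge0 g; rewrite le_eqVlt => /predU1P[g0|g0]; last first.
  have := H (inn f g / inn g g).
  rewrite -(ler_pM2r g0) mul0r => /le_trans.
  move=> /(_ (inn f f * inn g g - inn f g ^+ 2)).
  rewrite subr_ge0; apply; rewrite le_eqVlt; apply/orP; left; apply/eqP.
  by field; rewrite gt_eqF.
rewrite -g0 mulr0; have [->|fg0] := eqVneq (inn f g) 0; first by rewrite expr0n.
(* At this [t] the affine function would equal [-1]. *)
have := H ((inn f f + 1) / (2 * inn f g)).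
rewrite -g0 mulr0 addr0.
have -> : (inn f f + 1) / (2 * inn f g) * 2 * inn f g = inn f f + 1.
  by field.
lra.
Qed.

Lemma EFin_inn f g : sqint f -> sqint g ->
  (inn f g)%:E = (\int[mu]_(x in D) (f x * g x)%:E)%E.
Proof.
move=> sf sg; rewrite /inn /Rintegral fineK//.
exact/integrable_fin_num/sqint_integrable_mul.
Qed.

Lemma ae_eq_inn f f' g : sqint f -> sqint f' -> sqint g ->
  {ae mu, forall x, D x -> f x = f' x} -> inn f g = inn f' g.
Proof.
move=> sf sf' sg ff'; apply: EFin_inj; rewrite !EFin_inn//.
apply: ae_eq_integral => //.
- by case: sf sg => [? _] [? _]; apply/measurable_EFinP; exact: measurable_funM.
- by case: sf' sg => [? _] [? _]; apply/measurable_EFinP; exact: measurable_funM.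
- by apply: filterS ff' => x H /H ->.
Qed.

Lemma inn_eq0 f : sqint f -> inn f f = 0 ->
  {ae mu, forall x, D x -> f x = 0}.
Proof.
move=> sf f0.
have ff := sqint_integrable_mul sf sf.
have := ae_eq_integral_abs mu mD (measurable_int mu ff).
move=> [+ _]; have -> : (\int[mu]_(x in D) `|(EFin \o (fun x => (f x * f x)%R)) x| = 0)%E.
  under eq_integral => x _ do rewrite /= ger0_norm -?expr2 ?sqr_ge0//.
  by under eq_integral => x _ do rewrite expr2; rewrite -EFin_inn// f0.
move=> /(_ erefl); apply: filterS => x H /H /= [] /eqP.
by rewrite mulf_eq0 orbb => /eqP.
Qed.

End SquareIntegrable.

Section SquareIntegrableSubset.
Context d (T : measurableType d) (R : realType).
Variable mu : {measure set T -> \bar R}.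
Variables A B : set T.
Hypotheses (mA : measurable A) (mB : measurable B) (AB : A `<=` B).
Implicit Types f g : T -> R.

Lemma sqintS f : sqint mu B f -> sqint mu A f.
Proof.
by move=> [mf if2]; split; [exact: measurable_funS mf|exact: integrableS if2].
Qed.

Lemma inn_subset f : sqint mu B f -> inn mu A f f <= inn mu B f f.
Proof.
move=> sf; have sfA := sqintS sf.
rewrite -lee_fin !EFin_inn//; apply: ge0_subset_integral => //.
  by case: sf => mf _; apply/measurable_EFinP; exact: measurable_funM.
by move=> x _; rewrite lee_fin -expr2 sqr_ge0.
Qed.

Lemma inn_supp f g : (forall x, ~ A x -> f x * g x = 0) ->
  inn mu A f g = inn mu B f g.
Proof.
move=> fg; rewrite /inn [LHS]Rintegral_mkcond [RHS]Rintegral_mkcond; apply: eq_Rintegral => x _.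
rewrite /patch; case: ifPn => xA.
  by rewrite mem_set//; apply: AB; exact: set_mem.
by case: ifPn => // _; rewrite fg// => /mem_set; exact/negP.
Qed.

End SquareIntegrableSubset.

Lemma limn_einf_le_near (R : realType) (u : (\bar R)^nat) (e : \bar R) N :
  (forall n, (N <= n)%N -> (u n <= e)%E) -> (limn_einf u <= e)%E.
Proof.
move=> ue; rewrite limn_einf_lim; apply: lime_le; first exact: is_cvg_einfs.
apply: nearW => n; rewrite /einfs /sdrop.
apply: (@le_trans _ _ (u (maxn n N))); last by apply: ue; rewrite leq_maxr.
by apply: ereal_inf_lbound; exists (maxn n N) => //=; rewrite leq_maxl.
Qed.

(** * Completeness of L2 on a set of finite measure *)

Section RieszFischer.
Context d (T : measurableType d) (R : realType).
Variable mu : {measure set T -> \bar R}.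
Variable D : set T.
Hypotheses (mD : measurable D) (muD : (mu D < +oo)%E).
Implicit Types f g h : T -> R.
Local Notation sqint := (sqint mu D).
Local Notation inn := (inn mu D).

Lemma sqint_cst (c : R) : sqint (fun=> c).
Proof.
split; first exact: measurable_cst.
apply: measurable_bounded_integrable => //; exists `|c ^+ 2|; split => // x cx y _ /=.
exact: ltW.
Qed.

(** Cauchy-Schwarz against the constant [1], which is square integrable because [D] has finite
    measure. It turns small increments in L2 into summable ones in L1. *)
Lemma integral_norm_le_inn f : sqint f ->
  (\int[mu]_(x in D) `|f x|%:E <= (Num.sqrt (fine (mu D) * inn f f))%:E)%E.
Proof.
move=> sf; have sn : sqint (fun x => `|f x|).
  apply: (@sqint_le _ _ _ mu _ mD _ f) => //; last by move=> x _; rewrite normr_id.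
  by apply: measurableT_comp => //; case: sf.
have s1 := sqint_cst 1.
have -> : (\int[mu]_(x in D) `|f x|%:E)%E = (inn (fun=> 1) (fun x => `|f x|))%:E.
  by rewrite EFin_inn//; apply: eq_integral => x _; rewrite mul1r.
rewrite lee_fin -[leLHS]ger0_norm; last first.
  by apply: Rintegral_ge0 => x _; rewrite mul1r.
rewrite -sqrtr_sqr ler_wsqrtr// (le_trans (cauchy_schwarz mD s1 sn))//.
rewrite {1}/inn; under eq_Rintegral do rewrite mulr1.
rewrite Rintegral_cst// mul1r le_eqVlt; apply/orP; left; apply/eqP; congr (_ * _).
by apply: eq_Rintegral => x _; rewrite -normrM ger0_norm// -expr2 sqr_ge0.
Qed.

(** A subsequence with rapidly decreasing increments converges absolutely almost everywhere; Fatou's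
    lemma shows that the whole sequence converges to its limit in mean square. *)
Lemma riesz_fischer (f : nat -> T -> R) : (forall n, sqint (f n)) ->
  (forall e, 0 < e -> exists N, forall m n, (N <= m)%N -> (N <= n)%N ->
    inn (fun x => f m x - f n x) (fun x => f m x - f n x) <= e) ->
  exists2 g, sqint g &
    (fun n => inn (fun x => f n x - g x) (fun x => f n x - g x)) @ \oo --> (0 : R).
Proof.
move=> sf cf.
(* The tolerance bounds a squared norm, so the norms of the increments are at most [2^-1 ^+ k],
   which is summable. *)
have e4 k : 0 < (4^-1 : R) ^+ k by rewrite exprn_gt0.
have /choice[idx idxP] k := cf _ (e4 k).
(* Summing the indices gives a nondecreasing sequence with [idx k <= s k]. *)
pose s k := (\sum_(i < k.+1) idx i)%N.
have idx_s k : (idx k <= s k)%N by rewrite /s big_ord_recr /= leq_addl.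
have s_mono k j : (k <= j)%N -> (s k <= s j)%N.
  move=> kj; rewrite -(subnKC kj); elim: (j - k)%N => [|i IH]; first by rewrite addn0.
  by rewrite (leq_trans IH)// addnS /s [leqRHS]big_ord_recr /= leq_addr.
pose a k := f (s k).
have sa k : sqint (a k) by exact: sf.
pose u k x : R := `|a k.+1 x - a k x|.
have u0 k x : 0 <= u k x by exact: normr_ge0.
have su k : sqint (fun x => a k.+1 x - a k x) by exact: sqintB.
have mu_ k : measurable_fun D (u k).
  by apply: measurableT_comp => //; case: (su k).
have int_u k : (\int[mu]_(x in D) (u k x)%:E <=
    (Num.sqrt (fine (mu D)) * (2^-1) ^+ k)%:E)%E.
  apply: (le_trans (integral_norm_le_inn (su k))); rewrite lee_fin.
  rewrite sqrtrM ?fine_ge0// ler_wpM2l ?sqrtr_ge0//.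
  have -> : (2^-1) ^+ k = Num.sqrt ((4^-1 : R) ^+ k).
    rewrite -[(2^-1) ^+ k]ger0_norm ?exprn_ge0// -sqrtr_sqr -exprM mulnC exprM.
    by congr (Num.sqrt (_ ^+ k)); field.
  by apply/ler_wsqrtr/idxP; rewrite (leq_trans (idx_s _))// s_mono.
have sum_u : (\int[mu]_(x in D) \sum_(0 <= k <oo) (u k x)%:E < +oo)%E.
  rewrite integral_nneseries//; last 2 first.
    by move=> k; apply/measurable_EFinP; exact: mu_.
    by move=> k x _; rewrite lee_fin u0.
  have c0 : 0 <= Num.sqrt (fine (mu D)) * 2 by rewrite mulr_ge0 ?sqrtr_ge0.
  apply: le_lt_trans (le_lt_trans (epsilon_trick0 xpredT c0) (ltry _)).
  apply: lee_nneseries => k _.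
    by move=> _; apply: integral_ge0 => x _; rewrite lee_fin u0.
  apply: (le_trans (int_u k)); rewrite lee_fin -mulrA ler_wpM2l ?sqrtr_ge0//.
  by rewrite natrX exprS invfM mulrA divff// mul1r exprVn.
have mS : measurable_fun D (fun x => (\sum_(0 <= k <oo) (u k x)%:E)%E).
  apply: ge0_emeasurable_sum => //; first by move=> k x Dx _; rewrite lee_fin u0.
  by move=> k _; apply/measurable_EFinP; exact: mu_.
have : {ae mu, forall x, D x -> (\sum_(0 <= k <oo) (u k x)%:E)%E \is a fin_num}.
  apply: integrable_ae => //; apply/integrableP; split => //.
  rewrite (eq_integral (fun x => \sum_(0 <= k <oo) (u k x)%:E)%E)// => x _.
  by rewrite gee0_abs// nneseries_ge0// => k _ _; rewrite lee_fin u0.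
case=> N [mN muN0 NP].
(* Cutting off the null set makes the sequence converge at every point of [D], so its limit is
   measurable. *)
pose b k x := a k x * \1_(~` N) x.
have mb k : measurable_fun D (b k).
  apply: measurable_funM; first by case: (sa k).
  by apply: measurable_indic; exact: measurableC.
have sb k : sqint (b k).
  apply: (sqint_le mD (mb k) (sa k)) => x Dx.
  rewrite /b indicE; case: (_ \in _); rewrite /= ?mulr1// mulr0 normr0.
  exact: normr_ge0.
have ab k : {ae mu, forall x, D x -> b k x = a k x}.
  exists N; split => // x; apply: contra_notP => Nx Dx.
  by rewrite /b indicE mem_set ?mulr1.
have cvgb x : D x -> cvgn (b^~ x).
  move=> Dx; rewrite /b indicE; case: (boolP (x \in ~` N)) => xN; last first.
    by under eq_fun do rewrite mulr0; exact: is_cvg_cst.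
  under eq_fun do rewrite mulr1.
  have : (\sum_(0 <= k <oo) (u k x)%:E)%E \is a fin_num.
    apply: contrapT => H; move: xN; rewrite inE; apply; apply: NP => /=.
    by move=> /(_ Dx).
  rewrite fin_numElt => /andP[_ /nnseries_is_cvg] /(_ (fun=> normr_ge0 _)) cvu.
  have cvt : cvgn (series (telescope (a^~ x))) by exact: normed_cvg.
  have -> : a^~ x = (fun k => a 0%N x + series (telescope (a^~ x)) k).
    by apply/funext => k; rewrite -(eq_sum_telescope (a^~ x)).
  by apply: is_cvgD => //; exact: is_cvg_cst.
pose g x := limn (b^~ x).
have mg : measurable_fun D g by apply: (measurable_fun_cvg mb) => x /cvgb.
(* Fatou's lemma in the index of the subsequence, with [n] fixed. *)
have key k n : (idx k <= n)%N ->
    (\int[mu]_(x in D) ((f n x - g x) ^+ 2)%:E <= (4^-1 ^+ k)%:E)%E.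
  move=> kn; pose F j x := ((f n x - b j x) ^+ 2)%:E.
  have mF j : measurable_fun D (F j).
    apply/measurable_EFinP/measurable_funX/measurable_funB => //.
    by case: (sf n).
  have F0 j x : D x -> (0 <= F j x)%E by rewrite lee_fin sqr_ge0.
  have := fatou mu mD mF F0.
  rewrite (eq_integral (fun x => ((f n x - g x) ^+ 2)%:E)); last first.
    move=> x /[!inE] Dx.
    suff cF : (F j x @[j --> \oo] --> ((f n x - g x) ^+ 2)%:E)%E.
      by rewrite (cvg_limn_einf_sup cF).1.
    apply: cvg_EFin; first exact: nearW.
    rewrite (_ : fine \o F^~ x = (fun j => (f n x - b j x) * (f n x - b j x))).
      have cfb : (f n x - b j x) @[j --> \oo] --> f n x - g x.
        by apply: cvgB; [exact: cvg_cst|exact: cvgb].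
      by rewrite expr2; exact: cvgM.
    by apply/funext => j; rewrite /F /= expr2.
  move=> /le_trans; apply; apply: (@limn_einf_le_near _ _ _ k) => j kj.
  have sfa := sqintB mD (sf n) (sa j); have sfb := sqintB mD (sf n) (sb j).
  under eq_integral => x _ do rewrite /F expr2.
  rewrite -EFin_inn// lee_fin.
  have aefab : {ae mu, forall x, D x -> f n x - b j x = f n x - a j x}.
    by apply: filterS (ab j) => x H /H ->.
  rewrite (ae_eq_inn mD sfb sfa sfb aefab) innC (ae_eq_inn mD sfb sfa sfa aefab).
  by apply: idxP => //; rewrite (leq_trans (idx_s k))// s_mono.
have sfg k n : (idx k <= n)%N -> sqint (fun x => f n x - g x).
  move=> kn; have mfg : measurable_fun D (fun x => f n x - g x).
    by apply: measurable_funB => //; case: (sf n).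
  split => //; apply/integrableP; split.
    by apply/measurable_EFinP/measurable_funX.
  under eq_integral do rewrite /= ger0_norm ?sqr_ge0//.
  by rewrite (le_lt_trans (key _ _ kn))// ltry.
exists g.
  have := sqintB mD (sf (idx 0%N)) (sfg 0%N (idx 0%N) (leqnn _)).
  by apply: (eq_sqint mD) => x _; ring.
apply/cvgrPdist_le => e e0.
have [k ke] : exists k, (4^-1 : R) ^+ k <= e.
  have : (fun k => (4^-1 : R) ^+ k) @ \oo --> (0 : R).
    by apply: cvg_expr; rewrite ger0_norm// invf_lt1// ltr1n.
  move=> /cvgrPdist_le /(_ _ e0) [k _ /(_ k (leqnn _))] /=.
  by rewrite sub0r normrN ger0_norm ?exprn_ge0//; exists k.
exists (idx k) => // n /= kn; rewrite sub0r normrN ger0_norm ?inn_ge0//.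
rewrite (le_trans _ ke)// -lee_fin EFin_inn//; try exact: sfg kn.
by apply: le_trans (key _ _ kn); under eq_integral do rewrite -expr2.
Qed.

End RieszFischer.

(** * Inequalities on the line *)

Section ContinuousAlgebra.
Context {R : realType} {T : topologicalType}.
Implicit Types f g : T -> R.

Lemma continuous_add f g : continuous f -> continuous g ->
  continuous (fun t => f t + g t).
Proof. by move=> cf cg t; apply: cvgD; [exact: cf|exact: cg]. Qed.

Lemma continuous_sub f g : continuous f -> continuous g ->
  continuous (fun t => f t - g t).
Proof. by move=> cf cg t; apply: cvgB; [exact: cf|exact: cg]. Qed.

Lemma continuous_mul f g : continuous f -> continuous g ->
  continuous (fun t => f t * g t).
Proof. by move=> cf cg t; apply: cvgM; [exact: cf|exact: cg]. Qed.

Lemma continuous_cst (c : R) : continuous (fun _ : T => c).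
Proof. by move=> t; exact: cvg_cst. Qed.

End ContinuousAlgebra.

Section RealLine.
Context {R : realType}.
Implicit Types (f g : R -> R) (a b x : R).
Local Notation leb := (@lebesgue_measure R).

Lemma sqrB_le (x y : R) : (x - y) ^+ 2 <= 2 * x ^+ 2 + 2 * y ^+ 2.
Proof. by have := sqr_ge0 (x + y); nra. Qed.

(** The hypotheses on [A] and [B] have the form in which [inn_itv_le] bounds the kernel of
    [deriv_kernel] on [[0, 1]]; [72] is [2 * 6 ^+ 2]. *)
Lemma sqrB_le_weighted (x y A B X Y : R) :
  x ^+ 2 <= A * X -> y ^+ 2 <= B * Y -> A <= 1 ^+ 2 * (1 - 0) -> B <= 6 ^+ 2 * (1 - 0) ->
  0 <= X -> 0 <= Y -> (x - y) ^+ 2 <= 72 * Y + 2 * X.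
Proof.
move=> xX yY A1 B1 X0 Y0; apply: (le_trans (sqrB_le _ _)).
have : A * X <= 1 * X by rewrite ler_wpM2r//; lra.
have : B * Y <= 36 * Y by rewrite ler_wpM2r//; lra.
lra.
Qed.

Lemma measurable_itvR (i : interval R) :
  measurable ([set` i] : set (measurableTypeR R)).
Proof. exact: measurable_itv. Qed.

Lemma ftc_line f g a b : a <= b -> (forall x : R, is_derive x 1 f (g x)) ->
  continuous g -> \int[leb]_(x in `[a, b]) g x = f b - f a.
Proof.
move=> ab df cg; rewrite /Rintegral; move: ab; rewrite le_eqVlt => /predU1P[<-|ab].
  by rewrite set_itv1 integral_set1 subrr.
have cf x : {for x, continuous f}.
  by apply/differentiable_continuous/derivable1_diffP; case: (df x).
rewrite (@continuous_FTC2 _ g f)//.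
- by apply: continuous_subspaceT => x; exact: cg.
- split.
  + by move=> x _; case: (df x).
  + exact/cvg_at_right_filter/cf.
  + exact/cvg_at_left_filter/cf.
- by move=> x _; rewrite derive1E; case: (df x).
Qed.

Lemma is_derive_continuous f g : (forall x : R, is_derive x 1 f (g x)) -> continuous f.
Proof.
by move=> df x; apply/differentiable_continuous/derivable1_diffP; case: (df x).
Qed.

Lemma continuous_integrable_itv f a b : continuous f ->
  leb.-integrable `[a, b] (EFin \o f).
Proof.
move=> cf; apply: continuous_compact_integrable; first exact: segment_compact.
exact: continuous_subspaceT.
Qed.

Lemma continuous_sqint f a b : continuous f -> sqint leb `[a, b] f.
Proof.
move=> cf; split; first by apply: measurable_funTS; exact: continuous_measurable_fun.
apply: continuous_integrable_itv => x; rewrite (_ : (fun x => _) = f \* f)//.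
by apply: continuousM; exact: cf.
Qed.

Lemma inn_itv_le f a b (c : R) : a <= b -> continuous f ->
  (forall x, a <= x <= b -> `|f x| <= c) -> inn leb `[a, b] f f <= c ^+ 2 * (b - a).
Proof.
move=> ab cf fc; rewrite /inn.
have := @Rintegral_cst _ _ _ leb `[a, b] (measurable_itv _) (c ^+ 2).
rewrite [X in fine X](_ : _ = (if (a < b)%R then (b - a)%:E else 0)%E); last first.
  by have := lebesgue_measure_itv `[a, b]; rewrite /= lte_fin EFinB.
move: ab.
rewrite le_eqVlt => /predU1P[<- _|ab].
  by rewrite subrr mulr0 set_itv1 Rintegral_set1.
rewrite ab => <-; apply: le_Rintegral => //.
- by have := continuous_sqint a b cf; move=> /sqint_integrable_mul; apply => //; exact: continuous_sqint.
- by apply: continuous_integrable_itv => x; exact: cvg_cst.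
- move=> x /=; rewrite in_itv/= => /fc fxc.
  by rewrite -expr2 -real_normK ?num_real// lerXn2r// nnegrE (le_trans _ fxc).
Qed.

(** Integrating [f2] by parts against [t - a] on [[a, x]] and against [b - t] on [[x, b]] gives two
    relations between [f x] and [f1 x]; a convex combination eliminates [f1 x]. Both end values must
    appear, since an affine [f] has [f2 = 0]. *)
Lemma sqr_chord_bound f f1 f2 a b x : a < x < b ->
  (forall t : R, is_derive t 1 f (f1 t)) -> (forall t : R, is_derive t 1 f1 (f2 t)) ->
  continuous f2 ->
  f x ^+ 2 <= 3 * f a ^+ 2 + 3 * f b ^+ 2 +
    3 * (b - a) ^+ 3 * inn leb `[a, b] f2 f2.
Proof.
move=> /andP[ax xb] df df1 cf2.
have ab : a < b by exact: lt_trans xb.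
have cid (c : R) : continuous (fun t : R => t - c).
  by move=> t; apply: continuousB; [exact: cvg_id|exact: cvg_cst].
have cid' (c : R) : continuous (fun t : R => c - t).
  by move=> t; apply: continuousB; [exact: cvg_cst|exact: cvg_id].
(* Each weight is at most the length of its interval, which explains the third power. *)
have smul (g : R -> R) u v : a <= u -> u <= v -> v <= b -> continuous g ->
    (forall t, u <= t <= v -> `|g t| <= v - u) ->
    inn leb `[u, v] g f2 ^+ 2 <= (b - a) ^+ 3 * inn leb `[a, b] f2 f2.
  move=> au uv vb cg gb.
  have sub : `[u, v] `<=` `[a, b].
    by move=> t /=; rewrite !in_itv/= => /andP[ut tv]; apply/andP; split; lra.
  have := cauchy_schwarz (measurable_itvR _) (continuous_sqint u v cg) (continuous_sqint u v cf2).
  move=> /le_trans; apply.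
  apply: ler_pM; rewrite ?inn_ge0//; last first.
    by apply: inn_subset; [exact: measurable_itvR|exact: measurable_itvR|exact: sub|exact: continuous_sqint].
  rewrite (le_trans (inn_itv_le uv cg gb))// -exprSr lerXn2r ?nnegrE; lra.
have I1 : inn leb `[a, x] (fun t => t - a) f2 = (x - a) * f1 x - f x + f a.
  have cG : continuous (fun t : R => (t - a) * f2 t).
    exact: continuous_mul (cid a) cf2.
  pose F (t : R) : R := (t - a) * f1 t - f t.
  transitivity (F x - F a); last by rewrite /F; ring.
  apply: ftc_line; first exact: ltW.
  - move=> t; have := df t; have := df1 t; move=> d1 d2.
    by apply: is_derive_eq; rewrite /GRing.scale/=; ring.
  - exact: cG.
have I2 : inn leb `[x, b] (fun t => b - t) f2 = f b - (b - x) * f1 x - f x.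
  have cG : continuous (fun t : R => (b - t) * f2 t).
    exact: continuous_mul (cid' b) cf2.
  pose F (t : R) : R := (b - t) * f1 t + f t.
  transitivity (F b - F x); last by rewrite /F; ring.
  apply: ftc_line; first exact: ltW.
  - move=> t; have := df t; have := df1 t; move=> d1 d2.
    by apply: is_derive_eq; rewrite /GRing.scale/=; ring.
  - exact: cG.
have K1 := smul (fun t => t - a) a x (lexx _) (ltW ax) (ltW xb) (cid a).
have K2 := smul (fun t => b - t) x b (ltW ax) (ltW xb) (lexx _) (cid' b).
rewrite I1 in K1; rewrite I2 in K2.
have {}K1 : ((x - a) * f1 x - f x + f a) ^+ 2 <= (b - a) ^+ 3 * inn leb `[a, b] f2 f2.
  by apply: K1 => t ?; rewrite ger0_norm; lra.
have {}K2 : (f b - (b - x) * f1 x - f x) ^+ 2 <= (b - a) ^+ 3 * inn leb `[a, b] f2 f2.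
  by apply: K2 => t ?; rewrite ger0_norm; lra.
set K := (b - a) ^+ 3 * _ in K1 K2.
rewrite -mulrA -/K.
(* Weights with [be * (x - a) = al * (b - x)], so that [f1 x] cancels in [be * p + al * q]. *)
pose al := (x - a) / (b - a); pose be := (b - x) / (b - a).
have albe : al + be = 1 by rewrite /al /be; field; rewrite subr_eq0 gt_eqF.
have al0 : 0 <= al by rewrite divr_ge0//; lra.
have be0 : 0 <= be by rewrite divr_ge0//; lra.
set p := _ + f a in K1; set q := _ - f x in K2.
have -> : f x = be * f a + al * f b - (be * p + al * q).
  by rewrite /p /q /al /be; field; rewrite subr_eq0 gt_eqF.
have H1 : (be * p + al * q) ^+ 2 <= K.
  have : (be * p + al * q) ^+ 2 <= be * p ^+ 2 + al * q ^+ 2.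
    rewrite -subr_ge0 (_ : _ - _ = be * al * (p - q) ^+ 2).
      by apply: mulr_ge0; [exact: mulr_ge0|exact: sqr_ge0].
    by rewrite (_ : be = 1 - al); [ring|lra].
  move=> /le_trans; apply.
  rewrite (_ : K = be * K + al * K); last by rewrite -mulrDl addrC albe mul1r.
  by rewrite lerD// ler_wpM2l.
have H2 : (be * f a) ^+ 2 <= f a ^+ 2.
  by rewrite exprMn ler_piMl ?sqr_ge0// expr_le1//; lra.
have H3 : (al * f b) ^+ 2 <= f b ^+ 2.
  by rewrite exprMn ler_piMl ?sqr_ge0// expr_le1//; lra.
set r := be * f a in H2 *; set s := al * f b in H3 *; set w := _ + al * q in H1 *.
have : (r + s - w) ^+ 2 <= 3 * r ^+ 2 + 3 * s ^+ 2 + 3 * w ^+ 2.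
  have := sqr_ge0 (r - s); have := sqr_ge0 (r + w); have := sqr_ge0 (s + w).
  nra.
lra.
Qed.

(** The kernel is minus the cubic Hermite polynomial with value [1] at [0], value [0] at [1] and
    zero slope at both ends. *)
Lemma deriv_kernel : exists eta eta1 eta2 : R -> R,
  [/\ (forall t : R, is_derive t 1 eta (eta1 t)) /\
        (forall t : R, is_derive t 1 eta1 (eta2 t)), continuous eta2,
      eta 0 = -1 /\ eta1 0 = 0, eta 1 = 0 /\ eta1 1 = 0 &
      forall t, 0 <= t <= 1 -> `|eta t| <= 1 /\ `|eta2 t| <= 6].
Proof.
exists (fun t => - ((1 - t) ^+ 2 * (1 + 2 * t))), (fun t => 6 * t * (1 - t)).
exists (fun t => 6 - 12 * t); split.
- by split=> t; apply: is_derive_eq; rewrite /GRing.scale/=; ring.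
- apply: continuous_sub; first exact: continuous_cst.
  by apply: continuous_mul; [exact: continuous_cst|move=> t; exact: cvg_id].
- by split; ring.
- by split; ring.
- move=> t /andP[t0 t1]; split; rewrite ler_norml; last by apply/andP; split; lra.
  by apply/andP; split; nra.
Qed.

(* Integrating [eta f'' - eta'' f], where [eta 0 = -1] and
   [eta' 0 = eta 1 = eta' 1 = 0], isolates [f' 0]. *)
Lemma sqr_deriv_bound f f1 f2 :
  (forall t : R, is_derive t 1 f (f1 t)) -> (forall t : R, is_derive t 1 f1 (f2 t)) ->
  continuous f2 ->
  f1 0 ^+ 2 <= 72 * inn leb `[0, 1] f f + 2 * inn leb `[0, 1] f2 f2.
Proof.
move=> df df1 cf2.
have cf : continuous f := is_derive_continuous df.
have [eta [eta1 [eta2 [[deta deta1] ceta2 [e0 e10] [e1 e11] eb]]]] := deriv_kernel.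
have ceta := is_derive_continuous deta.
have m01 := measurable_itvR `[0, 1].
have cG : continuous (fun t : R => eta t * f2 t - eta2 t * f t).
  exact: continuous_sub (continuous_mul ceta cf2) (continuous_mul ceta2 cf).
have seta := continuous_sqint 0 1 ceta; have seta2 := continuous_sqint 0 1 ceta2.
have sf := continuous_sqint 0 1 cf; have sf2 := continuous_sqint 0 1 cf2.
have dF (t : R) :
    is_derive t 1 (fun t => eta t * f1 t - eta1 t * f t) (eta t * f2 t - eta2 t * f t).
  have := df t; have := df1 t; have := deta t; have := deta1 t.
  by move=> d1 d2 d3 d4; apply: is_derive_eq; rewrite /GRing.scale/=; ring.
have H : inn leb `[0, 1] eta f2 - inn leb `[0, 1] eta2 f = f1 0.
  rewrite (innB m01)//; have := ftc_line ler01 dF cG; rewrite e0 e10 e1 e11 => ->.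
  by ring.
have K1 := cauchy_schwarz m01 seta sf2; have K2 := cauchy_schwarz m01 seta2 sf.
have L1 : inn leb `[0, 1] eta eta <= 1 ^+ 2 * (1 - 0).
  by apply: inn_itv_le => // t /eb[].
have L2 : inn leb `[0, 1] eta2 eta2 <= 6 ^+ 2 * (1 - 0).
  by apply: inn_itv_le => // t /eb[].
by rewrite -H (sqrB_le_weighted K1 K2)// inn_ge0.
Qed.

End RealLine.

(** * Calculus in the plane *)

Section Plane.
Context {R : realType}.
Implicit Types (A om : set (R * R)) (p q v : R * R) (f g : R * R -> R).
Local Notation leb := (@lebesgue_measure R).
Local Notation plane := (measurableTypeR R * measurableTypeR R)%type.

Definition obox (a b c d : R) : set (R * R) :=
  [set p | [/\ a < p.1, p.1 < b, c < p.2 & p.2 < d]].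

Definition cbox (a b c d : R) : set (R * R) :=
  [set p | [/\ a <= p.1, p.1 <= b, c <= p.2 & p.2 <= d]].

Lemma obox_cbox a b c d : obox a b c d `<=` cbox a b c d.
Proof. by move=> p [? ? ? ?]; split; exact: ltW. Qed.

Lemma oboxE a b c d : obox a b c d = `]a, b[ `*` `]c, d[.
Proof.
apply/seteqP; split=> p /=; rewrite !in_itv/=.
  by move=> [-> -> -> ->].
by move=> [/andP[? ?] /andP[? ?]]; split.
Qed.

Lemma cboxE a b c d : cbox a b c d = `[a, b] `*` `[c, d].
Proof.
apply/seteqP; split=> p /=; rewrite !in_itv/=.
  by move=> [-> -> -> ->].
by move=> [/andP[? ?] /andP[? ?]]; split.
Qed.

Lemma measurable_obox a b c d : measurable (obox a b c d : set plane).
Proof. by rewrite oboxE; apply: measurableX; exact: measurable_itvR. Qed.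

Lemma measurable_cbox a b c d : measurable (cbox a b c d : set plane).
Proof. by rewrite cboxE; apply: measurableX; exact: measurable_itvR. Qed.

Lemma compact_cbox a b c d : compact (cbox a b c d).
Proof. by rewrite cboxE; apply: compact_setX; exact: segment_compact. Qed.

Lemma ballP2 p e q : ball p e q <-> `|p.1 - q.1| < e /\ `|p.2 - q.2| < e.
Proof. by []. Qed.

(** Rational boxes form a countable base. The closed box is kept inside [A] too, because a bump
    function on the open box has its support in the closed one. *)
Lemma open_rat_box A p : open A -> A p -> exists q : (rat * rat) * (rat * rat),
  obox (ratr q.1.1) (ratr q.1.2) (ratr q.2.1) (ratr q.2.2) p /\
  cbox (ratr q.1.1) (ratr q.1.2) (ratr q.2.1) (ratr q.2.2) `<=` A.
Proof.
move=> oA Ap; have : nbhs p A by exact: open_nbhs_nbhs.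
move=> /nbhs_ballP[e /= e0 pA].
have ex (x : R) : exists a b : rat, [/\ x - e < ratr a, ratr a < x, x < ratr b & ratr b < x + e].
  have xe1 : x - e < x by lra.
  have xe2 : x < x + e by lra.
  have [a] := rat_in_itvoo xe1; have [b] := rat_in_itvoo xe2.
  by rewrite !in_itv/= => /andP[? ?] /andP[? ?]; exists a, b.
have [a [b [? ? ? ?]]] := ex p.1; have [c [d [? ? ? ?]]] := ex p.2.
exists ((a, b), (c, d)); split; first by split.
by move=> q [/= ? ? ? ?]; apply/pA/ballP2; rewrite !ltr_distl; split; apply/andP; split; lra.
Qed.

Lemma open_measurable_plane A : open A -> measurable (A : set plane).
Proof.
move=> oA; pose F (q : (rat * rat) * (rat * rat)) : set plane :=
  [set p | obox (ratr q.1.1) (ratr q.1.2) (ratr q.2.1) (ratr q.2.2) p /\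
           cbox (ratr q.1.1) (ratr q.1.2) (ratr q.2.1) (ratr q.2.2) `<=` A].
have -> : A = \bigcup_q F q.
  apply/seteqP; split=> [p Ap|p [q _ [pq qA]]].
    by have [q [pq qA]] := open_rat_box oA Ap; exists q.
  exact/qA/obox_cbox.
apply: countable_bigcupT_measurable; first exact: countableP.
move=> q.
have [qA|qA] := pselect (cbox (ratr q.1.1) (ratr q.1.2) (ratr q.2.1) (ratr q.2.2) `<=` A).
  rewrite (_ : F q = obox (ratr q.1.1) (ratr q.1.2) (ratr q.2.1) (ratr q.2.2)); first exact: measurable_obox.
  by apply/seteqP; split=> [p []|p].
by rewrite (_ : F q = set0)//; apply/seteqP; split=> // p [_ /qA].
Qed.

Lemma closed_measurable_plane A : closed A -> measurable (A : set plane).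
Proof.
move=> cA; rewrite -[A]setCK; apply: measurableC.
by apply: open_measurable_plane; exact: closed_openC.
Qed.

Lemma continuous_measurable_plane f (D : set plane) : continuous f ->
  measurable_fun D (f : plane -> R).
Proof.
move=> cf; apply: (measurable_funS measurableT) => //.
apply: (measurability _ (RGenOpens.measurableE R)).
move=> _ [_ [a [b ->] <-]]; rewrite setTI; apply: open_measurable_plane.
by move/continuousP : cf; apply; exact: interval_open.
Qed.

Lemma bounded_cbox om : bounded_set om -> exists B : R, 0 < B /\ om `<=` cbox (- B) B (- B) B.
Proof.
move=> [M [_ bM]]; exists (`|M| + 1); split; first by rewrite ltr_wpDl.
move=> p omp; have := bM (`|M| + 1) _ p omp.
have -> : M < `|M| + 1 by rewrite (le_lt_trans (ler_norm M))// ltrDl.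
move=> /(_ erefl); rewrite /= prod_normE ge_max => /andP[].
by rewrite !ler_norml => /andP[? ?] /andP[? ?]; split.
Qed.

Lemma leb2_cbox_lty a b c d : (leb2 (cbox a b c d : set plane) < +oo)%E.
Proof.
rewrite cboxE /leb2 product_measure1E; [|exact: measurable_itvR|exact: measurable_itvR].
by rewrite /= !lebesgue_measure_itv /=; case: ifP; case: ifP => _ _; rewrite -?EFinB -?EFinM ?mule0 ?mul0e ltry.
Qed.

Lemma bounded_leb2_lty om : measurable (om : set plane) -> bounded_set om ->
  (leb2 (om : set plane) < +oo)%E.
Proof.
move=> mom /bounded_cbox[B [_ omB]]; apply: le_lt_trans (leb2_cbox_lty (- B) B (- B) B).
by apply: le_measure => //; rewrite inE//; exact: measurable_cbox.
Qed.

Lemma continuous_bounded_cbox f a b c d : continuous f ->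
  exists M, forall p, cbox a b c d p -> `|f p| <= M.
Proof.
move=> cf; have := continuous_compact (continuous_subspaceT cf) (@compact_cbox a b c d).
move=> /compact_bounded[M [_ bM]]; exists (`|M| + 1) => p pb.
apply: bM; last by exists p.
by rewrite (le_lt_trans (ler_norm M))// ltrDl.
Qed.

Lemma continuous_sqint_plane f om : measurable (om : set plane) -> bounded_set om ->
  continuous f -> sqint leb2 om f.
Proof.
move=> mom bom cf; have [B [_ omB]] := bounded_cbox bom.
have [M fM] := @continuous_bounded_cbox f (- B) B (- B) B cf.
apply: (@sqint_le _ _ _ leb2 om mom f (fun=> M)).
- exact: continuous_measurable_plane.
- exact/sqint_cst/bounded_leb2_lty.
- by move=> p /omB /fM; move=> fpM; rewrite (le_trans fpM)// ler_norm.
Qed.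

End Plane.

Section PlaneCalculus.
Context {R : realType}.
Implicit Types (p q v : R * R) (f g h phi : R * R -> R) (i j : 'I_2).
Local Notation leb := (@lebesgue_measure R).
Local Notation i0 := (ord0 : 'I_2).
Local Notation i1 := (ord_max : 'I_2).

Lemma ord2P i : i = i0 \/ i = i1.
Proof. by case: i => [[|[|//]]] ?; [left|right]; apply/val_inj. Qed.

Definition C1 f := forall i, continuous (pd i f) /\ forall p, derivable f p (evec i).

Lemma line_pt p v (t : R) : p + t *: v = (p.1 + t * v.1, p.2 + t * v.2).
Proof. by []. Qed.

Lemma is_deriveP (V : normedModType R) (f : V -> R) (a v : V) (d : R) :
  is_derive a v f d <-> (h^-1 * (f (h *: v + a) - f a)) @[h --> (0 : R)^'] --> d.
Proof.
split=> [[df <-]|fd]; first exact: df.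
by apply: DeriveDef; [apply/cvg_ex; exists d; exact: fd|exact: cvg_lim fd].
Qed.

Lemma is_derive_line f p v (t d : R) :
  is_derive (p + t *: v) v f d <-> is_derive t 1 (fun s : R => f (p + s *: v)) d.
Proof.
rewrite !is_deriveP.
suff -> : (fun h : R => h^-1 * (f (p + (h *: 1 + t) *: v) - f (p + t *: v))) =
          (fun h : R => h^-1 * (f (h *: v + (p + t *: v)) - f (p + t *: v))) by [].
apply/funext => h; congr (_ * (f _ - _)).
have -> : h%:A = h :> R by rewrite /GRing.scale /= mulr1.
by rewrite scalerDl addrCA.
Qed.

Lemma C1_derive_fst f : C1 f -> forall (x y : R),
  is_derive x 1 (fun s => f (s, y)) (pd i0 f (x, y)).
Proof.
move=> /(_ i0)[_ df] x y.
pose a : R * R := (0, y); pose e : R * R := (1, 0).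
have /(is_derive_line _ a e) : is_derive (a + x *: e) e f (pd i0 f (x, y)).
  rewrite (_ : _ + _ = (x, y)); first exact: DeriveDef (df _) erefl.
  by rewrite line_pt /= !(add0r, mulr1, mulr0, addr0).
suff -> : (fun s : R => f (a + s *: e)) = (fun s => f (s, y)) by [].
by apply/funext => s; rewrite line_pt /= !(add0r, mulr1, mulr0, addr0).
Qed.

Lemma C1_derive_snd f : C1 f -> forall (x y : R),
  is_derive y 1 (fun s => f (x, s)) (pd i1 f (x, y)).
Proof.
move=> /(_ i1)[_ df] x y.
pose a : R * R := (x, 0); pose e : R * R := (0, 1).
have /(is_derive_line _ a e) : is_derive (a + y *: e) e f (pd i1 f (x, y)).
  rewrite (_ : _ + _ = (x, y)); first exact: DeriveDef (df _) erefl.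
  by rewrite line_pt /= !(add0r, mulr1, mulr0, addr0).
suff -> : (fun s : R => f (a + s *: e)) = (fun s => f (x, s)) by [].
by apply/funext => s; rewrite line_pt /= !(add0r, mulr1, mulr0, addr0).
Qed.

(** Increments of either sign occur in difference quotients; hence the position of [c] is expressed
    by a distance. *)
Lemma mean_value (g dg : R -> R) (a b : R) : (forall x : R, is_derive x 1 g (dg x)) ->
  exists c, `|c - a| <= `|b - a| /\ g b - g a = dg c * (b - a).
Proof.
move=> dgg; have cg := is_derive_continuous dgg.
have sub (x y : R) : {within `[x, y], continuous g} by exact: continuous_subspaceT.
have [ab|/ltW ba] := leP a b.
  have [c + E] := MVT_segment ab (fun x _ => dgg x) (sub a b).
  rewrite in_itv/= => /andP[ac cb]; exists c; split => //.
  by rewrite !ger0_norm; lra.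
have [c + E] := MVT_segment ba (fun x _ => dgg x) (sub b a).
rewrite in_itv/= => /andP[ac cb]; exists c; split => //.
  by rewrite !ler0_norm; lra.
by rewrite -opprB E; ring.
Qed.

(** Edges and normals have arbitrary directions, while [C1] speaks of the axes only. The increment
    is split along an axis-parallel path; the mean value theorem handles each leg, and continuity of
    the partial derivatives closes the estimate. *)
Lemma C1_is_derive f p v : C1 f ->
  is_derive p v f (v.1 * pd i0 f p + v.2 * pd i1 f p).
Proof.
move=> C1f; apply/is_deriveP/cvgrPdist_le => e e0.
pose K := `|v.1| + `|v.2| + 1.
have K0 : 0 < K by rewrite ltr_wpDl// addr_ge0.
have eK : 0 < e / K by rewrite divr_gt0.
have [c0 _] := C1f i0; have [c1 _] := C1f i1.
have /cvgrPdist_le/(_ _ eK)/nbhs_ballP[d0 /= d00 H0] := c0 p.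
have /cvgrPdist_le/(_ _ eK)/nbhs_ballP[d1 /= d10 H1] := c1 p.
pose d := Num.min d0 d1.
have d_gt0 : 0 < d / K by rewrite divr_gt0// lt_min d00.
near=> h.
have h0 : h != 0 by near: h; exact: nbhs_dnbhs_neq.
have hd : `|h| < d / K by near: h; exact: dnbhs0_lt.
have hv1 : `|h * v.1| < d.
  rewrite normrM; apply: le_lt_trans (_ : `|h| * K < d); last by rewrite -ltr_pdivlMr.
  by rewrite ler_wpM2l// /K -addrA lerDl addr_ge0.
have hv2 : `|h * v.2| < d.
  rewrite normrM; apply: le_lt_trans (_ : `|h| * K < d); last by rewrite -ltr_pdivlMr.
  by rewrite ler_wpM2l// /K addrAC lerDr addr_ge0.
have [c [cp Ec]] := mean_value p.1 (p.1 + h * v.1) (fun x => C1_derive_fst C1f x (p.2 + h * v.2)).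
have [c' [cp' Ec']] := mean_value p.2 (p.2 + h * v.2) (fun y => C1_derive_snd C1f p.1 y).
rewrite /= (addrC p.1) addrK in cp Ec; rewrite /= (addrC p.2) addrK in cp' Ec'.
have -> : h^-1 * (f (h *: v + p) - f p) =
    v.1 * pd i0 f (c, h * v.2 + p.2) + v.2 * pd i1 f (p.1, c').
  have -> : h *: v + p = (h * v.1 + p.1, h * v.2 + p.2) by [].
  have -> : f p = f (p.1, p.2) by case: (p).
  apply: (mulfI h0); rewrite mulrA divff// mul1r.
  rewrite (addrC p.2) in Ec.
  rewrite -(subrKA (f (p.1, h * v.2 + p.2))) Ec Ec'; ring.
have -> : v.1 * pd i0 f p + v.2 * pd i1 f p -
    (v.1 * pd i0 f (c, h * v.2 + p.2) + v.2 * pd i1 f (p.1, c')) =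
  v.1 * (pd i0 f p - pd i0 f (c, h * v.2 + p.2)) +
  v.2 * (pd i1 f p - pd i1 f (p.1, c')) by ring.
have B0 : `|pd i0 f p - pd i0 f (c, h * v.2 + p.2)| <= e / K.
  apply: H0; apply/ballP2; split=> /=.
    by rewrite distrC (le_lt_trans cp)// (lt_le_trans hv1)// ge_min lexx.
  by rewrite opprD addrCA subrr addr0 normrN (lt_le_trans hv2)// ge_min lexx.
have B1 : `|pd i1 f p - pd i1 f (p.1, c')| <= e / K.
  apply: H1; apply/ballP2; split=> /=; first by rewrite subrr normr0.
  by rewrite distrC (le_lt_trans cp')// (lt_le_trans hv2)// ge_min lexx orbT.
rewrite (le_trans (ler_normD _ _))// !normrM.
apply: (@le_trans _ _ (`|v.1| * (e / K) + `|v.2| * (e / K))).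
  by rewrite lerD// ler_wpM2l.
rewrite -mulrDl mulrCA -{2}[e]mulr1 ler_pM2l// ler_pdivrMr// mul1r /K.
by rewrite lerDl.
Unshelve. all: by end_near.
Qed.

Lemma C1_derive_dir f p v : C1 f ->
  'D_v f p = v.1 * pd i0 f p + v.2 * pd i1 f p.
Proof. by move=> C1f; have [] := C1_is_derive p v C1f. Qed.

Lemma C1_derive_line f p v (t : R) : C1 f ->
  is_derive t 1 (fun s : R => f (p + s *: v)) ('D_v f (p + t *: v)).
Proof.
by move=> C1f; apply/is_derive_line; rewrite C1_derive_dir//; exact: C1_is_derive.
Qed.

Lemma smooth_C1 phi : smooth phi -> C1 phi.
Proof.
move=> sphi i; split; first by have [] := sphi [:: i].
by move=> p; have [_] := sphi [::]; apply.
Qed.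

Lemma smooth_continuous phi : smooth phi -> continuous phi.
Proof. by move=> /(_ [::])[]. Qed.

Lemma smooth_pd i phi : smooth phi -> smooth (pd i phi).
Proof. by move=> sphi s; have := sphi (rcons s i); rewrite foldr_rcons. Qed.

Lemma double_difference (a b c d x y : R) :
  a - b - (c - d) = x -> a - c - (b - d) = y -> x = y.
Proof. by move=> <- <-; ring. Qed.

(** Made for the symmetry of second derivatives, where mean values locate a common value of both
    mixed derivatives near [p], but at two different points. *)
Lemma eq_of_close_values (F G : R * R -> R) p : continuous F -> continuous G ->
  (forall r : R, 0 < r -> exists q q', [/\ `|q.1 - p.1| <= r, `|q.2 - p.2| <= r,
     `|q'.1 - p.1| <= r, `|q'.2 - p.2| <= r & F q = G q']) -> F p = G p.
Proof.
move=> cF cG H.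
apply/eqP; rewrite -subr_eq0 -normr_le0; apply/ler_addgt0Pr => e e0; rewrite add0r.
have e2 : 0 < e / 2 by rewrite divr_gt0.
have /cvgrPdist_le/(_ _ e2)/nbhs_ballP[dA /= dA0 HA] := cF p.
have /cvgrPdist_le/(_ _ e2)/nbhs_ballP[dB /= dB0 HB] := cG p.
pose h := Num.min dA dB / 2.
have h0 : 0 < h by rewrite divr_gt0// lt_min dA0.
have hA : h < dA by rewrite ltr_pdivrMr// mulr_natr (le_lt_trans (_ : _ <= dA)) ?ge_min ?lexx//; lra.
have hB : h < dB by rewrite ltr_pdivrMr// mulr_natr (le_lt_trans (_ : _ <= dB)) ?ge_min ?lexx ?orbT//; lra.
have [q [q' [q1 q2 q1' q2' E]]] := H _ h0.
have KA : `|F p - F q| <= e / 2.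
  by apply: HA; apply/ballP2; split; rewrite /= distrC; apply: le_lt_trans hA.
have KB : `|G p - G q'| <= e / 2.
  by apply: HB; apply/ballP2; split; rewrite /= distrC; apply: le_lt_trans hB.
rewrite -(subrKA (F q)) {2}E (le_trans (ler_normD _ _))// (splitr e) lerD//.
by rewrite distrC.
Qed.

(** The mixed second difference over a square of side [h] is evaluated by mean values in both
    orders; each order yields [h ^+ 2] times one mixed derivative at some point of the square. *)
Lemma smooth_schwarz i j phi : smooth phi -> pd i (pd j phi) = pd j (pd i phi).
Proof.
move=> sphi; suff H : pd i0 (pd i1 phi) = pd i1 (pd i0 phi).
  case: (ord2P i) => ->; case: (ord2P j) => ->;
    [reflexivity|exact: H|exact: (esym H)|reflexivity].
apply/funext => -[x y].
have C := smooth_C1 sphi.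
have C0 := smooth_C1 (smooth_pd i0 sphi); have C1' := smooth_C1 (smooth_pd i1 sphi).
have [cA _] := C1' i0; have [cB _] := C0 i1.
apply: (eq_of_close_values cA cB) => h h0.
have dsub (F G dF dG : R -> R) : (forall t : R, is_derive t 1 F (dF t)) ->
    (forall t : R, is_derive t 1 G (dG t)) ->
    forall t : R, is_derive t 1 (fun s => F s - G s) (dF t - dG t).
  by move=> FF GG t; have := FF t; have := GG t => ? ?; exact: is_deriveB.
have [a [ax Ea]] := mean_value x (x + h) (dsub _ _ _ _
  (fun s => C1_derive_fst C s (y + h)) (fun s => C1_derive_fst C s y)).
have [b [bx Eb]] := mean_value y (y + h) (fun s => C1_derive_snd C0 a s).
have [c [cx Ec]] := mean_value y (y + h) (dsub _ _ _ _
  (fun s => C1_derive_snd C (x + h) s) (fun s => C1_derive_snd C x s)).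
have [d [dx Ed]] := mean_value x (x + h) (fun s => C1_derive_fst C1' s c).
rewrite !(addrC _ h) !addrK in ax Ea bx Eb cx Ec dx Ed.
rewrite /= Eb in Ea; rewrite /= Ed in Ec.
rewrite (gtr0_norm h0) in ax bx cx dx.
exists (d, c), (a, b); split; [exact: dx|exact: cx|exact: ax|exact: bx|].
apply: (mulIf (lt0r_neq0 h0)); apply: (mulIf (lt0r_neq0 h0)).
exact: double_difference Ec Ea.
Qed.

Lemma smooth_lin (c : R) f g : smooth f -> smooth g -> smooth (fun p => f p + c * g p).
Proof.
move=> sf sg s.
have E : foldr pd (fun p => f p + c * g p) s = (fun p => foldr pd f s p + c * foldr pd g s p).
  elim: s => //= i s ->; apply/funext => p.
  have [_ df] := sf s; have [_ dg] := sg s.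
  rewrite /pd deriveD//; last by apply: derivableM => //; exact: derivable_cst.
  by congr (_ + _); rewrite (_ : (fun p => _) = c \*: foldr pd g s)// deriveZ.
have [cf df] := sf s; have [cg dg] := sg s; rewrite /= E; split.
  by apply: continuous_add => //; apply: continuous_mul => //; exact: continuous_cst.
move=> p i; apply: derivableD => //.
by rewrite (_ : (fun p => _) = c \*: foldr pd g s)//; exact: derivableZ.
Qed.

End PlaneCalculus.

(** * Bump functions and the fundamental lemma *)

Section Bump.
Context {R : realType}.
Implicit Types (P : {poly R}) (x y : R) (p : R * R) (phi f g : R * R -> R).
Local Notation leb := (@lebesgue_measure R).
Local Notation plane := (measurableTypeR R * measurableTypeR R)%type.
Local Notation i0 := (ord0 : 'I_2).
Local Notation i1 := (ord_max : 'I_2).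

(** By the exponential series, each power of [y] is at most its factorial times the exponential. *)
Lemma poly_le_expR P : exists C : R, forall y, 0 < y -> `|P.[y]| <= C * expR y.
Proof.
exists (\sum_(i < size P) `|P`_i| * (i`!)%:R) => y y0.
rewrite horner_coef mulr_suml (le_trans (ler_norm_sum _ _ _))//.
apply: ler_sum => i _; rewrite normrM -mulrA ler_wpM2l//.
rewrite ger0_norm ?exprn_ge0 ?(ltW y0)//; case: (nat_of_ord i) => [|n].
  by rewrite expr0 fact0 mul1r -expR0 ler_expR ltW.
have := expR_ge1Dxn n (ltW y0).
have f0 : 0 < (n.+1`!)%:R :> R by rewrite ltr0n fact_gt0.
move=> H; have {}H : y ^+ n.+1 / (n.+1)`!%:R <= expR y by lra.
by rewrite mulrC -ler_pdivrMr.
Qed.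

(* These functions are closed under differentiation, so they are smooth. *)
Definition pexp P x : R := if 0 < x then P.[x^-1] * expR (- x^-1) else 0.

(** [poly_le_expR] for [P * 'X^2] at [x^-1] absorbs two extra powers of [x^-1]. This flatness makes
    [pexp P] differentiable at [0], with derivative [0]. *)
Lemma pexp_flat P : exists C : R, forall x, `|pexp P x| <= C * x ^+ 2.
Proof.
have [C PC] := poly_le_expR (P * 'X^2); exists (Num.max C 0) => x.
have C0 : 0 <= Num.max C 0 by rewrite le_max lexx orbT.
rewrite /pexp; case: ifPn => x0; last by rewrite normr0 mulr_ge0// sqr_ge0.
have xV0 : 0 < x^-1 by rewrite invr_gt0.
have H : `|P.[x^-1]| * x^-1 ^+ 2 <= Num.max C 0 * expR x^-1.
  have := PC _ xV0; rewrite hornerM hornerXn normrM [X in _ * X <= _]ger0_norm ?sqr_ge0//.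
  by move=> /le_trans; apply; rewrite ler_wpM2r ?expR_ge0// le_max lexx.
rewrite normrM (ger0_norm (expR_ge0 _)) expRN ler_pdivrMr ?expR_gt0//.
have x2 : 0 < x ^+ 2 by rewrite exprn_gt0.
move: H; rewrite exprVn ler_pdivrMr// => /le_trans; apply.
by rewrite mulrAC.
Qed.

(** Chain rule: differentiating [P.[x^-1]] and the exponential both produce the factor [x ^- 2],
    with opposite signs. *)
Definition pexp_deriv P : {poly R} := (P - P^`()) * 'X^2.

Lemma is_derive_pexp P x : is_derive x 1 (pexp P) (pexp (pexp_deriv P) x).
Proof.
have [x0|x0|->] := ltgtP x 0.
- have H : is_derive x 1 (cst (0 : R)) (0 : R) by exact: is_derive_cst.
  rewrite {2}/pexp lt_gtF//; apply: (near_eq_is_derive _ H).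
  by near=> y; rewrite /pexp lt_gtF//; near: y; exact: lt_nbhsl.
- rewrite {2}/pexp x0.
  apply: (@near_eq_is_derive _ _ _ (fun y => P.[y^-1] * expR (- y^-1))).
    by near=> y; rewrite /pexp ifT//; near: y; exact: lt_nbhsr.
  have xn0 : x != 0 by rewrite gt_eqF.
  have dV : is_derive x 1 (fun y : R => y^-1) (- x ^- 2).
    have := @is_deriveV R id x 1 1 xn0 (is_derive_id _ _).
    by rewrite /GRing.scale/= mulr1.
  have dNV : is_derive x 1 (fun y : R => - y^-1) (x ^- 2).
    by rewrite -[x ^- 2]opprK; exact: is_deriveN.
  have d1 := @is_derive1_comp R (horner P) (fun y => y^-1) x _ _ (is_derive_poly P _) dV.
  have d2 := @is_derive1_comp R expR (fun y => - y^-1) x _ _ (is_derive_expR _) dNV.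
  have := is_deriveM d1 d2; rewrite /GRing.scale /= => d12; apply: is_derive_eq.
  by rewrite /pexp_deriv hornerM hornerXn hornerD hornerN exprVn; ring.
- rewrite {2}/pexp ltxx; apply/is_deriveP/cvgrPdist_le => e e0.
  have [C PC] := pexp_flat P.
  have K0 : 0 < `|C| + 1 by rewrite ltr_wpDl.
  near=> h.
  have h0 : h != 0 by near: h; exact: nbhs_dnbhs_neq.
  have hd : `|h| < e / (`|C| + 1) by near: h; apply: dnbhs0_lt; exact: divr_gt0.
  rewrite addr0 {2}/pexp ltxx subr0 sub0r normrN normrM normfV.
  rewrite /GRing.scale /= mulr1 ler_pdivrMl ?normr_gt0//.
  apply: (le_trans (PC h)); rewrite -real_normK ?num_real// expr2 mulrA mulrC ler_wpM2l//.
  move: hd; rewrite ltr_pdivlMr// mulrDr mulr1 => hd.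
  have : C * `|h| <= `|h| * `|C| by rewrite mulrC ler_wpM2l// ler_norm.
  have := normr_ge0 h; lra.
Unshelve. all: by end_near.
Qed.

Lemma pexp_lin (c : R) P x : c * pexp P x = pexp (c *: P) x.
Proof. by rewrite /pexp; case: ifP; rewrite ?mulr0// hornerZ mulrA. Qed.

(** A coinduction principle: [smooth] quantifies over all iterated derivatives, and membership in
    [S] passes from a function to its partial derivatives. *)
Lemma smooth_closed (S : set (R * R -> R)) :
  (forall f, S f -> continuous f /\ forall i, S (pd i f) /\ forall p, derivable f p (evec i)) ->
  S `<=` @smooth R.
Proof.
move=> HS f Sf s.
have : S (foldr pd f s) by elim: s => //= i s /HS[_ /(_ i)[]].
by move=> /HS[cf df]; split=> // p i; have [] := df i.
Qed.

Lemma is_derive_pexp_affine P (a b c : R) p (i : 'I_2) :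
  is_derive p (evec i) (fun q => pexp P (a * q.1 + b * q.2 + c))
    ((if i == i0 then a else b) * pexp (pexp_deriv P) (a * p.1 + b * p.2 + c)).
Proof.
set k := (if _ then _ else _).
rewrite -[p]addr0 -(scale0r (evec i)); apply/is_derive_line.
rewrite scale0r addr0.
pose L (t : R) := k * t + (a * p.1 + b * p.2 + c).
have dL : is_derive (0 : R) 1 L k.
  by apply: is_derive_eq; rewrite /GRing.scale/=; ring.
have -> : (fun s : R => pexp P (a * (p + s *: evec i).1 + b * (p + s *: evec i).2 + c)) =
    pexp P \o L.
  apply/funext => s; rewrite line_pt /L /k /=; congr pexp.
  by case: (ord2P i) => ->; rewrite /= ; ring.
have -> : a * p.1 + b * p.2 + c = L 0 by rewrite /L; ring.
rewrite mulrC; exact: is_derive1_comp (is_derive_pexp _ _) dL.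
Qed.

Lemma smooth_pexp_affine P (a b c : R) :
  smooth (fun p => pexp P (a * p.1 + b * p.2 + c)).
Proof.
apply: (@smooth_closed [set f | exists P, f = (fun p => pexp P (a * p.1 + b * p.2 + c))]); last by exists P.
move=> _ [Q ->]; split; last first.
  move=> i; split; last by move=> p; have [] := is_derive_pexp_affine Q a b c p i.
  exists ((if i == i0 then a else b) *: pexp_deriv Q); apply/funext => p.
  by rewrite -pexp_lin; have [_] := is_derive_pexp_affine Q a b c p i.
have cp := is_derive_continuous (is_derive_pexp Q).
move=> p; apply: (@continuous_comp _ _ _ (fun p : R * R => a * p.1 + b * p.2 + c) (pexp Q)); last exact: cp.
apply: cvgD; last exact: cvg_cst.
by apply: cvgD; apply: cvgM; [exact: cvg_cst|exact: cvg_fst|exact: cvg_cst|exact: cvg_snd].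
Qed.

Lemma derive_mul f g p v (a b : R) : is_derive p v f a -> is_derive p v g b ->
  is_derive p v (fun q => f q * g q) (a * g p + f p * b).
Proof.
move=> df dg; have := is_deriveM df dg; rewrite /GRing.scale /= => d12.
by apply: is_derive_eq; ring.
Qed.

Lemma derive_add f g p v (a b : R) : is_derive p v f a -> is_derive p v g b ->
  is_derive p v (fun q => f q + g q) (a + b).
Proof. by move=> df dg; exact: is_deriveD. Qed.

(** Finite sums of products of smooth functions are closed under partial derivatives: by Leibniz's
    rule each summand becomes two. *)
Lemma smooth_mul f g : smooth f -> smooth g -> smooth (fun p => f p * g p).
Proof.
pose S : set (R * R -> R) := [set h | exists l : seq ((R * R -> R) * (R * R -> R)),
  (forall u, List.In u l -> smooth u.1 /\ smooth u.2) /\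
  h = (fun p => \sum_(u <- l) u.1 p * u.2 p)].
move=> sf sg; apply: (@smooth_closed S); last first.
  exists [:: (f, g)]; split; first by move=> u [<-|[]].
  by apply/funext => p; rewrite big_seq1.
move=> h; suff H : S h -> continuous h /\ forall i, exists2 h', S h' &
    forall p, is_derive p (evec i) h (h' p).
  move=> /H[ch dh]; split; first exact: ch.
  move=> i; have [h' Sh' hh'] := dh i.
  split; last by move=> p; have [] := hh' p.
  by rewrite (_ : pd i h = h')//; apply/funext => p; have [_] := hh' p.
move=> [l [+ ->]]; elim: l => [_|u l IH] /=.
  under eq_fun do rewrite big_nil; split; first exact: continuous_cst.
  move=> i; exists (fun=> 0); last by move=> p; exact: is_derive_cst.
  by exists [::]; split=> //; apply/funext => p; rewrite big_nil.
move=> Hl; have [su1 su2] := Hl u (or_introl erefl).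
have [c d] := IH (fun w wl => Hl w (or_intror wl)).
split.
  under eq_fun do rewrite big_cons.
  by apply: continuous_add => //; apply: continuous_mul; exact: smooth_continuous.
move=> i; have [h' [l' [Hl' ->]] dh'] := d i.
exists (fun p => (pd i u.1 p * u.2 p + u.1 p * pd i u.2 p) + \sum_(u <- l') u.1 p * u.2 p).
  exists [:: (pd i u.1, u.2), (u.1, pd i u.2) & l']; split.
    move=> w [<-|[<-|wl']]; last exact: Hl'.
      by split; [exact: smooth_pd|exact: su2].
    by split; [exact: su1|exact: smooth_pd].
  by apply/funext => p; rewrite !big_cons addrA.
move=> p; under eq_fun do rewrite big_cons.
have d1 := (smooth_C1 su1 i).2 p; have d2 := (smooth_C1 su2 i).2 p.
exact: (derive_add (derive_mul (DeriveDef d1 erefl) (DeriveDef d2 erefl)) (dh' p)).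
Qed.

Lemma pd_mul i f g : smooth f -> smooth g ->
  pd i (fun p => f p * g p) = (fun p => pd i f p * g p + f p * pd i g p).
Proof.
move=> sf sg; apply/funext => p.
have d1 := (smooth_C1 sf i).2 p; have d2 := (smooth_C1 sg i).2 p.
by have [_] := derive_mul (DeriveDef d1 erefl) (DeriveDef d2 erefl).
Qed.

(* [e^(-1/(n t))] is the [n]-th root of [e^(-1/t)], so it tends to [1] for [t > 0]. *)
Definition bump (a b c d : R) (n : nat) p : R :=
  let E t := pexp 1 (n.+1%:R * t) in
  E (p.1 - a) * E (b - p.1) * (E (p.2 - c) * E (d - p.2)).

Lemma smooth_bump a b c d n : smooth (bump a b c d n).
Proof.
have H (u v w : R) (F : R * R -> R) : (forall p, F p = u * p.1 + v * p.2 + w) ->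
    smooth (fun p => pexp 1 (F p)).
  move=> FE; rewrite (_ : (fun p => _) = (fun p => pexp 1 (u * p.1 + v * p.2 + w))).
    exact: smooth_pexp_affine.
  by apply/funext => p; rewrite FE.
apply: smooth_mul; apply: smooth_mul.
- by apply: (H n.+1%:R 0 (- (n.+1%:R * a))) => p; ring.
- by apply: (H (- n.+1%:R) 0 (n.+1%:R * b)) => p; ring.
- by apply: (H 0 n.+1%:R (- (n.+1%:R * c))) => p; ring.
- by apply: (H 0 (- n.+1%:R) (n.+1%:R * d)) => p; ring.
Qed.

Lemma pexp1_bound x : 0 <= pexp 1 x <= 1.
Proof.
rewrite /pexp; case: ifPn => [x0|_]; last by rewrite lexx ler01.
by rewrite hornerC mul1r expR_ge0 -expR0 ler_expR oppr_le0 invr_ge0 ltW.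
Qed.

Lemma pexp1_eq0 x : x <= 0 -> pexp 1 x = 0.
Proof. by rewrite /pexp leNgt => /negbTE ->. Qed.

Lemma bump_out a b c d n p : ~ obox a b c d p -> bump a b c d n p = 0.
Proof.
move=> Hp; rewrite /bump.
have n0 : 0 < n.+1%:R :> R by [].
have H t : t <= 0 -> pexp 1 (n.+1%:R * t) = 0 by move=> t0; rewrite pexp1_eq0// pmulr_rle0.
have [pa|pa] := leP p.1 a; first by rewrite (H (p.1 - a)) ?subr_le0// !mul0r.
have [pb|pb] := leP b p.1; first by rewrite (H (b - p.1)) ?subr_le0// mulr0 !mul0r.
have [pc|pc] := leP p.2 c; first by rewrite (H (p.2 - c)) ?subr_le0// mul0r !mulr0.
have [pd|pd] := leP d p.2; first by rewrite (H (d - p.2)) ?subr_le0// !mulr0.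
by case: Hp; split.
Qed.

Lemma bump_le1 a b c d n p : `|bump a b c d n p| <= 1.
Proof.
rewrite /bump; set A := pexp 1 _; set B := pexp 1 _; set C := pexp 1 _; set D := pexp 1 _.
have /andP[A0 A1] : 0 <= A <= 1 by exact: pexp1_bound.
have /andP[B0 B1] : 0 <= B <= 1 by exact: pexp1_bound.
have /andP[C0 C1] : 0 <= C <= 1 by exact: pexp1_bound.
have /andP[D0 D1] : 0 <= D <= 1 by exact: pexp1_bound.
by rewrite ger0_norm ?mulr_ge0// mulr_ile1 ?mulr_ge0// mulr_ile1.
Qed.

Lemma cvg_pexp1 t : 0 < t -> (fun n => pexp 1 (n.+1%:R * t)) @ \oo --> (1 : R).
Proof.
move=> t0.
rewrite (_ : (fun n => _) = (fun n => expR (- (t^-1 * n.+1%:R^-1)))); last first.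
  apply/funext => n; rewrite /pexp mulr_gt0// hornerC mul1r; congr expR.
  by rewrite invfM mulrC.
have H : (fun n : nat => - (t^-1 * n.+1%:R^-1)) @ \oo --> - (t^-1 * 0).
  by apply: cvgN; apply: cvgM; [exact: cvg_cst|exact: cvg_harmonic].
have := cvg_comp _ _ H (@continuous_expR R _).
by rewrite mulr0 oppr0 expR0.
Qed.

Lemma cvg_bump a b c d p :
  (fun n => bump a b c d n p) @ \oo --> (\1_(obox a b c d) p : R).
Proof.
have [Hp|Hp] := pselect (obox a b c d p); last first.
  under eq_fun do rewrite bump_out//.
  by rewrite indicE memNset//; exact: cvg_cst.
rewrite indicE mem_set//=.
case: Hp; rewrite -subr_gt0 -(subr_gt0 p.1) -(subr_gt0 c) -(subr_gt0 p.2) => pa pb pc pd.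
rewrite [X in _ --> X](_ : _ = 1 * 1 * (1 * 1)); last by rewrite !mulr1.
exact: (cvgM (cvgM (cvg_pexp1 pa) (cvg_pexp1 pb)) (cvgM (cvg_pexp1 pc) (cvg_pexp1 pd))).
Qed.

Lemma test_bump a b c d n (om : set (R * R)) : cbox a b c d `<=` om ->
  test om (bump a b c d n).
Proof.
move=> bom.
have H : closure [set p | bump a b c d n p != 0] `<=` cbox a b c d.
  have /closure_id E : closed (cbox a b c d).
    by apply: compact_closed; [exact: norm_hausdorff|exact: compact_cbox].
  rewrite E; apply: closureS => p /=; have [/obox_cbox//|Hp] := pselect (obox a b c d p).
  by rewrite bump_out// eqxx.
split; [exact: smooth_bump| |exact: subset_trans bom].
apply: subclosed_compact (@compact_cbox _ a b c d) H; exact: closed_closure.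
Qed.

End Bump.

(** * Integrals that vanish on a generating pi-system *)

Section Dynkin.
Context d (T : measurableType d) (R : realType).
Variable mu : {measure set T -> \bar R}.
Implicit Types (D A : set T) (g : T -> \bar R).

(** The sets over which the integral vanishes form a Dynkin system: complements use that the
    integral over [D] is zero, disjoint unions use countable additivity. *)
Lemma integral_eq0_pi_system (D : set T) (g : T -> R) (G : set (set T)) :
  measurable D -> mu.-integrable D (EFin \o g) ->
  setI_closed G -> @measurable _ T `<=` <<s G >> ->
  (forall A, G A -> measurable A /\ (\int[mu]_(x in D `&` A) (g x)%:E = 0)%E) ->
  (\int[mu]_(x in D) (g x)%:E = 0)%E ->
  forall A, measurable A -> (\int[mu]_(x in D `&` A) (g x)%:E = 0)%E.
Proof.
move=> mD ig GI mG HG D0 A mA.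
pose H : set (set T) := [set A | measurable A /\ (\int[mu]_(x in D `&` A) (g x)%:E = 0)%E].
suff [] : H A by [].
suff : <<d G >> `<=` H.
  by rewrite setI_closed_g_dynkin_g_sigma_algebra//; apply; exact: mG.
apply: smallest_sub; last by move=> B /HG.
have igS B : measurable B -> B `<=` D -> mu.-integrable B (EFin \o g).
  by move=> mB BD; exact: integrableS ig.
split.
- by split; [exact: measurableT|rewrite setIT].
- move=> B [mB B0]; split; first exact: measurableC.
  have : (\int[mu]_(x in (D `&` B) `|` (D `&` ~` B)) (g x)%:E = 0)%E by rewrite -setIUr setUv setIT.
  rewrite integral_setU ?B0 ?add0e//.
  + exact: measurableI.
  + by apply: measurableI => //; exact: measurableC.
  + rewrite -setIUr setUv setIT; exact: measurable_int ig.
  + by rewrite disj_set2E setIACA setICr setI0.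
- move=> F tF HF; split; first by apply: bigcupT_measurable => k; case: (HF k).
  rewrite setI_bigcupr integral_bigcup.
  + by rewrite eseries0// => k _ _; case: (HF k).
  + by move=> i j _ _ [x [[_ Fi] [_ Fj]]]; apply: tF => //; exists x.
  + by move=> k; apply: measurableI => //; case: (HF k).
  + rewrite -setI_bigcupr; apply: igS; last exact: subIsetl.
    by apply: measurableI => //; apply: bigcupT_measurable => k; case: (HF k).
Qed.

End Dynkin.

Global Instance ae_leb2_filter (R : realType) :
  Filter (nbhs (almost_everywhere (@leb2 R))).
Proof. exact: ae_filter_ringOfSetsType. Qed.

Section FundamentalLemma.
Context {R : realType}.
Implicit Types (om : set (R * R)) (p : R * R) (phi f g : R * R -> R).
Local Notation leb := (@lebesgue_measure R).
Local Notation plane := (measurableTypeR R * measurableTypeR R)%type.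

Definition oboxes : set (set plane) := [set A | exists a b c d : R, A = obox a b c d].

Lemma obox_setI (a b c d a' b' c' d' : R) : obox a b c d `&` obox a' b' c' d' =
  obox (Num.max a a') (Num.min b b') (Num.max c c') (Num.min d d').
Proof.
apply/seteqP; split=> p /=.
  by move=> [[? ? ? ?] [? ? ? ?]]; split; rewrite ?gt_max ?lt_min; apply/andP.
by rewrite /obox/= !gt_max !lt_min => -[/andP[? ?] /andP[? ?] /andP[? ?] /andP[? ?]].
Qed.

Lemma oboxes_setI : setI_closed oboxes.
Proof.
move=> _ _ [a [b [c [d ->]]]] [a' [b' [c' [d' ->]]]]; rewrite obox_setI.
by do 4 eexists.
Qed.

(** The product sigma-algebra is generated by the two projections. Preimages of open intervals under
    them are open, and an open set is a countable union of rational boxes. *)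
Lemma measurable_oboxes : @measurable _ plane `<=` <<s oboxes >>.
Proof.
have sa := @smallest_sigma_algebra _ (setT : set plane) oboxes.
have open_s (A : set plane) : open (A : set (R * R)) -> <<s oboxes >> A.
  move=> oA; pose F (q : (rat * rat) * (rat * rat)) : set plane :=
    [set p | obox (ratr q.1.1) (ratr q.1.2) (ratr q.2.1) (ratr q.2.2) p /\
           cbox (ratr q.1.1) (ratr q.1.2) (ratr q.2.1) (ratr q.2.2) `<=` A].
  have -> : A = \bigcup_q F q.
    apply/seteqP; split=> [p Ap|p [q _ [pq qA]]].
      by have [q [pq qA]] := open_rat_box oA Ap; exists q.
    exact/qA/obox_cbox.
  apply: (@countable_bigcupT_measurable _ (g_sigma_algebraType oboxes)); first exact: countableP.
  move=> q; have [qA|qA] := pselect (cbox (ratr q.1.1) (ratr q.1.2) (ratr q.2.1) (ratr q.2.2) `<=` A).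
    rewrite (_ : F q = obox (ratr q.1.1) (ratr q.1.2) (ratr q.2.1) (ratr q.2.2)).
      by apply: sub_sigma_algebra; eexists; eexists; eexists; eexists.
    by apply/seteqP; split=> [p []|p].
  by rewrite (_ : F q = set0); [exact: (@measurable0 _ (g_sigma_algebraType oboxes))|apply/seteqP; split=> // p [_ /qA]].
have pre (h : plane -> measurableTypeR R) : (forall A : set R, open A -> open (h @^-1` A : set (R * R))) ->
    preimage_set_system setT h measurable `<=` <<s oboxes >>.
  move=> ch _ [X mX <-]; rewrite setTI.
  have : (RGenOpens.G (R:=R)).-sigma.-measurable X by rewrite -RGenOpens.measurableE.
  move: X {mX}.
  suff : <<s (RGenOpens.G (R:=R)) >> `<=` [set X | <<s oboxes >> (h @^-1` X)] by [].
  apply: smallest_sub; last first.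
    move=> _ [x [y ->]]; apply: open_s; apply: ch.
    have : open (`]x, y[%classic : set R) by exact: interval_open.
    exact.
  have [s0 sC sU] := sa; split.
  - by rewrite /= preimage_set0.
  - by move=> A /sC /=; rewrite !setTD preimage_setC.
  - by move=> F HF; rewrite /= preimage_bigcup; exact: sU.
apply: smallest_sub; first exact: sa.
move=> X [|]; apply: pre => A oA.
- by apply: open_comp oA => p _; exact: cvg_fst.
- by apply: open_comp oA => p _; exact: cvg_snd.
Qed.

Lemma sqint_integrable d (T : measurableType d) (mu : {measure set T -> \bar R}) (D : set T) (g : T -> R) :
  measurable D -> (mu D < +oo)%E -> sqint mu D g -> mu.-integrable D (EFin \o g).
Proof.
move=> mD muD sg; have := sqint_integrable_mul mD sg (sqint_cst mD muD 1).
by under [X in EFin \o X]eq_fun do rewrite mulr1.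
Qed.

(** The bump functions tend pointwise to the indicator of the open box and are bounded by [1], so
    dominated convergence applies with the absolute value of [g] as majorant. *)
Lemma integral_obox_eq0 om g (a b c d : R) : open om -> L2 om g ->
  (forall phi, test om phi -> ip om g phi = 0) -> cbox a b c d `<=` om ->
  (\int[leb2]_(p in obox a b c d) (g p)%:E = 0)%E.
Proof.
move=> oom /(sqint_Lfun leb2 (open_measurable_plane oom)) sg H bom.
have mom := open_measurable_plane oom.
have mc := @measurable_cbox R a b c d.
have mo := @measurable_obox R a b c d.
have ig : leb2.-integrable (cbox a b c d : set plane) (EFin \o g).
  apply: sqint_integrable => //; [exact: leb2_cbox_lty|exact: sqintS sg].
have mg := measurable_int leb2 ig.
pose F n p := (g p * bump a b c d n p)%:E.
have F0 n : (\int[leb2]_(p in cbox a b c d) F n p = 0)%E.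
  have H0 : inn leb2 om g (bump a b c d n) = 0 by exact: H (test_bump n bom).
  have sb : sqint leb2 (cbox a b c d) (bump a b c d n).
    apply: continuous_sqint_plane => //.
      by apply: compact_bounded; exact: compact_cbox.
    exact: smooth_continuous (smooth_bump a b c d n).
  rewrite -(EFin_inn mc (sqintS mc mom bom sg) sb) (@inn_supp _ plane R leb2 _ _ bom) ?H0// => p pc.
  by rewrite bump_out ?mulr0// => /obox_cbox.
have := @dominated_cvg _ _ _ leb2 (cbox a b c d : set plane) mc F
  (fun p => (g p * \1_(obox a b c d) p)%:E) (fun p => `|g p|%:E).
have mb n : measurable_fun (cbox a b c d : set plane) (bump a b c d n).
  by apply: continuous_measurable_plane; exact: smooth_continuous (smooth_bump a b c d n).
move=> /(_ _ _ _ _ _) L.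
have {}L : (\int[leb2]_(p in cbox a b c d) F n p)%E @[n --> \oo] -->
  (\int[leb2]_(p in cbox a b c d) (g p * \1_(obox a b c d) p)%:E)%E.
  apply: L => //.
  - move=> n; apply/measurable_EFinP; apply: measurable_funM => //.
    exact/measurable_EFinP.
  - move=> p _; apply: cvg_EFin; first exact: nearW.
    by apply: cvgM; [exact: cvg_cst|exact: cvg_bump].
  - exact: integrable_norm.
  - move=> n p _; rewrite /F /= lee_fin normrM -[leRHS]mulr1 ler_wpM2l//.
    exact: bump_le1.
move: L; under eq_fun do rewrite F0; move=> L.
have : (\int[leb2]_(p in cbox a b c d) (g p * \1_(obox a b c d) p)%:E = 0)%E.
  by apply: cvg_unique L _ => //; exact: cvg_cst.
move=> <-.
rewrite -(setIidr (@obox_cbox R a b c d)) integral_mkcondr.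
apply: eq_integral => p _; rewrite patchE indicE setIidr; last exact: obox_cbox.
by case: ifPn => pb; rewrite ?mulr1 ?mulr0.
Qed.

(** On a rational box whose closed box lies in [om], the integral of [g] vanishes over all smaller
    boxes, hence over all measurable subsets. Countably many such boxes cover [om]. *)
Lemma fundamental_lemma om g : open om -> L2 om g ->
  (forall phi, test om phi -> ip om g phi = 0) ->
  {ae leb2, forall p, om p -> g p = 0}.
Proof.
move=> oom L2g H.
have sg := (sqint_Lfun leb2 (open_measurable_plane oom) g).1 L2g.
have mom := open_measurable_plane oom.
pose B (q : (rat * rat) * (rat * rat)) : set plane :=
  obox (ratr q.1.1) (ratr q.1.2) (ratr q.2.1) (ratr q.2.2).
pose CB (q : (rat * rat) * (rat * rat)) : set plane :=
  cbox (ratr q.1.1) (ratr q.1.2) (ratr q.2.1) (ratr q.2.2).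
have HB q : CB q `<=` om -> {ae leb2, forall p, B q p -> g p = 0}.
  move=> qom.
  have mB : measurable (B q) by exact: measurable_obox.
  have Bom : B q `<=` om by apply: subset_trans qom; exact: obox_cbox.
  have iB : leb2.-integrable (B q) (EFin \o g).
    apply: sqint_integrable => //; last exact: sqintS sg.
    apply: le_lt_trans (leb2_cbox_lty _ _ _ _); apply: le_measure; rewrite ?inE//.
      exact: measurable_cbox.
    exact: obox_cbox.
  have B0 : (\int[leb2]_(p in B q) (g p)%:E = 0)%E by exact: integral_obox_eq0 L2g H qom.
  have BA (A : set plane) : measurable A -> (\int[leb2]_(p in B q `&` A) (g p)%:E = 0)%E.
    apply: (integral_eq0_pi_system mB iB oboxes_setI measurable_oboxes) => //.
    move=> _ [a [b [c [d ->]]]]; split; first exact: measurable_obox.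
    rewrite /B obox_setI; apply: (integral_obox_eq0 oom L2g H).
    apply: subset_trans qom => p [].
    by rewrite !ge_max !le_min => /andP[? ?] /andP[? ?] /andP[? ?] /andP[? ?]; split.
  have aeB : ae_eq leb2 (B q) (EFin \o g) (fun=> 0%E).
    apply: (integral_ae_eq mB iB (measurable_cst _)) => A AB mA.
    by rewrite integral0 -[RHS](BA A mA) (setIidr AB).
  by apply: filterS aeB => p /= H' /H' [].
(* Boxes are numbered by [unpickle] so that their null sets can be united. *)
have K n : {ae leb2, forall p, if unpickle n is Some q then
    (CB q `<=` om -> B q p -> g p = 0) else True}.
  case: (unpickle n) => [q|]; last exact: aeW.
  have [qom|qom] := pselect (CB q `<=` om); last by apply: aeW => p /qom.
  by apply: filterS (HB q qom) => p Hp _ /Hp.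
apply: filterS (ae_foralln K) => p Hp omp.
have [q [pq qom]] := open_rat_box oom omp.
by have := Hp (pickle q); rewrite pickleK; apply.
Qed.

End FundamentalLemma.

(** * Weak derivatives *)

Lemma innD2 d (T : measurableType d) (R : realType) (mu : {measure set T -> \bar R})
    (D : set T) (f g h k : T -> R) : measurable D ->
  sqint mu D f -> sqint mu D g -> sqint mu D h -> sqint mu D k ->
  inn mu D f g + inn mu D h k = \int[mu]_(x in D) (f x * g x + h x * k x).
Proof. by move=> *; rewrite /inn RintegralD//; exact: sqint_integrable_mul. Qed.

Section IntegrationByParts.
Context {R : realType}.
Implicit Types (om : set (R * R)) (p : R * R) (phi f g h : R * R -> R) (i : 'I_2).
Local Notation leb := (@lebesgue_measure R).
Local Notation plane := (measurableTypeR R * measurableTypeR R)%type.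
Local Notation i0 := (ord0 : 'I_2).
Local Notation i1 := (ord_max : 'I_2).

Lemma pd_eq0 i f (A : set (R * R)) p : open A -> A p -> (forall q, A q -> f q = 0) ->
  pd i f p = 0.
Proof.
move=> oA Ap fA; have H : is_derive p (evec i) (cst (0 : R)) (0 : R) by exact: is_derive_cst.
suff [] : is_derive p (evec i) f 0 by [].
apply: (near_eq_is_derive _ H); have : nbhs p A by exact: open_nbhs_nbhs.
by apply: filterS => q /fA.
Qed.

Lemma closed_cbox (a b c d : R) : closed (cbox a b c d).
Proof. by apply: compact_closed; [exact: norm_hausdorff|exact: compact_cbox]. Qed.

Lemma bounded_set_cbox (a b c d : R) : bounded_set (cbox a b c d).
Proof. by apply: compact_bounded; exact: compact_cbox. Qed.

Lemma pd_out_cbox i h (a b c d : R) : (forall p, ~ obox a b c d p -> h p = 0) ->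
  forall p, ~ cbox a b c d p -> pd i h p = 0.
Proof.
move=> hb p pb; apply: (@pd_eq0 _ _ (~` cbox a b c d)) => //.
  exact/closed_openC/closed_cbox.
by move=> q qb; apply: hb => /obox_cbox.
Qed.

Lemma integral_supp_itv (f : R -> R) (a b : R) : (forall x, ~ (a <= x <= b) -> f x = 0) ->
  (\int[leb]_x (f x)%:E)%E = (\int[leb]_(x in `[a, b]) (f x)%:E)%E.
Proof.
move=> fab; rewrite [RHS]integral_mkcond; apply: eq_integral => x _.
rewrite patchE; case: ifPn => // xab; rewrite fab// => H; move/negP: xab; apply.
by rewrite inE /= in_itv.
Qed.

Lemma integral_derive_eq0 (f g : R -> R) (B : R) : 0 < B ->
  (forall x : R, is_derive x 1 f (g x)) -> continuous g ->
  (forall x, ~ (- B <= x <= B) -> g x = 0) -> f B = 0 -> f (- B) = 0 ->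
  (\int[leb]_x (g x)%:E = 0)%E.
Proof.
move=> B0 fg cg gB fB fNB; rewrite (integral_supp_itv gB).
have BB : - B <= B by lra.
have := ftc_line BB fg cg; rewrite fB fNB subrr /Rintegral => H.
apply/eqP; rewrite -fine_eq0 ?H//; apply: integrable_fin_num; first exact: measurable_itvR.
exact: continuous_integrable_itv.
Qed.

(** Fubini's theorem allows integrating first in the direction of differentiation, where only the
    values of [h] at both ends remain, and these vanish. *)
Lemma integral_pd_eq0 i h (B : R) : 0 < B -> smooth h ->
  (forall p, ~ obox (- B) B (- B) B p -> h p = 0) ->
  (\int[leb2]_(p in cbox (- B) B (- B) B) (pd i h p)%:E = 0)%E.
Proof.
move=> B0 sh hB; have C := smooth_C1 sh.
have mc := @measurable_cbox R (- B) B (- B) B.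
have cpd : continuous (pd i h) by exact: smooth_continuous (smooth_pd i sh).
have hout := pd_out_cbox i hB.
(* The derivative vanishes off the square, so the integral may be taken over the plane, whose
   sections are full lines. *)
have E : (fun p => (pd i h p)%:E) = (EFin \o pd i h) \_ (cbox (- B) B (- B) B).
  apply/funext => p; rewrite patchE; case: ifPn => // pb.
  by rewrite hout// => /mem_set; exact/negP.
have ii : leb2.-integrable (setT : set plane) (fun p => (pd i h p)%:E).
  rewrite E; apply/(integrable_mkcond _ mc); apply: sqint_integrable => //.
    exact: leb2_cbox_lty.
  by apply: continuous_sqint_plane => //; exact: bounded_set_cbox.
rewrite integral_mkcond -E.
have cx (y : R) : continuous (fun x : R => (x, y)).
  move=> x; apply/cvg_ballP => e e0; have H : nbhs x (ball x e) by exact: nbhsx_ballx.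
  near=> t; apply/ballP2; split=> /=; first by near: t; exact: H.
  by rewrite subrr normr0.
have cy (x : R) : continuous (fun y : R => (x, y)).
  move=> y; apply/cvg_ballP => e e0; have H : nbhs y (ball y e) by exact: nbhsx_ballx.
  near=> t; apply/ballP2; split=> /=; first by rewrite subrr normr0.
  by near: t; exact: H.
case: (ord2P i) => Ei; rewrite Ei in ii cpd hout *.
  rewrite -(integral21_prod_meas1 ii); apply: integral0_eq => y _.
  apply: (@integral_derive_eq0 (fun x => h (x, y)) (fun x => pd i0 h (x, y)) B B0).
  - by move=> x; exact: C1_derive_fst.
  - by move=> x; apply: (continuous_comp (cx y x)); exact: cpd.
  - by move=> x xB; apply: hout => -[/= ? ? ? ?]; apply: xB; apply/andP.
  - by apply: hB => -[/=]; rewrite ltxx.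
  - by apply: hB => -[/=]; rewrite ltxx.
rewrite -(integral12_prod_meas1 ii); apply: integral0_eq => x _.
apply: (@integral_derive_eq0 (fun y => h (x, y)) (fun y => pd i1 h (x, y)) B B0).
- by move=> y; exact: C1_derive_snd.
- by move=> y; apply: (continuous_comp (cy x y)); exact: cpd.
- by move=> y xB; apply: hout => -[/= ? ? ? ?]; apply: xB; apply/andP.
- by apply: hB => -[/= _ _]; rewrite ltxx.
- by apply: hB => -[/= _ _]; rewrite ltxx.
Unshelve. all: by end_near.
Qed.

Lemma test_smooth om phi : test om phi -> smooth phi.
Proof. by case. Qed.

Lemma test_out om phi p : test om phi -> ~ om p -> phi p = 0.
Proof.
move=> [_ _ sub] op; apply/eqP/negPn/negP => pn0; apply: op; apply: sub.
exact: subset_closure.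
Qed.

Lemma test_box om phi : test om phi -> exists B : R, 0 < B /\
  forall p, ~ obox (- B) B (- B) B p -> phi p = 0.
Proof.
move=> [_ /compact_bounded/bounded_cbox[B [B0 sub]] _].
exists (B + 1); split; first by lra.
move=> p pB; apply/eqP/negPn/negP => pn0; apply: pB.
have H : closure [set x | phi x != 0] p by exact: subset_closure.
by have [/= ? ? ? ?] := sub p H; split=> /=; lra.
Qed.

Lemma test_pd om i phi : test om phi -> test om (pd i phi).
Proof.
move=> [sphi cphi sub]; set S := closure [set x | phi x != 0] in cphi sub.
have H : closure [set x | pd i phi x != 0] `<=` S.
  rewrite closureE; apply: smallest_sub; first exact: closed_closure.
  move=> p /= pn0; apply: contrapT => pS; move/eqP: pn0; apply.
  apply: (@pd_eq0 _ _ (~` S)) => //; first exact/closed_openC/closed_closure.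
  move=> q qS; apply/eqP/negPn/negP => qn0; apply: qS.
  exact: subset_closure.
split; [exact: smooth_pd| |exact: subset_trans sub].
exact: subclosed_compact (@closed_closure _ _) cphi H.
Qed.

Lemma test_sub om om' phi : om `<=` om' -> test om phi -> test om' phi.
Proof. by move=> sub [? ? ?]; split=> //; exact: subset_trans sub. Qed.

Lemma ip_test_supp om f phi (B : R) : test om phi ->
  (forall p, ~ obox (- B) B (- B) B p -> phi p = 0) ->
  ip om f phi = ip (cbox (- B) B (- B) B) f phi.
Proof.
move=> tphi phiB; rewrite /ip.
transitivity (inn leb2 (setT : set plane) f phi).
  by apply: inn_supp => // p op; rewrite (test_out tphi)// mulr0.
by apply/esym/inn_supp => // p op; rewrite phiB ?mulr0// => /obox_cbox.
Qed.

(** Both integrals are moved to a square that contains the supports, where the derivative of the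
    product of [f] and [phi] integrates to zero. *)
Lemma ip_pd om i f phi : smooth f -> test om phi ->
  ip om f (pd i phi) = - ip om (pd i f) phi.
Proof.
move=> sf tphi; have [B [B0 phiB]] := test_box tphi.
have [B' [B0' phiB']] := test_box (test_pd i tphi).
pose K := Num.max B B'.
have KB : B <= K by rewrite le_max lexx.
have KB' : B' <= K by rewrite le_max lexx orbT.
have phiK p : ~ obox (- K) K (- K) K p -> phi p = 0.
  by move=> H; apply: phiB => -[? ? ? ?]; apply: H; split; lra.
have phiK' p : ~ obox (- K) K (- K) K p -> pd i phi p = 0.
  by move=> H; apply: phiB' => -[? ? ? ?]; apply: H; split; lra.
rewrite (ip_test_supp _ (test_pd i tphi) phiK') (ip_test_supp _ tphi phiK).
have mc := @measurable_cbox R (- K) K (- K) K.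
have sq g : smooth g -> sqint leb2 (cbox (- K) K (- K) K) g.
  by move=> sg; apply: continuous_sqint_plane => //; [exact: bounded_set_cbox|exact: smooth_continuous].
have sphi := test_smooth tphi.
have K0 : 0 < K by rewrite (lt_le_trans B0).
have H := integral_pd_eq0 i K0 (smooth_mul sf sphi).
apply/eqP; rewrite -addr_eq0; apply/eqP; rewrite /ip.
have := innD2 mc (sq _ sf) (sq _ (smooth_pd i sphi)) (sq _ (smooth_pd i sf)) (sq _ sphi).
rewrite /inn => ->; rewrite /Rintegral [X in fine X](_ : _ = 0%E)//.
rewrite -[RHS]H; last by move=> p /phiK ->; rewrite mulr0.
by apply: eq_integral => p _; rewrite pd_mul// addrC.
Qed.

End IntegrationByParts.

Section WeakDerivatives.
Context {R : realType}.
Implicit Types (om : set (R * R)) (p : R * R) (phi f g h u v w : R * R -> R) (i j : 'I_2).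
Implicit Types (M Q N : R * R -> 'M[R]_2).
Local Notation plane := (measurableTypeR R * measurableTypeR R)%type.

Lemma L2P om f : open om -> L2 om f <-> sqint leb2 om f.
Proof. by move=> /open_measurable_plane mom; exact: sqint_Lfun. Qed.

Lemma L2_test om phi : open om -> test om phi -> sqint leb2 om phi.
Proof.
move=> oom tphi; have mom := open_measurable_plane oom.
have [B [B0 phiB]] := test_box tphi.
have mc := @measurable_cbox R (- B) B (- B) B.
have cphi := smooth_continuous (test_smooth tphi).
have [_ sc] := continuous_sqint_plane mc (@bounded_set_cbox R _ _ _ _) cphi.
split; first exact: continuous_measurable_plane.
apply: (integrableS measurableT mom) => //.
rewrite (_ : EFin \o _ = (EFin \o (fun p => phi p ^+ 2)) \_ (cbox (- B) B (- B) B)); last first.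
  apply/funext => p; rewrite patchE; case: ifPn => //= pB.
  rewrite phiB ?expr0n// => /obox_cbox/mem_set; exact/negP.
exact/(integrable_mkcond _ mc).
Qed.

Lemma L2_uniq om f g : open om -> L2 om f -> L2 om g ->
  (forall phi, test om phi -> ip om f phi = ip om g phi) ->
  {ae leb2, forall p, om p -> f p = g p}.
Proof.
move=> oom /(L2P _ oom) sf /(L2P _ oom) sg H; have mom := open_measurable_plane oom.
have sfg := sqintB mom sf sg.
have : {ae leb2, forall p, om p -> f p - g p = 0}.
  apply: (fundamental_lemma oom); first exact/L2P.
  move=> phi tphi; have sphi := L2_test oom tphi.
  by have := innBl mom sf sg sphi; rewrite /ip /inn => ->; apply/eqP; rewrite subr_eq0; apply/eqP/H.
by apply: filterS => p Hp /Hp /eqP; rewrite subr_eq0 => /eqP.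
Qed.

Lemma is_dDiv_uniq om M f g : open om -> is_dDiv om M f -> is_dDiv om M g ->
  {ae leb2, forall p, om p -> f p = g p}.
Proof.
by move=> oom [Lf Hf] [Lg Hg]; apply: L2_uniq => // phi tphi; rewrite -Hf// -Hg.
Qed.

Lemma ae_forall_fin (I : finType) (P : I -> R * R -> Prop) :
  (forall k, {ae leb2, forall p, P k p}) -> {ae leb2, forall p, forall k, P k p}.
Proof. by move=> H; apply: filter_forall. Qed.

Lemma is_hess_uniq om v M N : open om -> is_hess om v M -> is_hess om v N ->
  {ae leb2, forall p, om p -> M p = N p}.
Proof.
move=> oom [[_ LM] HM] [[_ LN] HN].
have : {ae leb2, forall p, forall i j, om p -> M p i j = N p i j}.
  apply: ae_forall_fin => i; apply: ae_forall_fin => j.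
  by apply: L2_uniq => // phi tphi; rewrite -HM// -HN.
by apply: filterS => p H omp; apply/matrixP => i j; exact: H.
Qed.

Lemma hessP om v M : is_hess om v M -> is_hess om v (hess om v).
Proof. by move=> H; exact: (@getPex _ [set N | is_hess om v N] (ex_intro _ M H)). Qed.

Lemma dDivP om M g : is_dDiv om M g -> is_dDiv om M (dDiv om M).
Proof. by move=> H; exact: (@getPex _ [set g | is_dDiv om M g] (ex_intro _ g H)). Qed.

Lemma hess_ae om v M : open om -> is_hess om v M ->
  {ae leb2, forall p, om p -> hess om v p = M p}.
Proof. by move=> oom H; apply: is_hess_uniq oom (hessP H) H. Qed.

Lemma dDiv_ae om M g : open om -> is_dDiv om M g ->
  {ae leb2, forall p, om p -> dDiv om M p = g p}.
Proof. by move=> oom H; apply: is_dDiv_uniq oom (dDivP H) H. Qed.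

End WeakDerivatives.

(** * Riesz representation *)

Section BilinearForm.
Context {R : realType} {V : lmodType R}.
Variables (S : set V) (a : V -> V -> R).
Implicit Types (u v w : V) (c t : R).
Hypothesis S_lin : forall c u v, S u -> S v -> S (u + c *: v).
Hypothesis a_sym : forall u v, S u -> S v -> a u v = a v u.
Hypothesis a_lin : forall c u v w, S u -> S v -> S w ->
  a (u + c *: v) w = a u w + c * a v w.
Hypothesis a_ge0 : forall u, S u -> 0 <= a u u.

Lemma form_linr c u v w : S u -> S v -> S w ->
  a w (u + c *: v) = a w u + c * a w v.
Proof.
by move=> Su Sv Sw; rewrite a_sym ?a_lin// ?(a_sym Su)// ?(a_sym Sv)//; exact: S_lin.
Qed.

Lemma form_sqr c u v : S u -> S v ->
  a (u + c *: v) (u + c *: v) = a u u + 2 * c * a u v + c ^+ 2 * a v v.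
Proof.
move=> Su Sv; have Suv := S_lin c Su Sv.
by rewrite a_lin// !form_linr// (a_sym Sv Su); ring.
Qed.

Lemma S_sub u v : S u -> S v -> S (u - v).
Proof. by move=> Su Sv; rewrite -scaleN1r; exact: S_lin. Qed.

Lemma form_sqrB u v : S u -> S v ->
  a (u - v) (u - v) = a u u - 2 * a u v + a v v.
Proof. by move=> Su Sv; rewrite -scaleN1r form_sqr//; ring. Qed.

(** Stated for real coefficients because it serves twice: for the Cauchy-Schwarz inequality, and in
    [riesz_representation] with [x] a bound for the gap to the infimum. *)
Lemma form_discr (x y z : R) : 0 <= z -> (forall t, 0 <= x + 2 * t * y + t ^+ 2 * z) ->
  y ^+ 2 <= x * z.
Proof.
move=> z0 H; have x0 : 0 <= x by have := H 0; lra.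
move: z0; rewrite le_eqVlt => /predU1P[z0|z0]; last first.
  have := H (- y / z); rewrite -(ler_pM2r z0) mul0r => /le_trans.
  move=> /(_ (x * z - y ^+ 2)); rewrite subr_ge0; apply.
  by rewrite le_eqVlt; apply/orP; left; apply/eqP; field; rewrite gt_eqF.
rewrite -z0 mulr0; have [->|y0] := eqVneq y 0; first by rewrite expr0n.
have := H (- (x + 1) / (2 * y)).
by rewrite -z0 mulr0 addr0 (_ : 2 * _ * y = - (x + 1)); [lra|field].
Qed.

Lemma form_cauchy_schwarz u v : S u -> S v -> a u v ^+ 2 <= a u u * a v v.
Proof.
move=> Su Sv; apply: form_discr => [|t]; first exact: a_ge0.
by rewrite -form_sqr//; apply: a_ge0; exact: S_lin.
Qed.

Lemma form_sqrB_le u v : S u -> S v -> a (u - v) (u - v) <= 2 * a u u + 2 * a v v.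
Proof.
move=> Su Sv; have := a_ge0 (S_lin 1 Su Sv); rewrite form_sqr// form_sqrB//; lra.
Qed.

(** The first hypothesis is what the value at the midpoint looks like after rewriting; [k] and [l]
    are the values of [L] at the two vectors. The parallelogram identity then bounds [x - 2 * y + z]
    by [2 * (h + h')]. *)
Lemma midpoint_bound (m e x y z k l h h' : R) :
  m <= 0 - 2 * 0 + 2 / 2 * (0 - (k + 1 * l)) +
    2^-1 ^+ 2 * (x + 2 * 1 * y + 1 ^+ 2 * z) ->
  x - 2 * k < m + h -> z - 2 * l < m + h' -> h <= e / 4 -> h' <= e / 4 ->
  x - 2 * y + z <= e.
Proof. lra. Qed.

Lemma variation_bound (m h t x y z : R) : m <= x + 2 * t * y + t ^+ 2 * z ->
  x < m + h -> 0 <= h + 2 * t * y + t ^+ 2 * z.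
Proof. lra. Qed.

Lemma form_cauchy_of_cvg (u_ : nat -> V) u : (forall n, S (u_ n)) -> S u ->
  (fun n => a (u_ n - u) (u_ n - u)) @ \oo --> (0 : R) ->
  forall e, 0 < e -> exists N, forall m n, (N <= m)%N -> (N <= n)%N ->
    a (u_ m - u_ n) (u_ m - u_ n) <= e.
Proof.
move=> Su_ Su /cvgrPdist_le cu e e0.
have [N _ HN] := cu (e / 4) (divr_gt0 e0 (ltr0Sn _ 3)).
exists N => m n Nm Nn.
have := HN _ Nm; have := HN _ Nn; rewrite /= !sub0r !normrN.
have Sm := S_sub (Su_ m) Su; have Sn := S_sub (Su_ n) Su.
rewrite !ger0_norm ?a_ge0// => H1 H2.
have -> : u_ m - u_ n = (u_ m - u) - (u_ n - u) by rewrite opprB addrA subrK.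
by apply: (le_trans (form_sqrB_le Sm Sn)); lra.
Qed.

(* Minimise [v |-> a v v - 2 L v]: by the parallelogram identity a minimising
   sequence is Cauchy. *)
Lemma riesz_representation (L : V -> R) (K : R) : S 0 ->
  (forall u_ : nat -> V, (forall n, S (u_ n)) ->
    (forall e, 0 < e -> exists N, forall m n, (N <= m)%N -> (N <= n)%N ->
      a (u_ m - u_ n) (u_ m - u_ n) <= e) ->
    exists2 u, S u & (fun n => a (u_ n - u) (u_ n - u)) @ \oo --> (0 : R)) ->
  (forall c u v, S u -> S v -> L (u + c *: v) = L u + c * L v) ->
  (forall v, S v -> L v ^+ 2 <= K * a v v) ->
  exists2 u, S u & forall v, S v -> a u v = L v.
Proof.
move=> S0 complete L_lin L_bnd.
pose J v := a v v - 2 * L v.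
have J_line c u v : S u -> S v ->
    J (u + c *: v) = J u + 2 * c * (a u v - L v) + c ^+ 2 * a v v.
  by move=> Su Sv; rewrite /J form_sqr// L_lin//; ring.
have J_bnd v : S v -> - `|K| <= J v.
  move=> Sv; have := L_bnd _ Sv; have := a_ge0 Sv; rewrite /J.
  have : K * a v v <= `|K| * a v v by rewrite ler_wpM2r ?a_ge0// ler_norm.
  have := normr_ge0 K.
  set x := a v v; set y := L v; set k := `|K| => k0 Kk x0 yK.
  have : 2 * y <= x + k.
    apply: contraTT isT; rewrite -ltNge => H.
    have : (x + k) ^+ 2 < (2 * y) ^+ 2 by rewrite ltrXn2r// ?nnegrE; lra.
    have := sqr_ge0 (x - k); nra.
  lra.
pose JS := [set J v | v in S].
have hasinf : has_inf JS.
  split; first by exists (J 0), 0.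
  by exists (- `|K|) => _ [v Sv <-]; exact: J_bnd.
pose m := inf JS.
have m_le v : S v -> m <= J v.
  by move=> Sv; apply: ge_inf; [case: hasinf|exists v].
have /choice[v_ v_P] n : exists v, S v /\ J v < m + n.+1%:R^-1.
  have n0 : 0 < n.+1%:R^-1 :> R by rewrite invr_gt0.
  by have [_ [v Sv <-] vm] := inf_adherent n0 hasinf; exists v.
have Sv_ n : S (v_ n) by case: (v_P n).
have cv : forall e, 0 < e -> exists N, forall m n, (N <= m)%N -> (N <= n)%N ->
    a (v_ m - v_ n) (v_ m - v_ n) <= e.
  move=> e e0; have [N _ HN] : \forall n \near \oo, (n.+1%:R^-1 : R) <= e / 4.
    have /cvgrPdist_le/(_ (e / 4)) : harmonic @ \oo --> (0 : R) by exact: cvg_harmonic.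
    move=> /(_ (divr_gt0 e0 (ltr0Sn _ 3))); apply: filterS => n /=.
    by rewrite sub0r normrN ger0_norm// invr_ge0.
  exists N => i j /HN /= Ni /HN /= Nj.
  have Smid := S_lin 1 (Sv_ i) (Sv_ j).
  (* The midpoint is written as [0 + 2^-1 *: (v_ i + 1 *: v_ j)], the shape to which [J_line]
     applies. *)
  have Sh := S_lin 2^-1 S0 Smid.
  have Jm := m_le _ Sh; move: Jm.
  rewrite J_line// /J form_sqr// (_ : a 0 (v_ i + 1 *: v_ j) = 0); last first.
    by have := a_lin (-1) S0 S0 Smid; rewrite scaler0 addr0; lra.
  rewrite (_ : a 0 0 = 0); last by have := a_lin (-1) S0 S0 S0; rewrite scaler0 addr0; lra.
  rewrite (_ : L 0 = 0); last by have := L_lin (-1) _ _ S0 S0; rewrite scaler0 addr0; lra.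
  rewrite L_lin// form_sqrB//.
  move=> Jm; have [_ Ji] := v_P i; have [_ Jj] := v_P j.
  exact: midpoint_bound Jm Ji Jj Ni Nj.
have [u Su cu] := complete _ Sv_ cv.
exists u => // w Sw.
(* The residual of [u] is compared with that of [v_ n], which is small because [v_ n] almost
   minimises [J] along the line in direction [w]. *)
have key n : (a u w - L w) ^+ 2 <=
    2 * (a (v_ n - u) (v_ n - u) * a w w) + 2 * (n.+1%:R^-1 * a w w).
  have Svu := S_sub (Sv_ n) Su.
  have E : a u w - L w = (a (v_ n) w - L w) - a (v_ n - u) w.
    by rewrite -(scaleN1r u) a_lin//; ring.
  have H1 : (a (v_ n) w - L w) ^+ 2 <= n.+1%:R^-1 * a w w.
    apply: form_discr => [|t]; first exact: a_ge0.
    have := m_le _ (S_lin t (Sv_ n) Sw); rewrite J_line// => Jm.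
    by have [_ Jn] := v_P n; exact: variation_bound Jm Jn.
  rewrite E (le_trans (sqrB_le _ _))// addrC lerD// ler_pM2l//.
  exact: form_cauchy_schwarz.
have lim : (fun n => 2 * (a (v_ n - u) (v_ n - u) * a w w) + 2 * (n.+1%:R^-1 * a w w)) @ \oo -->
    2 * (0 * a w w) + 2 * (0 * a w w).
  apply: cvgD; apply: cvgM; [exact: cvg_cst| |exact: cvg_cst|].
    by apply: cvgM; [exact: cu|exact: cvg_cst].
  by apply: cvgM; [exact: cvg_harmonic|exact: cvg_cst].
have : (a u w - L w) ^+ 2 <= 2 * (0 * a w w) + 2 * (0 * a w w).
  exact: (ler_cvg_to (cvg_cst _) lim (nearW _ key)).
rewrite !mul0r !mulr0 addr0 -[_ ^+ 2]ger0_norm ?sqr_ge0// normr_le0 sqrf_eq0 subr_eq0.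
by move=> /eqP.
Qed.

End BilinearForm.

(** * Weak Hessians *)

Lemma Rintegral_sum d (T : measurableType d) (R : realType)
    (mu : {measure set T -> \bar R}) (D : set T) (I : Type) (s : seq I) (F : I -> T -> R) :
  measurable D -> (forall i, mu.-integrable D (EFin \o F i)) ->
  \int[mu]_(x in D) (\sum_(i <- s) F i x) = \sum_(i <- s) \int[mu]_(x in D) F i x.
Proof.
move=> mD iF; elim: s => [|i s IH].
  rewrite big_nil /Rintegral; under eq_integral do rewrite big_nil.
  by rewrite integral0.
rewrite big_cons -IH -RintegralD//.
  by apply: eq_Rintegral => x _; rewrite big_cons.
have := integrable_sum mD s (P := xpredT) (fun j _ => iF j).
by apply: eq_integrable => // x _; rewrite /= sumEFin.
Qed.

Section HessianAlgebra.
Context {R : realType}.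
Variable om : set (R * R).
Hypothesis oom : open om.
Implicit Types (phi f g h u v w : R * R -> R) (i j : 'I_2) (c : R).
Implicit Types (M Q N : R * R -> 'M[R]_2).
Local Notation plane := (measurableTypeR R * measurableTypeR R)%type.

Let mom : measurable (om : set plane) := open_measurable_plane oom.

Lemma L2_lin c f g : L2 om f -> L2 om g -> L2 om (f + c *: g).
Proof.
move=> /(L2P _ oom) sf /(L2P _ oom) sg; apply/(L2P _ oom).
apply: (@sqintD _ _ _ leb2 om mom f (fun p => c * g p)) => //.
exact: sqintZ.
Qed.

Lemma ip_sym f g : ip om f g = ip om g f.
Proof. exact: innC. Qed.

Lemma ip_lin c f g h : L2 om f -> L2 om g -> L2 om h ->
  ip om (f + c *: g) h = ip om f h + c * ip om g h.
Proof.
move=> /(L2P _ oom) sf /(L2P _ oom) sg /(L2P _ oom) sh.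
have := innDl mom sf (sqintZ mom c sg) sh; rewrite innZl//; exact.
Qed.

Lemma ip_ge0 f : 0 <= ip om f f.
Proof. exact: inn_ge0. Qed.

Lemma ip_ae f g h : L2 om f -> L2 om g -> L2 om h ->
  {ae leb2, forall p, om p -> f p = g p} -> ip om f h = ip om g h.
Proof.
move=> /(L2P _ oom) sf /(L2P _ oom) sg /(L2P _ oom) sh; exact: ae_eq_inn.
Qed.

Lemma L2S_entry M i j : L2S om M -> sqint leb2 om (fun p => M p i j).
Proof. by move=> [_ LM]; exact/(L2P _ oom). Qed.

Lemma ipSE M Q : L2S om M -> L2S om Q ->
  ipS om M Q = \sum_i \sum_j inn leb2 om (fun p => M p i j) (fun p => Q p i j).
Proof.
move=> sM sQ; rewrite /ipS /frob.
have I i j : leb2.-integrable (om : set plane) (EFin \o (fun p => M p i j * Q p i j)).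
  by apply: sqint_integrable_mul => //; exact: L2S_entry.
rewrite Rintegral_sum//.
  by apply: eq_bigr => i _; rewrite Rintegral_sum.
move=> i; have := integrable_sum mom (index_enum 'I_2) (P := xpredT) (fun j _ => I i j).
by apply: eq_integrable => // x _; rewrite /= sumEFin.
Qed.

Lemma ipS_sym M Q : ipS om M Q = ipS om Q M.
Proof.
apply: eq_Rintegral => p _; apply: eq_bigr => i _; apply: eq_bigr => j _.
exact: mulrC.
Qed.

Lemma symm_lin (A B : 'M[R]_2) c : symm A -> symm B -> symm (A + c *: B).
Proof. by rewrite /symm => sA sB; rewrite linearD linearZ /= sA sB. Qed.

Lemma L2S_lin c M Q : L2S om M -> L2S om Q -> L2S om (M + c *: Q).
Proof.
move=> [sM LM] [sQ LQ]; split.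
  by move=> p omp; apply: symm_lin; [exact: sM|exact: sQ].
move=> i j; rewrite (_ : (fun p => _) = (fun p => M p i j) + c *: (fun p => Q p i j)).
  exact: L2_lin.
by apply/funext => p; rewrite !mxE.
Qed.

Lemma L2S0 : L2S om 0.
Proof.
split; first by move=> p _; rewrite /symm trmx0.
move=> i j; apply/(L2P _ oom).
by rewrite (_ : (fun p => _) = fun=> 0); [exact: sqint0|apply/funext => p; rewrite mxE].
Qed.

Lemma ipS_lin c M Q N : L2S om M -> L2S om Q -> L2S om N ->
  ipS om (M + c *: Q) N = ipS om M N + c * ipS om Q N.
Proof.
move=> sM sQ sN; have sMQ := L2S_lin c sM sQ.
rewrite !ipSE// mulr_sumr -big_split; apply: eq_bigr => i _.
rewrite mulr_sumr -big_split; apply: eq_bigr => j _ /=.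
rewrite -innZl//; try exact: L2S_entry.
rewrite -innDl//; try exact: L2S_entry; last by apply: sqintZ => //; exact: L2S_entry.
by apply: eq_inn => // p _; rewrite !mxE.
Qed.

Lemma frob_ge0 (A : 'M[R]_2) : 0 <= frob A A.
Proof. by apply: sumr_ge0 => i _; apply: sumr_ge0 => j _; rewrite -expr2 sqr_ge0. Qed.

Lemma frob_eq0 (A : 'M[R]_2) : frob A A = 0 -> A = 0.
Proof.
move=> /eqP; rewrite psumr_eq0; last first.
  by move=> i _; apply: sumr_ge0 => j _; rewrite -expr2 sqr_ge0.
move=> /allP H; apply/matrixP => i j; rewrite mxE.
have := H i (mem_index_enum _) => /= ; rewrite psumr_eq0; last by move=> k _; rewrite -expr2 sqr_ge0.
by move=> /allP /(_ j (mem_index_enum _)) /=; rewrite -expr2 sqrf_eq0 => /eqP.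
Qed.

Lemma ipS_ge0 M : 0 <= ipS om M M.
Proof. by apply: Rintegral_ge0 => p _; exact: frob_ge0. Qed.

Lemma ipS_ae M N Q : L2S om M -> L2S om N -> L2S om Q ->
  {ae leb2, forall p, om p -> M p = N p} -> ipS om M Q = ipS om N Q.
Proof.
move=> sM sN sQ MN; rewrite !ipSE//; apply: eq_bigr => i _; apply: eq_bigr => j _.
apply: ae_eq_inn => //; try exact: L2S_entry.
by apply: filterS MN => p H /H ->.
Qed.

Lemma ipS_ae2 M N Q P : L2S om M -> L2S om N -> L2S om Q -> L2S om P ->
  {ae leb2, forall p, om p -> M p = N p} -> {ae leb2, forall p, om p -> Q p = P p} ->
  ipS om M Q = ipS om N P.
Proof. by move=> sM sN sQ sP MN QP; rewrite (ipS_ae sM sN sQ MN) ipS_sym (ipS_ae sQ sP sN QP) ipS_sym. Qed.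

Lemma ipS_eq0 M : L2S om M -> ipS om M M = 0 -> {ae leb2, forall p, om p -> M p = 0}.
Proof.
move=> sM; rewrite ipSE// => /eqP; rewrite psumr_eq0; last first.
  by move=> i _; apply: sumr_ge0 => j _; exact: inn_ge0.
move=> /allP H.
have : {ae leb2, forall p, forall i j, om p -> M p i j = 0}.
  apply: ae_forall_fin => i; apply: ae_forall_fin => j; apply: inn_eq0 => //; first exact: L2S_entry.
  have := H i (mem_index_enum _) => /=; rewrite psumr_eq0; last by move=> k _; exact: inn_ge0.
  by move=> /allP /(_ j (mem_index_enum _)) /= /eqP.
by apply: filterS => p Hp omp; apply/matrixP => i j; rewrite mxE; exact: Hp.
Qed.

(** [H2] without the first derivatives: the part that [norm2] controls directly and in which limits
    are taken. The first derivatives are recovered in [zero_trace_H2]. *)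
Definition hasH v := L2 om v /\ exists M, is_hess om v M.

Lemma is_hess_lin c v w M N : L2 om v -> L2 om w -> is_hess om v M -> is_hess om w N ->
  is_hess om (v + c *: w) (M + c *: N).
Proof.
move=> Lv Lw [sM HM] [sN HN]; split; first exact: L2S_lin.
move=> phi tphi i j.
have Lp := (L2P _ oom).2 (L2_test oom (test_pd i (test_pd j tphi))).
have Lphi := (L2P _ oom).2 (L2_test oom tphi).
rewrite ip_lin// HM// HN//.
have := @ip_lin c (fun p => M p i j) (fun p => N p i j) phi; rewrite (_ : _ + _ = (fun p => (M + c *: N) p i j)).
  by move=> -> //; [case: sM|case: sN].
by apply/funext => p; rewrite !mxE.
Qed.

Lemma hasH_lin c v w : hasH v -> hasH w -> hasH (v + c *: w).
Proof.
move=> [Lv [M HM]] [Lw [N HN]]; split; first exact: L2_lin.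
by exists (M + c *: N); exact: is_hess_lin.
Qed.

Lemma hasH_hess v : hasH v -> is_hess om v (hess om v).
Proof. by move=> [_ [M /hessP]]. Qed.

Lemma hasH_L2S v : hasH v -> L2S om (hess om v).
Proof. by move=> /hasH_hess []. Qed.

Lemma hess_lin c v w : hasH v -> hasH w ->
  {ae leb2, forall p, om p -> hess om (v + c *: w) p = (hess om v + c *: hess om w) p}.
Proof.
move=> Hv Hw; apply: hess_ae => //.
by apply: is_hess_lin; [case: Hv|case: Hw|exact: hasH_hess|exact: hasH_hess].
Qed.

Definition form2 v w := ip om v w + ipS om (hess om v) (hess om w).

Lemma form2_sym v w : form2 v w = form2 w v.
Proof. by rewrite /form2 ip_sym ipS_sym. Qed.

Lemma form2_lin c u v w : hasH u -> hasH v -> hasH w ->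
  form2 (u + c *: v) w = form2 u w + c * form2 v w.
Proof.
move=> Hu Hv Hw; rewrite /form2 ip_lin//; [|by case: Hu|by case: Hv|by case: Hw].
have sH := hasH_L2S Hu; have sH' := hasH_L2S Hv.
rewrite (ipS_ae (hasH_L2S (hasH_lin c Hu Hv)) (L2S_lin c sH sH') (hasH_L2S Hw) (hess_lin c Hu Hv)).
by rewrite (ipS_lin c sH sH' (hasH_L2S Hw)) mulrDr addrACA.
Qed.

Lemma form2_ge0 v : 0 <= form2 v v.
Proof. by rewrite addr_ge0 ?ip_ge0 ?ipS_ge0. Qed.

Lemma norm2E v : norm2 om v = Num.sqrt (form2 v v).
Proof.
by rewrite /norm2 /norm_L2 /norm_L2S !sqr_sqrtr ?ip_ge0 ?ipS_ge0.
Qed.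

Lemma norm2_sqr v : norm2 om v ^+ 2 = form2 v v.
Proof. by rewrite norm2E sqr_sqrtr// form2_ge0. Qed.

End HessianAlgebra.

Section SmoothHessian.
Context {R : realType}.
Variable om : set (R * R).
Hypotheses (oom : open om) (bom : bounded_set om).
Implicit Types (phi f g h u v w : R * R -> R) (i j : 'I_2) (c : R).
Local Notation plane := (measurableTypeR R * measurableTypeR R)%type.

Lemma L2_continuous f : continuous f -> L2 om f.
Proof.
move=> cf; apply/(L2P _ oom); apply: continuous_sqint_plane => //.
exact: open_measurable_plane.
Qed.

Lemma L2_smooth f : smooth f -> L2 om f.
Proof. by move=> /smooth_continuous; exact: L2_continuous. Qed.

Lemma is_hess_smooth f : smooth f -> is_hess om f (chess f).
Proof.
move=> sf; split.
  split; first by move=> p _; apply/matrixP => i j; rewrite !mxE smooth_schwarz.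
  move=> i j; rewrite (_ : (fun p => _) = pd i (pd j f)).
    by apply: L2_smooth; do 2 apply: smooth_pd.
  by apply/funext => p; rewrite mxE.
move=> phi tphi i j.
rewrite (ip_pd i sf (test_pd j tphi)) (ip_pd j (smooth_pd i sf) tphi) opprK.
by apply: eq_Rintegral => p _; rewrite mxE smooth_schwarz.
Qed.

Lemma hasH_smooth f : smooth f -> hasH om f.
Proof. by move=> sf; split; [exact: L2_smooth|exists (chess f); exact: is_hess_smooth]. Qed.

Lemma hess_smooth f : smooth f ->
  {ae leb2, forall p, om p -> hess om f p = chess f p}.
Proof. by move=> sf; apply: hess_ae => //; exact: is_hess_smooth. Qed.

Lemma H2_hasH v : H2 om v -> hasH om v.
Proof. by case. Qed.

End SmoothHessian.

(** * Poincare inequality *)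

Section AffineSubstitution.
Context {R : realType}.
Implicit Types (g : R -> R) (p c : R).
Local Notation leb := (@lebesgue_measure R).

Lemma derive1_affine p c : derive1 (fun s : R => p + c * s) = cst c.
Proof.
apply/funext => s; rewrite derive1E; have H : is_derive s 1 (fun s : R => p + c * s) c.
  by apply: is_derive_eq; rewrite /GRing.scale/=; ring.
by case: H.
Qed.

Lemma derivable_affine p c (a b : R) : derivable_oo_LRcontinuous (fun s : R => p + c * s) a b.
Proof.
have H (s : R) : is_derive s 1 (fun s : R => p + c * s) c.
  by apply: is_derive_eq; rewrite /GRing.scale/=; ring.
have cF := is_derive_continuous H.
split; first by move=> s _; case: (H s).
- exact/cvg_at_right_filter/cF.
- exact/cvg_at_left_filter/cF.
Qed.

(** Substitution [y = p + c * s]. It turns an integral over the heights at which horizontal lines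
    meet an edge into one over the edge parameter; edges run upwards or downwards, hence both signs
    of [c]. *)
Lemma integral_affine g p c : c != 0 -> continuous g ->
  (\int[leb]_y (g ((y - p) / c) * \1_`[0, 1] ((y - p) / c))%:E)%E =
  (`|c| * \int[leb]_(s in `[0, 1]) g s)%:E.
Proof.
move=> c0 cg; pose F s : R := p + c * s; pose G y : R := g ((y - p) / c).
have cG : continuous G.
  move=> y; apply: (@continuous_comp _ _ _ (fun y => (y - p) / c) g); last exact: cg.
  by apply: cvgM; [apply: cvgB; [exact: cvg_id|exact: cvg_cst]|exact: cvg_cst].
have GF s : G (F s) = g s by rewrite /G /F; congr g; field.
have int01 : (\int[leb]_(s in `[0%R, 1%R]) (g s)%:E)%E = (\int[leb]_(s in `[0, 1]) g s)%:E.
  rewrite /Rintegral fineK//; apply: integrable_fin_num; first exact: measurable_itvR.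
  exact: continuous_integrable_itv.
have ig := continuous_integrable_itv 0 1 cg.
have dF : derive1 F = cst c by exact: derive1_affine.
have supp (a b : R) : (forall y, a <= y <= b <-> 0 <= (y - p) / c <= 1) ->
    (\int[leb]_y (g ((y - p) / c) * \1_`[0%R, 1%R] ((y - p) / c))%:E =
     \int[leb]_(y in `[a, b]) (G y)%:E)%E.
  move=> ab; rewrite (@integral_supp_itv _ _ a b).
    apply: eq_integral => y; rewrite inE /= in_itv/= => /ab y01.
    by rewrite indicE mem_set ?mulr1//= in_itv.
  move=> y /ab y01; rewrite indicE memNset ?mulr0//= in_itv /=; exact: y01.
have [cpos|cneg] : 0 < c \/ c < 0 by move: c0; rewrite neq_lt => /orP[]; [right|left].
  rewrite (supp (F 0) (F 1)); last first.
    move=> y; rewrite /F mulr0 mulr1 addr0 ler_pdivrMr// ler_pdivlMr// mul0r mul1r.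
    by split=> /andP[? ?]; apply/andP; split; lra.
  rewrite integration_by_substitution_increasing//.
  - rewrite gtr0_norm// EFinM -int01 -(integralZl (measurable_itvR _) ig).
    by apply: eq_integral => s _; rewrite /= dF -EFinM mulrC; congr (_ * _)%:E; exact: GF.
  - by move=> x y _ _ xy; rewrite /F ltrD2l ltr_pM2l.
  - by rewrite dF => x _; exact: cvg_cst.
  - by rewrite dF; exact: is_cvg_cst.
  - by rewrite dF; exact: is_cvg_cst.
  - exact: derivable_affine.
  - exact: continuous_subspaceT.
rewrite (supp (F 1) (F 0)); last first.
  move=> y; rewrite /F mulr0 mulr1 addr0 ler_ndivrMr// ler_ndivlMr// mul0r mul1r.
  by split=> /andP[? ?]; apply/andP; split; lra.
rewrite integration_by_substitution_decreasing//.
- rewrite ltr0_norm// EFinM -int01 -(integralZl (measurable_itvR _) ig).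
  by apply: eq_integral => s _; rewrite /= dF -EFinM mulrC; congr (_ * _)%:E; exact: GF.
- by move=> x y _ _ xy; rewrite /F ltrD2l ltr_nM2l.
- by rewrite dF => x _; exact: cvg_cst.
- by rewrite dF; exact: is_cvg_cst.
- by rewrite dF; exact: is_cvg_cst.
- exact: derivable_affine.
- exact: continuous_subspaceT.
Qed.

End AffineSubstitution.

(** * Horizontal chords of an open set *)

Section Chord.
Context {R : realType}.

(** [b] is the infimum of the points beyond [x] outside [U]; openness of [U] keeps it outside. *)
Lemma right_exit (U : set R) (x B : R) : open U -> U x -> (forall t, U t -> t <= B) ->
  exists b, [/\ x < b, ~ U b & forall t, x <= t -> t < b -> U t].
Proof.
move=> oU Ux UB; pose E := [set t | x <= t /\ ~ U t].
have hi : has_inf E.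
  split; last by exists x => t [].
  exists (`|B| + `|x| + 1); split.
    by have := ler_norm x; have := normr_ge0 B; lra.
  by move=> /UB; have := ler_norm B; have := normr_ge0 x; lra.
pose b := inf E.
have xb : x <= b by apply: lb_le_inf; [case: hi|move=> t []].
have Ut t : x <= t -> t < b -> U t.
  move=> xt tb; apply: contrapT => nUt.
  have : b <= t by apply: ge_inf; [case: hi|split].
  by rewrite leNgt tb.
have nUb : ~ U b.
  move=> Ub; have : nbhs b U by exact: open_nbhs_nbhs.
  move=> /nbhs_ballP[e /= e0 bU].
  have [t [xt nUt] tb] := inf_adherent e0 hi.
  have bt : b <= t by apply: ge_inf; [case: hi|split].
  apply: nUt; apply: bU; rewrite /ball /= ltr_distlC; apply/andP.
  by rewrite -/b in tb; split; lra.
exists b; split=> //; rewrite lt_neqAle xb andbT; apply/eqP => E'.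
by apply: nUb; rewrite -E'.
Qed.

Lemma left_exit (U : set R) (x B : R) : open U -> U x -> (forall t, U t -> - B <= t) ->
  exists a, [/\ a < x, ~ U a & forall t, a < t -> t <= x -> U t].
Proof.
move=> oU Ux UB; pose V := [set t : R | U (- t)].
have oV : open V by apply: open_comp oU => t _; exact: oppr_continuous.
have Vx : V (- x) by rewrite /V /= opprK.
have VB t : V t -> t <= B by rewrite /V /= => /UB; lra.
have [b [xb nVb Vt]] := right_exit oV Vx VB.
exists (- b); split=> //; first by lra.
by move=> t bt tx; have := Vt (- t); rewrite /V /= opprK; apply; lra.
Qed.

Lemma continuous_pairl (y : R) : continuous (fun t : R => (t, y)).
Proof.
move=> t; apply/cvg_ballP => e e0; have H : nbhs t (ball t e) by exact: nbhsx_ballx.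
near=> s; apply/ballP2; split=> /=; first by near: s; exact: H.
by rewrite subrr normr0.
Unshelve. all: by end_near.
Qed.

(** The ends of the component of the section around [x] are limits of points of [om] without lying
    in it, so they are boundary points. *)
Lemma horizontal_chord (om : set (R * R)) (x y B : R) : open om -> om (x, y) ->
  om `<=` cbox (- B) B (- B) B ->
  exists a b, [/\ - B <= a < x, x < b <= B, bdry om (a, y), bdry om (b, y) &
    forall t, a < t < b -> om (t, y)].
Proof.
move=> oom omx omB; pose U := [set t : R | om (t, y)].
have oU : open U.
  by apply: open_comp oom => t _; exact: continuous_pairl.
have UB t : U t -> t <= B by move=> /omB[].
have UB' t : U t -> - B <= t by move=> /omB[].
have [b [xb nUb Ub]] := right_exit oU omx UB.
have [a [ax nUa Ua]] := left_exit oU omx UB'.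
have ti : interior om = om by move/interior_id : oom.
have bB : b <= B.
  rewrite leNgt; apply/negP => Bb.
  have : U ((Num.max x B + b) / 2).
    apply: Ub; rewrite ?ler_pdivlMr ?ltr_pdivrMr//.
      have : x <= Num.max x B by rewrite le_max lexx.
      lra.
    have : Num.max x B < b by rewrite gt_max xb.
    lra.
  move=> /UB; rewrite ler_pdivrMr//; have : B <= Num.max x B by rewrite le_max lexx orbT.
  lra.
have aB : - B <= a.
  rewrite leNgt; apply/negP => Ba.
  have : U ((Num.min x (- B) + a) / 2).
    apply: Ua; rewrite ?ltr_pdivlMr ?ler_pdivrMr//.
      have : a < Num.min x (- B) by rewrite lt_min ax.
      lra.
    have : Num.min x (- B) <= x by rewrite ge_min lexx.
    lra.
  move=> /UB'; rewrite ler_pdivlMr//; have : Num.min x (- B) <= - B by rewrite ge_min lexx orbT.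
  lra.
exists a, b; split.
- by rewrite aB.
- by rewrite xb.
- split; last by rewrite ti.
  move=> A /nbhs_ballP[e /= e0 aA].
  pose t := Num.min x (a + e / 2).
  have ta : a < t by rewrite lt_min ax/=; lra.
  exists (t, y); split; first by apply: Ua => //; rewrite ge_min lexx.
  apply: aA; apply/ballP2; split=> /=; last by rewrite subrr normr0.
  have : t <= a + e / 2 by rewrite ge_min lexx orbT.
  by rewrite ltr_distlC => ?; apply/andP; split; lra.
- split; last by rewrite ti.
  move=> A /nbhs_ballP[e /= e0 bA].
  pose t := Num.max x (b - e / 2).
  have tb : t < b by rewrite gt_max xb/=; lra.
  exists (t, y); split; first by apply: Ub => //; rewrite le_max lexx.
  apply: bA; apply/ballP2; split=> /=; last by rewrite subrr normr0.
  have : b - e / 2 <= t by rewrite le_max lexx orbT.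
  by rewrite ltr_distlC => ?; apply/andP; split; lra.
- move=> t /andP[at' tb']; have [xt|/ltW tx] := leP x t.
    exact: Ub.
  exact: Ua.
Qed.

End Chord.

Section Poincare.
Context {R : realType}.
Variables (om : set (R * R)) (m : nat) (E : 'I_m -> (R * R) * (R * R)) (B : R).
Hypotheses (oom : open om) (om_bounded : bounded_set om) (B0 : 0 < B)
  (omB : om `<=` cbox (- B) B (- B) B)
  (bom : bdry om = \bigcup_k closed_seg (E k).1 (E k).2).
Implicit Types (phi f : R * R -> R) (k : 'I_m) (x y s : R).
Local Notation leb := (@lebesgue_measure R).
Local Notation plane := (measurableTypeR R * measurableTypeR R)%type.

Let height k : R := (E k).2.2 - (E k).1.2.
Let param k y : R := (y - (E k).1.2) / height k.
Let edge_sqr phi k s : R := phi (seg_pt (E k).1 (E k).2 s) ^+ 2.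
(** Collects the squares of [phi] at all crossings of the line at height [y] with non-horizontal
    edges. It dominates the end values of every chord at that height and is measurable in [y],
    whereas the chord itself varies with the point. *)
Let cross_sqr phi y : R :=
  \sum_k if height k == 0 then 0 else edge_sqr phi k (param k y) * \1_`[0, 1] (param k y).

Let mom : measurable (om : set plane) := open_measurable_plane oom.

Let B2_ge0 : 0 <= 2 * B.
Proof. by apply: mulr_ge0 => //; exact: ltW. Qed.

Let integrand f (z : plane) : \bar R := (f z ^+ 2 * \1_om z)%:E.

Let cross_sqr_ge0 phi y : 0 <= cross_sqr phi y.
Proof.
apply: sumr_ge0 => k _; case: ifP => // _; apply: mulr_ge0; first exact: sqr_ge0.
by rewrite indicE.
Qed.

(** A height that avoids the horizontal edges forces the boundary point onto an edge on which [y]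
    determines the parameter. *)
Let bdry_le_cross_sqr phi x y : bdry om (x, y) ->
  (forall k, height k = 0 -> y <> (E k).1.2) -> phi (x, y) ^+ 2 <= cross_sqr phi y.
Proof.
rewrite bom => -[k _ [s s01 xy]] ny.
have y2 : y = (E k).1.2 + s * height k by have := congr1 snd xy; rewrite /seg_pt/= => <-.
have hk : height k != 0.
  by apply/eqP => hk; apply: (ny k hk); rewrite y2 hk mulr0 addr0.
have ps : param k y = s by rewrite /param y2 addrAC subrr add0r mulfK.
rewrite /cross_sqr (bigD1 k)//= (negbTE hk) ps /edge_sqr xy indicE mem_set// mulr1 lerDl.
apply: sumr_ge0 => l _; case: ifP => // _; apply: mulr_ge0; first exact: sqr_ge0.
by rewrite indicE.
Qed.

Let integrand_ge0 f z : (0 <= integrand f z)%E.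
Proof. by rewrite lee_fin mulr_ge0 ?sqr_ge0// indicE. Qed.

Let measurable_integrand f : continuous f -> measurable_fun setT (integrand f).
Proof.
move=> cf; apply/measurable_EFinP/measurable_funM.
  by apply: measurable_funX; exact: continuous_measurable_plane.
exact: measurable_indic.
Qed.

Let integral_integrand f : continuous f -> 
  (\int[leb]_y fubini_G leb (integrand f) y)%E = (ip om f f)%:E.
Proof.
move=> cf; rewrite -fubini_tonelli2//; last exact: measurable_integrand.
have sf := continuous_sqint_plane mom om_bounded cf.
rewrite /ip -/(inn leb2 om f f) EFin_inn//.
rewrite integral_mkcond; apply: eq_integral => z _.
by rewrite /integrand patchE indicE; case: ifPn => // _; rewrite ?mulr1 ?mulr0.
Qed.

(** [6] counts both ends with the factor [3] of [sqr_chord_bound]. The chord is at most [2 * B]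
    long, and its integral is at most that over the whole section of [om]. *)
Let sqr_le_chord phi x y : smooth phi -> (forall k, height k = 0 -> y <> (E k).1.2) ->
  (integrand phi (x, y) <= (6 * cross_sqr phi y)%:E +
    (3 * (2 * B) ^+ 3)%:E * fubini_G leb (integrand (pd ord0 (pd ord0 phi))) y)%E.
Proof.
move=> sp ny; set D := pd ord0 (pd ord0 phi).
have cD : continuous D by exact/smooth_continuous/smooth_pd/smooth_pd.
have G0 : (0 <= fubini_G leb (integrand D) y)%E by apply: integral_ge0 => t _; exact: integrand_ge0.
have [omx|nomx] := pselect (om (x, y)); last first.
  rewrite {1}/integrand indicE memNset// mulr0 adde_ge0//.
    by rewrite lee_fin mulr_ge0.
  by apply: mule_ge0 => //; rewrite lee_fin mulr_ge0// exprn_ge0// mulr_ge0// ltW.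
have [a [b [/andP[Ba ax] /andP[xb bB] ba bb omab]]] := horizontal_chord oom omx omB.
have axb : a < x < b by rewrite ax.
have spd := smooth_pd ord0 sp.
have := sqr_chord_bound axb (fun t => C1_derive_fst (smooth_C1 sp) t y)
  (fun t => C1_derive_fst (smooth_C1 spd) t y).
have cDy : continuous (fun t => D (t, y)).
  move=> t; apply: (@continuous_comp _ _ _ (fun t => (t, y)) D); last exact: cD.
  exact: continuous_pairl.
move=> /(_ cDy); set I := inn _ _ _ _ => phib.
have IG : (I%:E <= fubini_G leb (integrand D) y)%E.
  have sD := continuous_sqint a b cDy.
  rewrite /I (EFin_inn (measurable_itvR _) sD sD).
  rewrite integral_itv_bndoo; last first.
    apply/measurable_EFinP/measurable_funM; exact: measurable_funS (continuous_measurable_fun cDy).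
  have -> : (\int[leb]_(t in `]a, b[) (D (t, y) * D (t, y))%:E =
             \int[leb]_(t in `]a, b[) integrand D (t, y))%E.
    apply: eq_integral => t; rewrite inE/= in_itv/= => /omab omt.
    by rewrite /integrand indicE mem_set// mulr1 expr2.
  apply: ge0_subset_integral => //.
  by apply: (measurableT_comp (measurable_integrand cD)); exact: measurable_fun_pair.
have I0 : 0 <= I by exact: inn_ge0.
rewrite (@le_trans _ _ ((6 * cross_sqr phi y)%:E + (3 * (2 * B) ^+ 3)%:E * I%:E)%E)//; last first.
  apply: leeD; first exact: lexx.
  apply: lee_wpmul2l IG; rewrite lee_fin; apply: mulr_ge0 => //.
  by exact: exprn_ge0.
rewrite /integrand indicE mem_set// mulr1 -EFinM -EFinD lee_fin (le_trans phib)//.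
have := bdry_le_cross_sqr phi ba ny; have := bdry_le_cross_sqr phi bb ny.
have L : (b - a) ^+ 3 <= (2 * B) ^+ 3 by apply: lerXn2r; rewrite ?nnegrE; lra.
move: L; move: ((b - a) ^+ 3) ((2 * B) ^+ 3) (cross_sqr phi y) => X Y Z XY bZ aZ.
have : X * I <= Y * I by exact: ler_wpM2r.
by move: aZ bZ; rewrite -!(mulrA 3); move: (X * I) (Y * I) => U V; lra.
Qed.

Let continuous_edge_sqr phi k : smooth phi -> continuous (edge_sqr phi k).
Proof.
move=> sp; have c : continuous (fun s : R => phi (seg_pt (E k).1 (E k).2 s)).
  exact: (is_derive_continuous
    (fun s => C1_derive_line (E k).1 ((E k).2 - (E k).1) s (smooth_C1 sp))).
exact: continuous_mul.
Qed.

Let cross_term phi k y : R := edge_sqr phi k (param k y) * \1_`[0, 1] (param k y).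

Let cross_term_ge0 phi k y : 0 <= cross_term phi k y.
Proof. by apply: mulr_ge0; [exact: sqr_ge0|rewrite indicE]. Qed.

Let measurable_cross_term phi k : smooth phi -> measurable_fun setT (cross_term phi k).
Proof.
move=> sp; have mp : measurable_fun setT (param k).
  by apply: measurable_funM => //; exact: measurable_funB.
apply: measurable_funM.
  exact: (measurableT_comp (continuous_measurable_fun (continuous_edge_sqr (k:=k) sp)) mp).
apply: (measurableT_comp _ mp); apply: measurable_indic; exact: measurable_itvR.
Qed.

Let edge_integral phi k : R :=
  elen ((E k).2 - (E k).1) * \int[leb]_(s in `[0, 1]) edge_sqr phi k s.

Let edge_integral_ge0 phi k : 0 <= edge_integral phi k.
Proof.
apply: mulr_ge0; first exact: sqrtr_ge0.
by apply: Rintegral_ge0 => s _; exact: sqr_ge0.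
Qed.

(** Along an edge [dy] is the absolute value of [height k] times [ds], and the height of an edge is
    at most its length. *)
Let integral_cross_sqr phi : smooth phi ->
  (\int[leb]_y (cross_sqr phi y)%:E <= (\sum_k edge_integral phi k)%:E)%E.
Proof.
move=> sp; have -> : (\int[leb]_y (cross_sqr phi y)%:E = \int[leb]_y
    \sum_k (if height k == 0%R then 0%E else (cross_term phi k y)%:E))%E.
  apply: eq_integral => y _; rewrite /cross_sqr -sumEFin; apply: eq_bigr => k _.
  by case: ifP.
rewrite ge0_integral_sum//; last 2 first.
- move=> k; case: (height k == 0); first exact: measurable_cst.
  by apply/measurable_EFinP; exact: measurable_cross_term.
- by move=> k y _; case: ifP => // _; rewrite lee_fin.
rewrite -sumEFin; apply: lee_sum => k _; case: (boolP (height k == 0)) => [_|hk].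
  by rewrite integral0 lee_fin.
rewrite integral_affine//; last exact: continuous_edge_sqr.
rewrite lee_fin ler_wpM2r//; first by apply: Rintegral_ge0 => s _; exact: sqr_ge0.
rewrite /elen -sqrtr_sqr ler_wsqrtr// /dot -!expr2 lerDr; exact: sqr_ge0.
Qed.

(** The boundary term stays because approximants of a function in [H20] need not vanish on the
    edges. Integrating the chord estimate over [x] contributes the factor [2 * B] to both
    constants. *)
Lemma poincare_smooth phi : smooth phi ->
  ip om phi phi <= 12 * B * (\sum_k elen ((E k).2 - (E k).1) *
      \int[leb]_(s in `[0, 1]) phi (seg_pt (E k).1 (E k).2 s) ^+ 2)
    + 6 * B * (2 * B) ^+ 3 * ip om (pd ord0 (pd ord0 phi)) (pd ord0 (pd ord0 phi)).
Proof.
move=> sp; set D := pd ord0 (pd ord0 phi).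
have sD : smooth D by exact/smooth_pd/smooth_pd.
have cp := smooth_continuous sp; have cD := smooth_continuous sD.
rewrite -lee_fin -(integral_integrand cp).
have mH := measurable_integrand cD.
have mGH := measurable_fun_fubini_tonelli_G (m1 := leb) _ mH (integrand_ge0 D).
have mG := measurable_fun_fubini_tonelli_G (m1 := leb) _ (measurable_integrand cp) (integrand_ge0 phi).
have GH0 y : (0 <= fubini_G leb (integrand D) y)%E.
  by apply: integral_ge0 => t _; exact: integrand_ge0.
have mcs : measurable_fun setT (EFin \o cross_sqr phi).
  apply/measurable_EFinP; apply: measurable_sum => k; case: (height k == 0); first exact: measurable_cst.
  exact: measurable_cross_term.
have B3 : 0 <= 3 * (2 * B) ^+ 3 by apply: mulr_ge0 => //; exact: exprn_ge0.
pose bound y : \bar R := ((6 * cross_sqr phi y)%:E +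
    (3 * (2 * B) ^+ 3)%:E * fubini_G leb (integrand D) y)%E.
have bound0 y : (0 <= bound y)%E.
  by apply: adde_ge0; [rewrite lee_fin mulr_ge0|apply: mule_ge0 => //; rewrite lee_fin].
have mcs6 : measurable_fun setT (fun y => (6 * cross_sqr phi y)%:E).
  by apply/measurable_EFinP; apply: measurable_funM => //; exact/measurable_EFinP.
have mGH3 : measurable_fun setT (fun y => (3 * (2 * B) ^+ 3)%:E * fubini_G leb (integrand D) y)%E.
  exact: measurable_funeM.
have mbound : measurable_fun setT bound by exact: emeasurable_funD.
(* The exceptional heights are those of the initial points of edges, a finite set that contains the
   heights of all horizontal edges. *)
have good : {ae leb, forall y, setT y -> (fubini_G leb (integrand phi) y <= bound y * (2 * B)%:E)%E}.
  exists (\bigcup_k [set (E k).1.2]); split.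
  - by apply: fin_bigcup_measurable => // k _; exact: measurable_set1.
  - apply: countable_lebesgue_measure0; apply: bigcup_countable => // k _; exact: countable1.
  move=> y /= nbound; apply: contrapT => ny; apply: nbound => _.
  have ny' k : height k = 0 -> y <> (E k).1.2 by move=> _ yk; apply: ny; exists k.
  rewrite /fubini_G (@integral_supp_itv _ (fun x => phi (x, y) ^+ 2 * \1_om (x, y)) (- B) B); last first.
    move=> x nx; rewrite indicE memNset ?mulr0// => /omB[/= x1 x2 _ _].
    by apply: nx; rewrite x1.
  apply: (@le_trans _ _ (\int[leb]_(x in `[(- B)%R, B]) bound y)%E).
    apply: ge0_le_integral => //.
    - by move=> x _; exact: integrand_ge0.
    - apply: measurable_funTS; exact: (measurable_fun_pair1 y (measurable_integrand cp)).
    - by move=> x _; exact: sqr_le_chord.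
  have -> := @integral_cst _ _ _ leb _ (measurable_itvR `[- B, B]) (bound y).
  have vol : lebesgue_measure (`[- B, B]%classic : set R) = (2 * B)%:E.
    rewrite lebesgue_measure_itv /= lte_fin ifT; last by rewrite -subr_gt0 opprK addr_gt0.
    by rewrite -EFinB opprK -mulr2n mulr_natl.
  apply: lee_wpmul2l => //; rewrite le_eqVlt; apply/orP; left; apply/eqP; exact: vol.
have B2 : (0 <= (2 * B)%:E :> \bar R)%E by rewrite lee_fin.
apply: le_trans (ae_ge0_le_integral measurableT _ mG _ _ good) _.
- by move=> y _; apply: integral_ge0 => t _; exact: integrand_ge0.
- by move=> y _; exact: mule_ge0.
- exact: emeasurable_funM.
rewrite ge0_integralZr// ge0_integralD//; last 2 first.
- by move=> y _; rewrite lee_fin mulr_ge0.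
- by move=> y _; apply: mule_ge0 => //; rewrite lee_fin.
under eq_integral do rewrite EFinM.
have -> : (\int[leb]_y ((6 : R)%:E * (cross_sqr phi y)%:E) = (6 : R)%:E * \int[leb]_y (cross_sqr phi y)%:E)%E.
  apply: (@ge0_integralZl _ _ _ leb setT measurableT (EFin \o cross_sqr phi) mcs (6 : R)%:E).
    by move=> y _; rewrite lee_fin.
  by rewrite lee_fin.
have -> : (\int[leb]_y ((3 * (2 * B) ^+ 3)%:E * fubini_G leb (integrand D) y) =
    (3 * (2 * B) ^+ 3)%:E * \int[leb]_y fubini_G leb (integrand D) y)%E.
  by apply: (ge0_integralZl _ measurableT mGH) => //; rewrite lee_fin.
rewrite integral_integrand//.
apply: (@le_trans _ _ (((6 : R)%:E * (\sum_k edge_integral phi k)%:E +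
   (3 * (2 * B) ^+ 3)%:E * (ip om D D)%:E) * (2 * B)%:E)%E).
  apply: lee_wpmul2r => //; apply: leeD => //; apply: lee_wpmul2l => //.
  exact: integral_cross_sqr.
suff H : (6 * (\sum_k edge_integral phi k) + 3 * (2 * B) ^+ 3 * ip om D D) * (2 * B) =
    12 * B * (\sum_k edge_integral phi k) + 6 * B * (2 * B) ^+ 3 * ip om D D.
  rewrite -H; exact: lexx.
move: (\sum_k _) ((2 * B) ^+ 3) (ip om D D) => X Y Z; ring.
Qed.

End Poincare.

(** * Homogeneous traces *)

Lemma cvg0_sqr_le (R : realType) (x y : nat -> R) : (forall n, x n ^+ 2 <= y n) ->
  y @ \oo --> (0 : R) -> x @ \oo --> (0 : R).
Proof.
move=> xy y0; apply/norm_cvg0P.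
have s0 : (fun n => Num.sqrt (y n)) @ \oo --> (0 : R).
  have := continuous_cvg _ (@sqrt_continuous R 0) y0; rewrite sqrtr0; exact.
apply: (@squeeze_cvgr _ _ _ _ (fun=> 0) (fun n => Num.sqrt (y n))) => //; last exact: cvg_cst.
by apply: nearW => n; rewrite /= normr_ge0/= -sqrtr_sqr ler_wsqrtr.
Qed.

Lemma cvg0_le_eps (R : realType) (x : nat -> R) (e : R) : 0 < e -> x @ \oo --> (0 : R) ->
  exists N, forall n, (N <= n)%N -> x n <= e.
Proof.
move=> e0 /cvgr0Pnorm_le/(_ _ e0)[N _ H]; exists N => n Nn.
exact: le_trans (ler_norm _) (H _ Nn).
Qed.

Section SquareIntegrableLimits.
Context d (T : measurableType d) (R : realType).
Variable mu : {measure set T -> \bar R}.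
Variable D : set T.
Hypothesis mD : measurable D.
Implicit Types f g h : T -> R.
Local Notation sqint := (sqint mu D).
Local Notation inn := (inn mu D).

Lemma inn_sqrD_le (c : R) f g : sqint f -> sqint g ->
  inn (fun x => f x + c * g x) (fun x => f x + c * g x) <=
  2 * inn f f + 2 * c ^+ 2 * inn g g.
Proof.
move=> sf sg; have scg := sqintZ mD c sg.
have sp := sqintD mD sf scg; have sm := sqintB mD sf scg.
have := inn_ge0 mu D (fun x => f x - c * g x).
rewrite innBl// !innBr// innDl// !innDr// (innZl mD c sg sf) (innZr mD c sg sf).
rewrite (innZl mD c sg scg) (innZr mD c sg sg) (innC _ _ g f).
move: (inn f f) (inn f g) (inn g g) => x y z; lra.
Qed.

Lemma cvg_inn (f_ : nat -> T -> R) f g : (forall n, sqint (f_ n)) -> sqint f -> sqint g ->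
  (fun n => inn (fun x => f_ n x - f x) (fun x => f_ n x - f x)) @ \oo --> (0 : R) ->
  (fun n => inn (f_ n) g) @ \oo --> inn f g.
Proof.
move=> sf_ sf sg H; apply/subr_cvg0.
apply: (@cvg0_sqr_le _ _ (fun n => inn (fun x => f_ n x - f x) (fun x => f_ n x - f x) * inn g g)).
  by move=> n; rewrite -innBl//; apply: cauchy_schwarz => //; exact: sqintB.
rewrite -(mul0r (inn g g)); exact: cvgMl.
Qed.

End SquareIntegrableLimits.

Section ZeroTrace.
Context {R : realType}.
Variables (om : set (R * R)) (m : nat) (E : 'I_m -> (R * R) * (R * R)).
Hypotheses (oom : open om) (bom : bounded_set om).
Implicit Types (phi psi u v : R * R -> R) (k : 'I_m) (c e s : R).
Local Notation leb := (@lebesgue_measure R).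

Let nu k := ext_normal om (E k).1 (E k).2.
Let edge_val phi k s : R := phi (seg_pt (E k).1 (E k).2 s).

(** Squared norms are used for the boundary data because they are quadratic, so sums are estimated
    by the parallelogram law without square roots. *)
Definition bdry_sqr (g : 'I_m -> R * R -> R) : R :=
  \sum_k elen ((E k).2 - (E k).1) * inn leb `[0, 1] (edge_val (g k) k) (edge_val (g k) k).

Definition cauchy_sqr phi : R :=
  bdry_sqr (fun=> phi) + bdry_sqr (fun k => 'D_(nu k) phi).

Lemma bdry_sqr_ge0 g : 0 <= bdry_sqr g.
Proof.
apply: sumr_ge0 => k _; apply: mulr_ge0; first exact: sqrtr_ge0.
exact: inn_ge0.
Qed.

Lemma norm_bdry_sqr g : norm_bdry E g ^+ 2 = bdry_sqr g.
Proof.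
have eqs : \sum_k elen ((E k).2 - (E k).1) *
    \int[leb]_(s in `[0, 1]) (on_edge E g k s) ^+ 2 = bdry_sqr g.
  by apply: eq_bigr => k _; congr (_ * _); apply: eq_Rintegral => s _; rewrite expr2.
by rewrite /norm_bdry eqs sqr_sqrtr// bdry_sqr_ge0.
Qed.

Lemma continuous_edge_val phi k : smooth phi -> continuous (edge_val phi k).
Proof.
move=> sp; exact: (is_derive_continuous
  (fun s => C1_derive_line (E k).1 ((E k).2 - (E k).1) s (smooth_C1 sp))).
Qed.

Lemma smooth_derive phi (w : R * R) : smooth phi -> smooth ('D_w phi).
Proof.
move=> sp; have s0 := smooth_pd ord0 sp; have s1 := smooth_pd ord_max sp.
(* [smooth_lin] has coefficient [1] on its first function, hence the splitting of [w.1]. *)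
suff -> : 'D_w phi = fun p => pd ord0 phi p + (w.1 - 1) * pd ord0 phi p + w.2 * pd ord_max phi p.
  exact/smooth_lin/s1/smooth_lin.
apply/funext => p; rewrite C1_derive_dir; last exact: smooth_C1.
move: (pd _ _ _) (pd _ _ _) => x y; ring.
Qed.

Lemma derive_lin phi psi c (w : R * R) : smooth phi -> smooth psi ->
  'D_w (fun p => phi p + c * psi p) = fun p => 'D_w phi p + c * 'D_w psi p.
Proof.
move=> sp sq; apply/funext => p.
have [dp _] := C1_is_derive p w (smooth_C1 sp); have [dq _] := C1_is_derive p w (smooth_C1 sq).
have d3 : is_derive p w (fun p => c * psi p) (c * 'D_w psi p) by exact: is_deriveZ.
by have [_ ->] := derive_add (DeriveDef dp erefl) d3.
Qed.

Lemma bdry_sqr_lin_le c (g h : 'I_m -> R * R -> R) :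
  (forall k, smooth (g k)) -> (forall k, smooth (h k)) ->
  bdry_sqr (fun k x => g k x + c * h k x) <= 2 * bdry_sqr g + 2 * c ^+ 2 * bdry_sqr h.
Proof.
move=> sg sh; rewrite !mulr_sumr -big_split/=; apply: ler_sum => k _.
rewrite (mulrCA 2) [X in _ <= _ + X]mulrCA -mulrDr; apply: ler_wpM2l; first exact: sqrtr_ge0.
apply: inn_sqrD_le; first exact: measurable_itvR.
- exact/continuous_sqint/continuous_edge_val.
- exact/continuous_sqint/continuous_edge_val.
Qed.

Lemma cauchy_sqr_ge0 phi : 0 <= cauchy_sqr phi.
Proof. by apply: addr_ge0; exact: bdry_sqr_ge0. Qed.

Lemma cauchy_sqr_lin_le c phi psi : smooth phi -> smooth psi ->
  cauchy_sqr (fun x => phi x + c * psi x) <= 2 * cauchy_sqr phi + 2 * c ^+ 2 * cauchy_sqr psi.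
Proof.
move=> sp sq; rewrite /cauchy_sqr !mulrDr addrACA; apply: lerD.
  exact: (bdry_sqr_lin_le c (fun=> sp) (fun=> sq)).
under [X in bdry_sqr X]eq_fun do rewrite derive_lin//.
exact: (bdry_sqr_lin_le c (fun k => smooth_derive (nu k) sp) (fun k => smooth_derive (nu k) sq)).
Qed.

Local Notation form2 := (form2 om).

Lemma form2_lin_le c u v : hasH om u -> hasH om v ->
  form2 (u + c *: v) (u + c *: v) <= 2 * form2 u u + 2 * c ^+ 2 * form2 v v.
Proof.
move=> Hu Hv; have sq := @form_sqr _ _ (hasH om) form2 (@hasH_lin _ _ oom)
  (fun u v _ _ => form2_sym om u v) (@form2_lin _ _ oom).
have := form2_ge0 om (u + (- c) *: v); rewrite !sq// sqrrN.
move: (form2 _ _) (form2 _ _) (form2 _ _) => x y z; lra.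
Qed.

(* With homogeneous data, the sequence of [cauchy_trace] can be replaced by
   approximations up to any given error. *)
Definition zero_trace v := forall e, 0 < e ->
  exists phi, [/\ smooth phi, form2 (v - phi) (v - phi) <= e & cauchy_sqr phi <= e].

Lemma cauchy_traceP v :
  cauchy_trace om E v (fun _ _ => 0) (fun _ _ => 0) <-> zero_trace v.
Proof.
pose b0 phi := norm_bdry E (fun k x => phi x - 0).
pose b1 phi := norm_bdry E (fun k x => 'D_(nu k) phi x - 0).
have cauchyE phi : cauchy_sqr phi = b0 phi ^+ 2 + b1 phi ^+ 2.
  rewrite /b0 /b1 !norm_bdry_sqr /cauchy_sqr; congr (_ + _); apply: eq_bigr => k _;
  by congr (_ * _); apply: eq_inn => s _; rewrite /edge_val subr0.
have b0ge0 phi : 0 <= b0 phi by exact: sqrtr_ge0.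
have b1ge0 phi : 0 <= b1 phi by exact: sqrtr_ge0.
split=> [[_ _ [phi [sphi nphi b0phi b1phi]]] e e0|H].
  (* A norm that is at most [1] and at most [e / 2] has its square at most [e / 2]. *)
  have d0 : 0 < Num.min 1 (e / 2) by rewrite lt_min ltr01 divr_gt0.
  have [N1 H1] := cvg0_le_eps d0 nphi; have [N2 H2] := cvg0_le_eps d0 b0phi.
  have [N3 H3] := cvg0_le_eps d0 b1phi.
  pose n := (N1 + N2 + N3)%N.
  have {}H1 := H1 n (leq_trans (leq_addr _ _) (leq_addr _ _)).
  have {}H2 := H2 n (leq_trans (leq_addl _ _) (leq_addr _ _)).
  have {}H3 := H3 n (leq_addl _ _).
  have small x : 0 <= x -> x <= Num.min 1 (e / 2) -> x ^+ 2 <= e / 2.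
    rewrite le_min => x0 /andP[x1 xe]; rewrite expr2 (le_trans _ xe)// ler_piMr//.
  exists (phi n); split=> //.
    rewrite -norm2_sqr; apply: le_trans (small _ _ H1) _; first exact: sqrtr_ge0.
    by rewrite ler_pdivrMr// ler_peMr ?ler1n// ltW.
  rewrite cauchyE (splitr e); apply: lerD; exact: small.
(* Squared, because [zero_trace] bounds squared norms. *)
have e0 n : 0 < (n.+1%:R^-1 : R) ^+ 2 by rewrite exprn_gt0// invr_gt0.
have [phi phiP] := choice (fun n => H _ (e0 n)).
have L0 : L2_bdry E (fun _ _ => 0).
  move=> k; apply/sqint_Lfun; first exact: measurable_itvR.
  exact: sqint0.
split=> //; exists phi.
have harm (x : nat -> R) : (forall n, 0 <= x n) -> (forall n, x n ^+ 2 <= n.+1%:R^-1 ^+ 2) ->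
    x @ \oo --> (0 : R).
  move=> x0 xle; apply: (@squeeze_cvgr _ _ _ _ (fun=> 0) (fun n => n.+1%:R^-1)).
  - by apply: nearW => n; rewrite x0 -(ler_pXn2r (_ : (0 < 2)%N)) ?xle// nnegrE ?x0// invr_ge0.
  - exact: cvg_cst.
  - exact: cvg_harmonic.
split; first by move=> n; case: (phiP n).
- apply: harm => n; first exact: sqrtr_ge0.
  by rewrite norm2_sqr; case: (phiP n).
- apply: harm => n; first exact: b0ge0.
  have [_ _] := phiP n; rewrite cauchyE; apply: le_trans; rewrite lerDl; exact: sqr_ge0.
- apply: harm => n; first exact: b1ge0.
  have [_ _] := phiP n; rewrite cauchyE; apply: le_trans; rewrite lerDr; exact: sqr_ge0.
Qed.

Lemma zero_trace_lin c u v : hasH om u -> hasH om v -> zero_trace u -> zero_trace v ->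
  zero_trace (u + c *: v).
Proof.
move=> Hu Hv zu zv e e0.
have c0 : 0 < 2 + 2 * c ^+ 2 by have := sqr_ge0 c; lra.
(* [2 + 2 * c ^+ 2] is the amplification of errors in [form2_lin_le] and [cauchy_sqr_lin_le]. *)
have d0 : 0 < e / (2 + 2 * c ^+ 2) by exact: divr_gt0.
have [phi [sp fp bp]] := zu _ d0; have [psi [sq fq bq]] := zv _ d0.
have arith x y z : x <= e / (2 + 2 * c ^+ 2) -> y <= e / (2 + 2 * c ^+ 2) ->
    z <= 2 * x + 2 * c ^+ 2 * y -> z <= e.
  move=> xe ye /le_trans; apply.
  have -> : e = 2 * (e / (2 + 2 * c ^+ 2)) + 2 * c ^+ 2 * (e / (2 + 2 * c ^+ 2)).
    by rewrite -mulrDl mulrC divfK// gt_eqF.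
  apply: lerD; first by rewrite ler_pM2l.
  by apply: ler_wpM2l => //; apply: mulr_ge0 => //; exact: sqr_ge0.
have Hp := hasH_lin oom (-1) Hu (hasH_smooth oom bom sp).
have Hq := hasH_lin oom (-1) Hv (hasH_smooth oom bom sq).
exists (fun x => phi x + c * psi x); split.
- exact: smooth_lin.
- apply: arith fp fq _.
  rewrite (_ : _ - _ = (u - phi) + c *: (v - psi)); last first.
    apply/funext => x.
    change (u x + c * v x - (phi x + c * psi x) = u x - phi x + c * (v x - psi x)); ring.
  by apply: form2_lin_le; [rewrite -scaleN1r|rewrite -scaleN1r].
- exact: (arith _ _ _ bp bq (cauchy_sqr_lin_le c sp sq)).
Qed.

(** Approximants of a late member of the sequence approximate the limit as well, and the boundary
    data are required of the approximant only. *)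
Lemma zero_trace_cvg (u_ : nat -> R * R -> R) u : (forall n, hasH om (u_ n)) -> hasH om u ->
  (forall n, zero_trace (u_ n)) ->
  (fun n => form2 (u_ n - u) (u_ n - u)) @ \oo --> (0 : R) -> zero_trace u.
Proof.
move=> Hu_ Hu zu cu e e0; have e4 : 0 < e / 4 by exact: divr_gt0.
have [N /(_ N (leqnn N)) uN] := cvg0_le_eps e4 cu.
have [phi [sp fp bp]] := zu N _ e4; exists phi.
have e4e : e / 4 <= e by rewrite ler_pdivrMr// ler_peMr ?ler1n// ltW.
split; [exact: sp| |exact: le_trans bp e4e].
have Hp : hasH om (u_ N - phi) by rewrite -scaleN1r; exact/hasH_lin/hasH_smooth.
have Hn : hasH om (u_ N - u) by rewrite -scaleN1r; exact: hasH_lin.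
have := form2_lin_le (-1) Hp Hn; rewrite scaleN1r sqrrN expr1n.
rewrite (_ : _ - phi - _ = u - phi); last by rewrite opprB addrC addrA subrK.
move: fp uN; move: (form2 _ _) (form2 _ _) (form2 _ _) => x y z; lra.
Qed.

(** The function approximates itself: the edges lie in the boundary, hence outside the open set
    [om], where a test function and its derivatives vanish. *)
Lemma zero_trace_test v : bdry om = \bigcup_k closed_seg (E k).1 (E k).2 -> test om v ->
  zero_trace v.
Proof.
move=> bdryE tv e e0; have sv := test_smooth tv.
have out k s : 0 <= s <= 1 -> ~ om (seg_pt (E k).1 (E k).2 s).
  move=> s01; have : bdry om (seg_pt (E k).1 (E k).2 s).
    by rewrite bdryE; exists k => //; exists s => //=; rewrite in_itv.
  by case=> _; move/interior_id : oom => ->.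
have bdry0 (g : 'I_m -> R * R -> R) : (forall k x, ~ om x -> g k x = 0) -> bdry_sqr g = 0.
  move=> g0; rewrite /bdry_sqr big1// => k _.
  rewrite (@eq_inn _ _ _ _ _ _ (fun=> 0) _ (fun=> 0)).
  - by rewrite /inn /Rintegral; under eq_integral do rewrite mul0r; rewrite integral0 /= mulr0.
  - move=> s /=; rewrite in_itv/= => s01; exact/g0/out.
  - move=> s /=; rewrite in_itv/= => s01; exact/g0/out.
exists v; split; first exact: sv.
  have H0 : hasH om (v - v) by rewrite -scaleN1r; apply: hasH_lin => //; exact: hasH_smooth.
  rewrite subrr in H0 *; have := form2_lin oom (-1) H0 H0 H0.
  by rewrite scaler0 addr0 mulN1r subrr => ->; exact: ltW.
have -> : cauchy_sqr v = 0; last exact: ltW.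
rewrite /cauchy_sqr bdry0 ?add0r; last by move=> k x; exact: (test_out tv).
rewrite bdry0// => k x ox; rewrite C1_derive_dir; last exact: smooth_C1.
by rewrite !(test_out (test_pd _ tv) ox) !mulr0 addr0.
Qed.

End ZeroTrace.

Lemma cvg0_sum (R : realType) (I : finType) (x : I -> nat -> R) :
  (forall i, x i @ \oo --> (0 : R)) -> (fun n => \sum_i x i n) @ \oo --> (0 : R).
Proof.
move=> x0; elim: (index_enum I) => [|i s IH].
  by under eq_fun do rewrite big_nil; exact: cvg_cst.
under eq_fun do rewrite big_cons.
by have := cvgD (x0 i) IH; rewrite addr0; exact.
Qed.

Lemma cvg0_le (R : realType) (x y : nat -> R) : (forall n, 0 <= x n) ->
  (forall n, x n <= y n) -> y @ \oo --> (0 : R) -> x @ \oo --> (0 : R).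
Proof.
move=> x0 xy y0; apply: (@squeeze_cvgr _ _ _ _ (fun=> 0) y) => //; last exact: cvg_cst.
by apply: nearW => n; rewrite x0 xy.
Qed.

(** * Completeness in the Hessian norm *)

Section HessianForm.
Context {R : realType}.
Variable om : set (R * R).
Hypotheses (oom : open om) (bom : bounded_set om).
Implicit Types (phi f g h u v w : R * R -> R) (i j : 'I_2) (c : R).
Local Notation plane := (measurableTypeR R * measurableTypeR R)%type.

Let mom : measurable (om : set plane) := open_measurable_plane oom.

Definition hform v w : R := ipS om (hess om v) (hess om w).

Lemma hform_sym v w : hform v w = hform w v.
Proof. exact: ipS_sym. Qed.

Lemma hform_lin c u v w : hasH om u -> hasH om v -> hasH om w ->
  hform (u + c *: v) w = hform u w + c * hform v w.
Proof.
move=> Hu Hv Hw; have := form2_lin oom c Hu Hv Hw; rewrite /form2 ip_lin//; last 3 first.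
- by case: Hu.
- by case: Hv.
- by case: Hw.
move: (ip _ _ _) (ip _ _ _) => x y; rewrite -/(hform _ _) -/(hform u w) -/(hform v w).
move: (hform _ _) (hform _ _) (hform _ _) => a b d; lra.
Qed.

Lemma hform_ge0 v : 0 <= hform v v.
Proof. exact: ipS_ge0. Qed.

Lemma hform_lin_le c u v : hasH om u -> hasH om v ->
  hform (u + c *: v) (u + c *: v) <= 2 * hform u u + 2 * c ^+ 2 * hform v v.
Proof.
move=> Hu Hv; have sq := @form_sqr _ _ (hasH om) hform (@hasH_lin _ _ oom)
  (fun u v _ _ => hform_sym u v) hform_lin.
have := hform_ge0 (u + (- c) *: v); rewrite !sq// sqrrN.
move: (hform _ _) (hform _ _) (hform _ _) => x y z; lra.
Qed.

Lemma ip_lin_le c f g : L2 om f -> L2 om g ->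
  ip om (f + c *: g) (f + c *: g) <= 2 * ip om f f + 2 * c ^+ 2 * ip om g g.
Proof.
move=> /(L2P _ oom) sf /(L2P _ oom) sg; exact: (inn_sqrD_le mom c sf sg).
Qed.

Lemma ip_le_form2 v : ip om v v <= form2 om v v.
Proof. by rewrite /form2 lerDl ipS_ge0. Qed.

Lemma hform_le_form2 v : hform v v <= form2 om v v.
Proof. by rewrite /form2 lerDr ip_ge0. Qed.

Lemma entry_le_ipS i j (M : R * R -> 'M[R]_2) : L2S om M ->
  inn leb2 om (fun p => M p i j) (fun p => M p i j) <= ipS om M M.
Proof.
move=> sM; rewrite ipSE// (bigD1 i)//= (bigD1 j)//= -addrA lerDl.
apply: addr_ge0; first by apply: sumr_ge0 => ? _; exact: inn_ge0.
by apply: sumr_ge0 => ? _; apply: sumr_ge0 => ? _; exact: inn_ge0.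
Qed.

Lemma hform_smooth phi : smooth phi -> hform phi phi = ipS om (chess phi) (chess phi).
Proof.
move=> sp; have Hp := hasH_smooth oom bom sp; have L := hasH_L2S Hp.
have [Lc _] := is_hess_smooth oom bom sp.
apply: ipS_ae2 => //; exact: hess_smooth.
Qed.

Lemma form2_opp v : hasH om v -> form2 om (- v) (- v) = form2 om v v.
Proof.
move=> Hv; have sq := @form_sqr _ _ (hasH om) (form2 om) (@hasH_lin _ _ oom)
  (fun u v _ _ => form2_sym om u v) (@form2_lin _ _ oom) (-2) _ _ Hv Hv.
have <- : v + (-2) *: v = - v by rewrite scaleNr scaler_nat mulr2n opprD addNKr.
by rewrite sq; ring.
Qed.

Lemma hasH_sub u v : hasH om u -> hasH om v -> hasH om (u - v).
Proof. by move=> Hu Hv; rewrite -scaleN1r; exact: hasH_lin. Qed.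

Lemma hess_sub u v : hasH om u -> hasH om v ->
  {ae leb2, forall p, om p -> hess om (u - v) p = hess om u p - hess om v p}.
Proof.
move=> Hu Hv; have := hess_lin oom (-1) Hu Hv; rewrite !scaleN1r; exact.
Qed.

Lemma L2S_sub (M N : R * R -> 'M[R]_2) : L2S om M -> L2S om N -> L2S om (M - N).
Proof. by move=> LM LN; rewrite -scaleN1r; exact: L2S_lin. Qed.

Lemma hform_sub u v : hasH om u -> hasH om v ->
  hform (u - v) (u - v) = ipS om (hess om u - hess om v) (hess om u - hess om v).
Proof.
move=> Hu Hv; have L := hasH_L2S (hasH_sub Hu Hv).
have L' := L2S_sub (hasH_L2S Hu) (hasH_L2S Hv).
by apply: ipS_ae2 => //; exact: hess_sub.
Qed.

Lemma L2S_complete (M_ : nat -> R * R -> 'M[R]_2) : (forall n, L2S om (M_ n)) ->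
  (forall e, 0 < e -> exists N, forall m n, (N <= m)%N -> (N <= n)%N ->
    ipS om (M_ m - M_ n) (M_ m - M_ n) <= e) ->
  exists2 M, L2S om M & (fun n => ipS om (M_ n - M) (M_ n - M)) @ \oo --> (0 : R).
Proof.
move=> LM_ cM_; have om_lty := bounded_leb2_lty mom bom.
have sM_ i j n : sqint leb2 om (fun p => M_ n p i j) by exact: L2S_entry.
have entry i j (A B : R * R -> 'M[R]_2) : L2S om A -> L2S om B ->
    inn leb2 om (fun p => A p i j - B p i j) (fun p => A p i j - B p i j) <= ipS om (A - B) (A - B).
  move=> LA LB; apply: le_trans (entry_le_ipS i j (L2S_sub LA LB)).
  by rewrite le_eqVlt; apply/orP; left; apply/eqP; apply: eq_inn => p _; rewrite !mxE.
have /choice[G0 G0P] i : exists Gi : 'I_2 -> R * R -> R, forall j,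
    sqint leb2 om (Gi j) /\
    (fun n => inn leb2 om (fun x => M_ n x i j - Gi j x) (fun x => M_ n x i j - Gi j x))
      @ \oo --> (0 : R).
  suff /choice[Gi GiP] j : exists g, sqint leb2 om g /\
      (fun n => inn leb2 om (fun x => M_ n x i j - g x) (fun x => M_ n x i j - g x))
        @ \oo --> (0 : R).
    by exists Gi.
  have [g sg gg] := @riesz_fischer _ _ _ leb2 om mom om_lty (fun n p => M_ n p i j)
    (sM_ i j) (fun e e0 => let: ex_intro N H := cM_ e e0 in
      ex_intro _ N (fun k n Nk Nn => le_trans (entry i j _ _ (LM_ k) (LM_ n)) (H k n Nk Nn))).
  by exists g.
(* Only limits of entries on and above the diagonal are used, since [L2S] asks for symmetry at every
   point of the domain, not almost everywhere. *)
pose M p : 'M[R]_2 := \matrix_(i, j) (if (i <= j)%N then G0 i j p else G0 j i p).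
have ME i j : (fun p => M p i j) = if (i <= j)%N then G0 i j else G0 j i.
  by apply/funext => p; rewrite mxE; case: ifP.
have sM i j : sqint leb2 om (fun p => M p i j).
  by rewrite ME; case: ifP => _; [case: (G0P i j)|case: (G0P j i)].
have cM i j : (fun n => inn leb2 om (fun x => M_ n x i j - M x i j) (fun x => M_ n x i j - M x i j))
    @ \oo --> (0 : R).
  have -> : (fun n => inn leb2 om (fun x => M_ n x i j - M x i j) (fun x => M_ n x i j - M x i j)) =
    (fun n => if (i <= j)%N then
        inn leb2 om (fun x => M_ n x i j - G0 i j x) (fun x => M_ n x i j - G0 i j x)
      else inn leb2 om (fun x => M_ n x j i - G0 j i x) (fun x => M_ n x j i - G0 j i x)).
    apply/funext => n; have [sy _] := LM_ n.
    by case: ifP => ij; apply: eq_inn => x omx; rewrite mxE ij// -[in LHS](sy x omx) mxE.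
  by case: (i <= j)%N; [case: (G0P i j)|case: (G0P j i)].
have LM : L2S om M.
  split; last by move=> i j; exact/(L2P _ oom).
  move=> p _; apply/matrixP => i j; rewrite !mxE; case: (ltngtP i j) => // ij.
  by have -> : i = j by exact: val_inj.
exists M => //; rewrite (_ : (fun n => _) = fun n =>
    \sum_i \sum_j inn leb2 om (fun x => M_ n x i j - M x i j) (fun x => M_ n x i j - M x i j)).
  by apply: cvg0_sum => i; apply: cvg0_sum => j; exact: cM.
apply/funext => n; have LD := L2S_sub (LM_ n) LM; rewrite (ipSE oom LD LD).
apply: eq_bigr => i _; apply: eq_bigr => j _.
by apply: eq_inn => x _; rewrite !mxE.
Qed.

(** The Hessians converge to some field; passing to the limit in the distributional identity for
    each test function identifies it as the Hessian of the limit. *)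
Lemma hasH_complete (u_ : nat -> R * R -> R) : (forall n, hasH om (u_ n)) ->
  (forall e, 0 < e -> exists N, forall m n, (N <= m)%N -> (N <= n)%N ->
    form2 om (u_ m - u_ n) (u_ m - u_ n) <= e) ->
  exists2 u, hasH om u & (fun n => form2 om (u_ n - u) (u_ n - u)) @ \oo --> (0 : R).
Proof.
move=> Hu cu; have om_lty := bounded_leb2_lty mom bom.
have su n : sqint leb2 om (u_ n) by apply/(L2P _ oom); case: (Hu n).
have Lh n := hasH_L2S (Hu n).
have [u squ uu] : exists2 u, sqint leb2 om u &
    (fun n => inn leb2 om (fun x => u_ n x - u x) (fun x => u_ n x - u x)) @ \oo --> (0 : R).
  apply: riesz_fischer => // e e0; have [N H] := cu _ e0; exists N => k n Nk Nn.
  exact: le_trans (ip_le_form2 _) (H _ _ Nk Nn).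
have [M LM cM] : exists2 M, L2S om M & (fun n => ipS om (hess om (u_ n) - M) (hess om (u_ n) - M))
    @ \oo --> (0 : R).
  apply: L2S_complete => // e e0; have [N H] := cu _ e0; exists N => k n Nk Nn.
  by rewrite -hform_sub//; exact: le_trans (hform_le_form2 _) (H _ _ Nk Nn).
have Lu : L2 om u by exact/(L2P _ oom).
have hM : is_hess om u M.
  split=> // phi tphi i j; have tp := test_pd i (test_pd j tphi).
  have sp := L2_test oom tphi; have spp := L2_test oom tp.
  have cMij : (fun n => inn leb2 om (fun x => hess om (u_ n) x i j - M x i j)
                                   (fun x => hess om (u_ n) x i j - M x i j)) @ \oo --> (0 : R).
    apply: cvg0_le cM => n; first exact: inn_ge0.
    apply: le_trans (entry_le_ipS i j (L2S_sub (Lh n) LM)).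
    by rewrite le_eqVlt; apply/orP; left; apply/eqP; apply: eq_inn => p _; rewrite !mxE.
  have c1 := cvg_inn mom su squ spp uu.
  have c2 := cvg_inn mom (fun n => L2S_entry oom i j (Lh n)) (L2S_entry oom i j LM) sp cMij.
  have e12 : (fun n => inn leb2 om (u_ n) (pd i (pd j phi))) =
             (fun n => inn leb2 om (fun p => hess om (u_ n) p i j) phi).
    by apply/funext => n; have [_ H] := hasH_hess (Hu n); exact: H.
  rewrite e12 in c1; exact: (cvg_unique _ c1 c2).
have Hu' : hasH om u by split => //; exists M.
exists u => //.
have hformE n : hform (u_ n - u) (u_ n - u) = ipS om (hess om (u_ n) - M) (hess om (u_ n) - M).
  rewrite hform_sub//; have LhM := L2S_sub (Lh n) LM.
  have E : {ae leb2, forall p, om p -> (hess om (u_ n) - hess om u) p = (hess om (u_ n) - M) p}.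
    have := hess_ae oom hM; apply: filterS => p H omp.
    by change (hess om (u_ n) p - hess om u p = hess om (u_ n) p - M p); rewrite H.
  by apply: (ipS_ae2 oom) => //; apply: L2S_sub => //; exact: hasH_L2S.
rewrite (_ : (fun n => _) = fun n => inn leb2 om (fun x => u_ n x - u x) (fun x => u_ n x - u x)
    + ipS om (hess om (u_ n) - M) (hess om (u_ n) - M)).
  by have := cvgD uu cM; rewrite addr0; exact.
by apply/funext => n; rewrite /form2 -/(hform (u_ n - u) (u_ n - u)) hformE.
Qed.

End HessianForm.

(** * Poincare inequality and completeness for homogeneous Cauchy data *)

Section HomogeneousTrace.
Context {R : realType}.
Variables (om : set (R * R)) (m : nat) (E : 'I_m -> (R * R) * (R * R)).
Hypotheses (oom : open om) (bom : bounded_set om)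
  (bdryE : bdry om = \bigcup_k closed_seg (E k).1 (E k).2).
Implicit Types (phi psi u v : R * R -> R) (c e s : R).
Local Notation plane := (measurableTypeR R * measurableTypeR R)%type.

Let mom : measurable (om : set plane) := open_measurable_plane oom.

Lemma poincare_cauchy_sqr : exists2 P : R, 0 < P & forall phi, smooth phi ->
  ip om phi phi <= P * (cauchy_sqr om E phi + hform om phi phi).
Proof.
have [B [B0 omB]] := bounded_cbox bom.
have B20 : 0 < (2 * B) ^+ 3 by rewrite exprn_gt0// mulr_gt0.
have P0 : 0 < 12 * B by rewrite mulr_gt0.
have P1 : 0 < 6 * B * (2 * B) ^+ 3 by rewrite mulr_gt0// mulr_gt0.
exists (12 * B + 6 * B * (2 * B) ^+ 3); first exact: addr_gt0.
move=> phi sp.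
have H := poincare_smooth oom bom B0 omB bdryE sp.
have b1 : \sum_k elen ((E k).2 - (E k).1) *
    \int[@lebesgue_measure R]_(s in `[0, 1]) phi (seg_pt (E k).1 (E k).2 s) ^+ 2
    <= cauchy_sqr om E phi.
  apply: (@le_trans _ _ (bdry_sqr E (fun=> phi))); last by rewrite lerDl bdry_sqr_ge0.
  rewrite le_eqVlt; apply/orP; left; apply/eqP/eq_bigr => k _.
  by congr (_ * _); apply: eq_Rintegral => s _; exact: expr2.
have b2 : ip om (pd ord0 (pd ord0 phi)) (pd ord0 (pd ord0 phi)) <= hform om phi phi.
  rewrite hform_smooth//; have [Lc _] := is_hess_smooth oom bom sp.
  apply: le_trans (entry_le_ipS oom ord0 ord0 Lc).
  by rewrite le_eqVlt; apply/orP; left; apply/eqP; apply: eq_inn => p _; rewrite !mxE.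
have c0 := cauchy_sqr_ge0 om E phi; have h0 := hform_ge0 om phi.
apply: (le_trans H).
move: b1 b2 c0 h0 P0 P1; clear; move: (12 * B) (6 * B * _) (\sum_k _) (cauchy_sqr _ _ _).
move: (ip _ _ _) (hform _ _ _) => a b x y z t; nra.
Qed.

(** For an approximant whose squared Cauchy data and squared distance to [v] are at most [d], the
    smooth inequality gives [4 * P] times the Hessian form of [v] plus [(2 + 6 * P) * d], and [d] is
    arbitrary. *)
Lemma poincare_zero_trace : exists2 K : R, 0 < K &
  forall v, hasH om v -> zero_trace om E v -> ip om v v <= K * hform om v v.
Proof.
have [P P0 HP] := poincare_cauchy_sqr; exists (4 * P); first exact: mulr_gt0.
move=> v Hv zv; apply/ler_addgt0Pr => e e0.
have c0 : 0 < 2 + 6 * P by rewrite addr_gt0// mulr_gt0.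
have d0 : 0 < e / (2 + 6 * P) by exact: divr_gt0.
have [phi [sp fp bp]] := zv _ d0; have Hp := hasH_smooth oom bom sp.
have Hvp := hasH_sub oom Hv Hp.
have vE : v = phi + 1 *: (v - phi) by rewrite scale1r addrC subrK.
have pE : phi = v + (-1) *: (v - phi) by rewrite scaleN1r opprB addrC subrK.
have h1 := ip_lin_le oom 1 (L2_smooth oom bom sp) Hvp.1; rewrite -vE in h1.
have h2 := hform_lin_le oom (-1) Hv Hvp; rewrite -pE in h2.
have h3 := HP _ sp; have h4 := ip_le_form2 om (v - phi); have h5 := hform_le_form2 om (v - phi).
have eE : e = (2 + 6 * P) * (e / (2 + 6 * P)) by rewrite mulrC divfK// gt_eqF.
rewrite [X in _ + X]eE; move: h1 h2 h3 h4 h5 fp bp P0; clear.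
rewrite sqrrN !expr1n !mulr1.
move: (e / _) (ip om v v) (ip om phi phi) (ip om (v - phi) _) (hform om v v) (hform om phi phi).
move: (hform om (v - phi) _) (form2 _ _ _) (cauchy_sqr _ _ _) => a b c d x y z t w.
move=> h1 h2 h3 h4 h5 fp bp P0.
have : P * (c + w) <= P * (d + (2 * t + 2 * d)) by apply: ler_wpM2l; [exact: ltW|lra].
lra.
Qed.

Hypothesis grad_bound : exists C : R, forall i phi, smooth phi ->
  ip om (pd i phi) (pd i phi) <= C * form2 om phi phi.

(** Convergence in [form2] does not mention the first derivatives that [H2] asks for. By
    [grad_bound] the gradients of smooth approximants form a Cauchy sequence, and its limit is the
    weak gradient. *)
Lemma zero_trace_H2 u : hasH om u -> zero_trace om E u -> H2 om u.
Proof.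
move=> Hu zu; split; [by case: Hu| |by case: Hu] => i.
have e0 n : 0 < (n.+1%:R^-1 : R) by rewrite invr_gt0.
have [phi phiP] := choice (fun n => zu _ (e0 n)).
have sp n : smooth (phi n) by case: (phiP n).
have Hp n := hasH_smooth oom bom (sp n).
have up : (fun n => form2 om (phi n - u) (phi n - u)) @ \oo --> (0 : R).
  apply: (@cvg0_le _ _ (fun n => n.+1%:R^-1)); last exact: cvg_harmonic.
    by move=> n; exact: form2_ge0.
  by move=> n; rewrite -opprB form2_opp//; [case: (phiP n)|exact: hasH_sub].
have cp := form_cauchy_of_cvg (@hasH_lin _ _ oom) (fun u v _ _ => form2_sym om u v)
  (@form2_lin _ _ oom) (fun u _ => form2_ge0 om u) Hp Hu up.
have [C HC] := grad_bound.
have Hn n : sqint leb2 om (phi n) by apply/(L2P _ oom); case: (Hp n).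
have su : sqint leb2 om u by apply/(L2P _ oom); case: Hu.
have sd n : sqint leb2 om (pd i (phi n)) by exact/(L2P _ oom)/L2_smooth/smooth_pd.
have [g sg gg] : exists2 g, sqint leb2 om g &
    (fun n => inn leb2 om (fun x => pd i (phi n) x - g x) (fun x => pd i (phi n) x - g x)) @ \oo --> (0 : R).
  apply: riesz_fischer => //; first exact: bounded_leb2_lty mom bom.
  move=> e e0'; have C0 : 0 < `|C| + 1 by rewrite ltr_wpDl.
  have [N NP] := cp (e / (`|C| + 1)) (divr_gt0 e0' C0); exists N => k n Nk Nn.
  have := NP k n Nk Nn; rewrite ler_pdivlMr// => h.
  have sk : smooth (phi k - phi n).
    have := smooth_lin (-1) (sp k) (sp n); rewrite (_ : (fun p => _) = phi k - phi n)//.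
    by apply/funext => p; rewrite mulN1r.
  have := HC i _ sk; rewrite (_ : pd i (phi k - phi n) = fun x => pd i (phi k) x - pd i (phi n) x).
    move=> /le_trans; apply; apply: le_trans h; rewrite mulrC; apply: ler_wpM2l; first exact: form2_ge0.
    by rewrite (le_trans (ler_norm _))// lerDl.
  have := derive_lin (-1) (evec i) (sp k) (sp n).
  rewrite (_ : (fun p => phi k p + -1 * phi n p) = phi k - phi n).
    by rewrite /pd => ->; apply/funext => p; rewrite mulN1r.
  by apply/funext => p; rewrite mulN1r.
exists g; split; first exact/(L2P _ oom).
move=> psi tpsi; have tp := test_pd i tpsi.
have sq := L2_test oom tpsi; have sqq := L2_test oom tp.
have up' : (fun n => inn leb2 om (fun x => phi n x - u x) (fun x => phi n x - u x)) @ \oo --> (0 : R).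
  by apply: cvg0_le up => n; [exact: inn_ge0|exact: (ip_le_form2 om (phi n - u))].
have c1 := cvg_inn mom Hn su sqq up'.
have c2 := cvg_inn mom sd sg sq gg.
have e12 : (fun n => inn leb2 om (phi n) (pd i psi)) = (fun n => - inn leb2 om (pd i (phi n)) psi).
  by apply/funext => n; exact: ip_pd.
rewrite e12 in c1; exact: (cvg_unique _ c1 (cvgN c2)).
Qed.

Lemma H20P v : H20 om E v <-> hasH om v /\ zero_trace om E v.
Proof.
split=> [[Hv /(cauchy_traceP om E) zv]|[Hv zv]].
  by split; [exact: H2_hasH Hv|].
by split; [exact: zero_trace_H2|exact/(cauchy_traceP om E)].
Qed.

Lemma H20_lin c u v : H20 om E u -> H20 om E v -> H20 om E (u + c *: v).
Proof.
move=> /H20P[Hu zu] /H20P[Hv zv]; apply/H20P; split; first exact: hasH_lin.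
exact: zero_trace_lin.
Qed.

Lemma H20_test v : test om v -> H20 om E v.
Proof.
move=> tv; apply/H20P; split; first exact/hasH_smooth/test_smooth/tv.
exact: zero_trace_test.
Qed.

Lemma H20_complete (u_ : nat -> R * R -> R) : (forall n, H20 om E (u_ n)) ->
  (forall e, 0 < e -> exists N, forall m n, (N <= m)%N -> (N <= n)%N ->
    form2 om (u_ m - u_ n) (u_ m - u_ n) <= e) ->
  exists2 u, H20 om E u & (fun n => form2 om (u_ n - u) (u_ n - u)) @ \oo --> (0 : R).
Proof.
move=> Hu cu; have Hu' n : hasH om (u_ n) by have /H20P[] := Hu n.
have [u Hu'' cuu] := hasH_complete oom bom Hu' cu; exists u => //.
apply/H20P; split=> //; apply: (zero_trace_cvg oom bom Hu') => // n.
by have /H20P[] := Hu n.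
Qed.

End HomogeneousTrace.

(** * Gradient estimate *)

Section Translation.
Context {R : realType}.
Local Notation leb := (@lebesgue_measure R).
Local Notation line := (measurableTypeR R).
Local Notation plane := (line * line)%type.

Let shift (a : R) : line -> line := fun x : R => x + a.

Let measurable_shift (a : R) : measurable_fun setT (shift a).
Proof. by apply: measurable_funD => //; exact: measurable_id. Qed.

Let lebesgue_measure_shift (a : R) (A : set line) : measurable A ->
  pushforward leb (shift a) A = leb A.
Proof.
move=> mA; apply/esym/lebesgue_measure_unique => //=; last first.
  move=> _ [[b c]] /= _ <-; rewrite /pushforward.
  have -> : shift a @^-1` `]b, c]%classic = `]b - a, c - a]%classic.
    by apply/seteqP; split=> x /=; rewrite !in_itv/= ltrBlDr lerBrDr.
  rewrite !lebesgue_measure_itv/= !lte_fin ltrD2r; case: ifP => // _.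
  by rewrite -!EFinB; congr EFin; ring.
Qed.

Lemma integral_shift (a : R) (f : line -> \bar R) : measurable_fun setT f ->
  (forall x, (0 <= f x)%E) -> (\int[leb]_x f ((x : R) + a)%R = \int[leb]_x f x)%E.
Proof.
move=> mf f0; have ms := measurable_shift a.
have := ge0_integral_pushforward ms leb measurableT mf (fun x _ => f0 x).
rewrite preimage_setT => <-.
by apply: eq_measure_integral => A mA _; exact: lebesgue_measure_shift.
Qed.

Lemma measurable_shift2 (e : R * R) (f : plane -> \bar R) : measurable_fun setT f ->
  measurable_fun setT (fun z : plane * line => f ((z.1 : R * R) + (z.2 : R) *: e)).
Proof.
move=> mf; apply: (measurableT_comp mf).
apply: measurable_fun_pair; apply: measurable_funD.
- exact: (measurableT_comp measurable_fst measurable_fst).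
- by apply: measurable_funM => //; exact: measurable_snd.
- exact: (measurableT_comp measurable_snd measurable_fst).
- by apply: measurable_funM => //; exact: measurable_snd.
Qed.

Lemma integral_shift2 (e : R * R) (f : plane -> \bar R) : measurable_fun setT f ->
  (forall x, (0 <= f x)%E) -> (\int[leb2]_x f ((x : R * R) + e)%R = \int[leb2]_x f x)%E.
Proof.
move=> mf f0.
have mfe : measurable_fun setT (fun x : plane => f ((x : R * R) + e)).
  apply: (measurableT_comp mf); apply: measurable_fun_pair; exact: measurable_funD.
rewrite [LHS](fubini_tonelli2 (m1 := leb) (m2 := leb) _ mfe)//.
rewrite [RHS](fubini_tonelli2 (m1 := leb) (m2 := leb) _ mf)//.
have mG := measurable_fun_fubini_tonelli_G (m1 := leb) _ mf f0.
rewrite -(integral_shift e.2 mG); last by move=> y; apply: integral_ge0 => x _; exact: f0.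
apply: eq_integral => y _; rewrite /fubini_G.
exact: (@integral_shift e.1 (fun x => f (x, (y : R) + e.2)) (measurable_fun_pair1 ((y : R) + e.2) mf)).
Qed.

Let sigma_finite_leb2 : sigma_finite setT (leb \x leb)%E.
Proof.
exists (fun n : nat => cbox (- n%:R) n%:R (- n%:R) n%:R : set plane).
  apply/seteqP; split=> // x _.
  have [n xn] : exists n : nat, `|(x : R * R).1| + `|(x : R * R).2| <= n%:R.
    exists (Num.truncn (`|(x : R * R).1| + `|(x : R * R).2|)).+1.
    by rewrite ltW// truncnS_gt.
  have [x1 x2] : `|(x : R * R).1| <= n%:R /\ `|(x : R * R).2| <= n%:R.
    by split; apply: le_trans xn; rewrite ?lerDl ?lerDr.
  by exists n => //; move: x1 x2; rewrite !ler_norml => /andP[? ?] /andP[? ?]; split.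
by move=> n; split; [exact: measurable_cbox|exact: leb2_cbox_lty].
Qed.

(** The segment averages below integrate over the product of the plane and a line, where Tonelli's
    theorem asks for the first measure together with its sigma-finite structure. *)
Let plane_measure : {sigma_finite_measure set plane -> \bar R} :=
  HB.pack (leb \x leb)%E (Measure_isSigmaFinite.Build _ _ _ _ sigma_finite_leb2).

(** Extending [F] by zero off [om] lets [x] run over the whole plane. After Tonelli's theorem every
    translate by [t *: e] has the same integral, and the parameter interval has length [1]. *)
Lemma integral_le_segment_average (W om : set plane) (e : R * R) (F G : R * R -> R) :
  measurable W -> measurable om -> continuous F -> (forall x, 0 <= F x) ->
  continuous G -> (forall x, 0 <= G x) ->
  (forall x, W x -> ((G x)%:E <= \int[leb]_(t in `[0%R, 1%R]) (F ((x : R * R) + t *: e)%R)%:E)%E) ->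
  (forall x t, W x -> 0 <= t <= 1 -> om ((x : R * R) + t *: e)) ->
  (\int[leb2]_(x in W) (G x)%:E <= \int[leb2]_(x in om) (F x)%:E)%E.
Proof.
move=> mW mom cF F0 cG G0 GF sub.
pose H (x : plane) : \bar R := (F x * \1_om x)%:E.
have H0 x : (0 <= H x)%E by rewrite lee_fin mulr_ge0// indicE.
have mH : measurable_fun setT H.
  apply/measurable_EFinP/measurable_funM; first exact: continuous_measurable_plane.
  exact: measurable_indic.
have mI : measurable (`[0, 1]%classic : set line) by exact: measurable_itvR.
pose K (z : plane * line) : \bar R :=
  (H ((z.1 : R * R) + (z.2 : R) *: e)%R * (\1_(`[0, 1]%classic : set line) z.2)%:E)%E.
have K0 z : (0 <= K z)%E by apply: mule_ge0 => //; rewrite lee_fin indicE.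
have mK : measurable_fun setT K.
  apply: emeasurable_funM; first exact: measurable_shift2.
  apply/measurable_EFinP; apply: (measurableT_comp (measurable_indic mI)); exact: measurable_snd.
have fub := @fubini_tonelli _ _ _ _ R plane_measure leb K mK K0.
have mFK := @measurable_fun_fubini_tonelli_F _ _ _ _ R leb K mK K0.
apply: (@le_trans _ _ (\int[(leb \x leb)%E]_x \int[leb]_t K (x, t))%E).
  rewrite [leLHS]integral_mkcond; apply: ge0_le_integral.
  - exact: measurableT.
  - by move=> x _; rewrite patchE; case: ifP => // _; rewrite lee_fin.
  - apply/(measurable_restrictT _ mW)/measurable_EFinP; exact: continuous_measurable_plane.
  - exact: mFK.
  - move=> x _; rewrite patchE; case: ifPn => [/set_mem Wx|_]; last by apply: integral_ge0 => t _; exact: K0.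
    apply: (le_trans (GF _ Wx)).
    rewrite integral_mkcond le_eqVlt; apply/orP; left; apply/eqP.
    apply: eq_integral => t _; rewrite patchE /K /= indicE; case: ifPn => [tI|_]; last by rewrite mule0.
    rewrite mule1 /H indicE mem_set ?mulr1//; apply: sub => //.
    by move: tI; rewrite inE/= in_itv.
rewrite fub.
have -> : (\int[leb2]_(x in om) (F x)%:E = \int[leb2]_x H x)%E.
  rewrite integral_mkcond; apply: eq_integral => x _; rewrite patchE /H indicE.
  by case: ifP => _; rewrite ?mulr1 ?mulr0.
rewrite le_eqVlt; apply/orP; left; apply/eqP.
transitivity (\int[leb]_(t in `[0%R, 1%R]) \int[leb2]_x H x)%E.
  rewrite [RHS]integral_mkcond; apply: eq_integral => t _; rewrite patchE.
  case: ifPn => tI.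
    rewrite -(integral_shift2 (t *: e) mH H0); apply: eq_integral => x _.
    by rewrite /K /= indicE tI mule1.
  rewrite (_ : (fun x => K (x, t)) = cst 0%E) ?integral0//.
  by apply/funext => x; rewrite /K /= indicE (negbTE tI) mule0.
have -> := @integral_cst _ _ _ leb _ mI (\int[leb2]_x H x)%E.
have vol : lebesgue_measure (`[0, 1]%classic : set R) = 1%E.
  by rewrite lebesgue_measure_itv /= lte_fin ltr01 -EFinB subr0.
by rewrite -[RHS]mule1; congr (_ * _)%E; exact: vol.
Qed.

End Translation.

Section SegmentGradient.
Context {R : realType}.
Variables (om : set (R * R)).
Hypotheses (oom : open om) (bom : bounded_set om).
Implicit Types (phi : R * R -> R) (e x : R * R).
Local Notation leb := (@lebesgue_measure R).
Local Notation plane := (measurableTypeR R * measurableTypeR R)%type.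

Let mom : measurable (om : set plane) := open_measurable_plane oom.

Lemma derive_lin2 (f g : R * R -> R) (p w : R * R) (c d a b : R) : is_derive p w f a ->
  is_derive p w g b -> 'D_w (fun q => c * f q + d * g q) p = c * a + d * b.
Proof.
move=> df dg; have cf : is_derive p w (fun q => c * f q) (c * a) by exact: is_deriveZ.
have cg : is_derive p w (fun q => d * g q) (d * b) by exact: is_deriveZ.
by have [_ ->] := derive_add cf cg.
Qed.

Lemma derive_derive phi e p : smooth phi ->
  'D_e ('D_e phi) p = e.1 * (e.1 * pd ord0 (pd ord0 phi) p + e.2 * pd ord_max (pd ord0 phi) p)
    + e.2 * (e.1 * pd ord0 (pd ord_max phi) p + e.2 * pd ord_max (pd ord_max phi) p).
Proof.
move=> sp; have s0 := smooth_C1 (smooth_pd ord0 sp); have s1 := smooth_C1 (smooth_pd ord_max sp).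
have -> : 'D_e phi = fun q => e.1 * pd ord0 phi q + e.2 * pd ord_max phi q.
  by apply/funext => q; exact: (C1_derive_dir q e (smooth_C1 sp)).
have d0 := C1_is_derive p e s0; have d1 := C1_is_derive p e s1.
exact: (derive_lin2 e.1 e.2 d0 d1).
Qed.

(** Cauchy-Schwarz twice: the quadratic form of a matrix at a vector is at most the Frobenius norm
    times the squared length of the vector. *)
Lemma sqr_quadratic_form_le (a b x y z t : R) :
  (a * (a * x + b * y) + b * (a * z + b * t)) ^+ 2 <=
  (a ^+ 2 + b ^+ 2) ^+ 2 * (x * x + y * y + (z * z + t * t)).
Proof.
have CS (u v : R) : (a * u + b * v) ^+ 2 <= (a ^+ 2 + b ^+ 2) * (u * u + v * v).
  have := sqr_ge0 (a * v - b * u); rewrite -subr_ge0 => H; rewrite -subr_ge0.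
  by have -> : (a ^+ 2 + b ^+ 2) * (u * u + v * v) - (a * u + b * v) ^+ 2 = (a * v - b * u) ^+ 2 - 0; [ring|].
have n0 : 0 <= a ^+ 2 + b ^+ 2 by rewrite addr_ge0 ?sqr_ge0.
apply: (le_trans (CS _ _)); rewrite [(_ + _) ^+ 2 * _]mulrAC -mulrA mulrCA.
rewrite [leRHS](_ : _ = (a ^+ 2 + b ^+ 2) * ((a ^+ 2 + b ^+ 2) * (x * x + y * y) + (a ^+ 2 + b ^+ 2) * (z * z + t * t))); last by ring.
rewrite [leLHS](_ : _ = (a ^+ 2 + b ^+ 2) * ((a * x + b * y) ^+ 2 + (a * z + b * t) ^+ 2)); last by ring.
by apply: ler_wpM2l => //; exact: lerD.
Qed.

Lemma integrable_frob (M Q : R * R -> 'M[R]_2) : L2S om M -> L2S om Q ->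
  leb2.-integrable (om : set plane) (EFin \o (fun p => frob (M p) (Q p))).
Proof.
move=> sM sQ.
have I i j : leb2.-integrable (om : set plane) (EFin \o (fun p => M p i j * Q p i j)).
  by apply: sqint_integrable_mul => //; exact: L2S_entry.
have J i : leb2.-integrable (om : set plane) (EFin \o (fun p => \sum_j M p i j * Q p i j)).
  have := integrable_sum mom (index_enum 'I_2) (P := xpredT) (fun j _ => I i j).
  by apply: eq_integrable => // x _; rewrite /= sumEFin.
have := integrable_sum mom (index_enum 'I_2) (P := xpredT) (fun i _ => J i).
by apply: eq_integrable => // x _; rewrite /= sumEFin.
Qed.

Lemma inn_derive_derive_le phi e : smooth phi ->
  inn leb2 om ('D_e ('D_e phi)) ('D_e ('D_e phi)) <= (e.1 ^+ 2 + e.2 ^+ 2) ^+ 2 * hform om phi phi.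
Proof.
move=> sp; have sD := smooth_derive e (smooth_derive e sp).
have cD := smooth_continuous sD; have sqD := continuous_sqint_plane mom bom cD.
have [Lc _] := is_hess_smooth oom bom sp.
have If := integrable_frob Lc Lc; have sqD2 := sqint_integrable_mul mom sqD sqD.
rewrite hform_smooth// /ipS -RintegralZl//.
apply: le_Rintegral => //; first exact: (integrableZl mom _ If).
move=> p _; rewrite -expr2 derive_derive// /frob !big_ord_recl !big_ord0 !addr0 !mxE /=.
rewrite (_ : lift ord0 ord0 = ord_max); last exact: val_inj.
rewrite addrACA; exact: (sqr_quadratic_form_le e.1 e.2 (pd ord0 (pd ord0 phi) p)
  (pd ord_max (pd ord0 phi) p) (pd ord0 (pd ord_max phi) p) (pd ord_max (pd ord_max phi) p)).
Qed.

(** [sqr_deriv_bound] on the segment from [x] to [x + e], averaged over [x] in [W]; the second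
    derivative along [e] is estimated by the full Hessian. *)
Lemma segment_gradient_le (W : set plane) phi e : measurable W -> smooth phi ->
  (forall x t, W x -> 0 <= t <= 1 -> om ((x : R * R) + t *: e)) ->
  inn leb2 W ('D_e phi) ('D_e phi) <=
    (72 + 2 * (e.1 ^+ 2 + e.2 ^+ 2) ^+ 2) * form2 om phi phi.
Proof.
move=> mW sp sub; have sD := smooth_derive e sp; have sDD := smooth_derive e sD.
have cp := smooth_continuous sp; have cD := smooth_continuous sD; have cDD := smooth_continuous sDD.
have sqp := continuous_sqint_plane mom bom cp.
have sqD := continuous_sqint_plane mom bom cD.
have sqDD := continuous_sqint_plane mom bom cDD.
have Wom : W `<=` om.
  by move=> x Wx; have := sub x 0 Wx; rewrite lexx ler01 scale0r addr0; exact.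
have sqDW := sqintS mW mom Wom sqD.
pose D : R * R -> R := 'D_e phi; pose DD : R * R -> R := 'D_e D.
pose F x : R := 72 * (phi x * phi x) + 2 * (DD x * DD x).
have cF : continuous F.
  apply: continuous_add; apply: continuous_mul; (try exact: continuous_cst); exact: continuous_mul.
have F0 x : 0 <= F x by rewrite /F -!expr2 addr_ge0// mulr_ge0// sqr_ge0.
have cG : continuous (fun x => D x * D x) by exact: continuous_mul.
have G0 x : 0 <= D x * D x by rewrite -expr2 sqr_ge0.
have GF x : W x -> ((D x * D x)%:E <=
    \int[leb]_(t in `[0%R, 1%R]) (F ((x : R * R) + t *: e)%R)%:E)%E.
  move=> Wx; pose f (t : R) : R := phi (x + t *: e); pose f2 (t : R) : R := DD (x + t *: e).
  have df (t : R) : is_derive t 1 f (D (x + t *: e)).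
    exact: (C1_derive_line x e t (smooth_C1 sp)).
  have df1 (t : R) : is_derive t 1 (fun t : R => D (x + t *: e)) (f2 t).
    exact: (C1_derive_line x e t (smooth_C1 sD)).
  have cf2 : continuous f2.
    exact: (is_derive_continuous (fun t => C1_derive_line x e t (smooth_C1 sDD))).
  have cf : continuous f := is_derive_continuous df.
  have sf := continuous_sqint 0 1 cf; have sf2 := continuous_sqint 0 1 cf2.
  have := sqr_deriv_bound df df1 cf2; rewrite scale0r addr0 expr2 -lee_fin.
  move=> /le_trans; apply; rewrite EFinD !EFinM.
  have mI := measurable_itvR `[(0 : R), 1].
  rewrite (EFin_inn mI sf sf) (EFin_inn mI sf2 sf2) le_eqVlt; apply/orP; left; apply/eqP.
  have i1 := sqint_integrable_mul mI sf sf; have i2 := sqint_integrable_mul mI sf2 sf2.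
  rewrite -(integralZl mI i1) -(integralZl mI i2) -integralD//; last 2 first.
  - exact: (integrableZl mI 72 i1).
  - exact: (integrableZl mI 2 i2).
have := integral_le_segment_average mW mom cF F0 cG G0 GF sub.
rewrite -(EFin_inn mW sqDW sqDW) => H.
have i1 := sqint_integrable_mul mom sqp sqp; have i2 := sqint_integrable_mul mom sqDD sqDD.
have FE : (\int[leb2]_(x in om) (F x)%:E = (72 * ip om phi phi + 2 * inn leb2 om DD DD)%:E)%E.
  rewrite EFinD !EFinM (EFin_inn mom sqp sqp) (EFin_inn mom sqDD sqDD).
  rewrite -(integralZl mom i1) -(integralZl mom i2) -integralD//.
  - exact: (integrableZl mom 72 i1).
  - exact: (integrableZl mom 2 i2).
rewrite FE lee_fin in H; apply: (le_trans H).
have := inn_derive_derive_le e sp; rewrite -/D -/DD /form2 -/(hform om phi phi).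
have := ip_ge0 om phi; have := hform_ge0 om phi.
have : 0 <= (e.1 ^+ 2 + e.2 ^+ 2) ^+ 2 by exact: sqr_ge0.
move: (_ ^+ 2) (ip _ _ _) (hform _ _ _) (inn _ _ _ _) => a b c d; clear; nra.
Qed.

End SegmentGradient.

(** * Triangles and meshes *)

Section Barycentric.
Context {R : realType}.
Implicit Types (V : 'I_3 -> R * R) (x y : R * R) (i j k : 'I_3) (w : 'I_3 -> R).
Local Notation leb := (@lebesgue_measure R).
Local Notation plane := (measurableTypeR R * measurableTypeR R)%type.

Lemma sum_pair (I : finType) (F : I -> R * R) :
  \sum_i F i = (\sum_i (F i).1, \sum_i (F i).2).
Proof. by elim/big_ind3: _ => // [x a b y c d -> ->|i _]; rewrite //; case: (F i). Qed.

Lemma dotDr x y (z : R * R) : dot x (y + z) = dot x y + dot x z.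
Proof. by rewrite /dot /=; ring. Qed.

Lemma dotZr x (c : R) y : dot x (c *: y) = c * dot x y.
Proof. by rewrite /dot /= /GRing.scale /=; ring. Qed.

(** Stored as gradient and constant term, so that the gradient is at hand for derivatives along
    lines and for null sets. *)
Definition affine (a : (R * R) * R) x : R := dot a.1 x + a.2.

Lemma affine_line a x (t : R) y : affine a (x + t *: y) = affine a x + t * dot a.1 y.
Proof. by rewrite /affine dotDr dotZr addrAC. Qed.

Lemma continuous_affine a : continuous (affine a).
Proof.
apply: continuous_add; last exact: continuous_cst.
by apply: continuous_add; apply: continuous_mul; (try exact: continuous_cst) => x;
  [exact: cvg_fst|exact: cvg_snd].
Qed.

Lemma bary_coords V : Defs.nondegenerate V -> exists lam : 'I_3 -> (R * R) * R,
  [/\ forall x, \sum_i affine (lam i) x = 1,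
      forall x, x = bary_pt V (fun i => affine (lam i) x) &
      forall w i, \sum_j w j = 1 -> affine (lam i) (bary_pt V w) = w i].
Proof.
rewrite /Defs.nondegenerate /dot /rot90 /=.
have -> : inord 1 = lift ord0 ord0 :> 'I_3 by apply: val_inj; rewrite /= inordK.
have -> : inord 2 = lift ord0 (lift ord0 ord0) :> 'I_3 by apply: val_inj; rewrite /= inordK.
set i1 := lift ord0 ord0; set i2 := lift ord0 (lift ord0 ord0).
case Va: (V ord0) => [a1 a2]; case Vb: (V i1) => [b1 b2]; case Vc: (V i2) => [c1 c2] /=.
(* [d] is twice the signed area of the triangle; the coordinates below are Cramer's rule. *)
set d := (X in X != 0) => d0.
pose l1 : (R * R) * R := (((c2 - a2) / d, - (c1 - a1) / d), (a2 * (c1 - a1) - a1 * (c2 - a2)) / d).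
pose l2 : (R * R) * R := ((- (b2 - a2) / d, (b1 - a1) / d), (a1 * (b2 - a2) - a2 * (b1 - a1)) / d).
pose l0 : (R * R) * R := ((- l1.1.1 - l2.1.1, - l1.1.2 - l2.1.2), 1 - l1.2 - l2.2).
pose lam i := if i == ord0 then l0 else if i == i1 then l1 else l2.
exists lam.
have sum3 (F : 'I_3 -> R) : \sum_i F i = F ord0 + (F i1 + F i2).
  by rewrite !big_ord_recl big_ord0 addr0.
have lam0 : lam ord0 = l0 by [].
have lam1 : lam i1 = l1 by [].
have lam2 : lam i2 = l2 by [].
split.
- move=> x; rewrite sum3 lam0 lam1 lam2 /affine /dot /=; ring.
- move=> [x y]; rewrite /bary_pt sum_pair !sum3 lam0 lam1 lam2 Va Vb Vc /=.
  rewrite /affine /dot /l0 /l1 /l2 /= /GRing.scale /=.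
  by congr (_, _); rewrite /d; field; exact: d0.
- move=> w i; rewrite sum3 => w1; rewrite /bary_pt sum_pair !sum3 Va Vb Vc /=.
  have w0 : w ord0 = 1 - w i1 - w i2 by rewrite -w1; ring.
  have [-> | [-> | ->]] : i = ord0 \/ i = i1 \/ i = i2.
    by case: i => -[|[|[|//]]] p; [left|right; left|right; right]; exact: val_inj.
  all: rewrite ?lam0 ?lam1 ?lam2 /affine /dot /l0 /l1 /l2 /= /GRing.scale /= ?w0; rewrite /d; field; exact: d0.
Qed.

(** Unless the line is vertical, each vertical section is a single point; a vertical line is the
    product of a point with the real line. *)
Lemma affine_null (a : (R * R) * R) : a.1 != 0 ->
  leb2.-negligible [set x : plane | affine a x = 0].
Proof.
case: a => -[a1 a2] c; rewrite /affine /dot /=; set A := [set _ | _] => a0.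
have mA : measurable (A : set plane).
  have -> : A = affine ((a1, a2), c) @^-1` [set 0] by [].
  apply: closed_measurable_plane; apply: closed_comp; last exact: closed_eq.
  by move=> x _; exact: continuous_affine.
exists A; split => //.
have [a20|a20] := eqVneq a2 0; last first.
  rewrite /leb2 /product_measure1 /= integral0_eq// => x _.
  rewrite (_ : xsection A x = [set - (a1 * x + c) / a2]) ?lebesgue_measure_set1//.
  apply/seteqP; split=> y; rewrite /xsection /= inE /A /=.
    by move=> /eqP; rewrite addrAC addrC addr_eq0 => /eqP <-; rewrite mulrC mulKf.
  by move=> ->; field.
have a10 : a1 != 0 by apply: contra a0 => /eqP ->; rewrite a20.
have sub : A `<=` [set - c / a1] `*` setT.
  move=> [x y]; rewrite /A a20 /= mul0r addr0 => /eqP; rewrite addr_eq0 => /eqP <-.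
  by split => //; rewrite mulrC mulKf.
have mB : measurable ([set - c / a1] `*` setT : set plane) by exact: measurableX.
apply/eqP; rewrite eq_le measure_ge0 andbT.
have : (leb2 A <= leb2 ([set (- c / a1)%R] `*` setT : set plane))%E by apply: le_measure; rewrite ?inE.
have e0 : lebesgue_measure ([set - c / a1] : set R) = 0%E by exact: lebesgue_measure_set1.
by rewrite /leb2 product_measure1E// [X in (X * _)%E]e0 mul0e.
Qed.

End Barycentric.

Section Triangle.
Context {R : realType}.
Variables (V : 'I_3 -> R * R) (lam : 'I_3 -> (R * R) * R).
Hypotheses (lam_sum : forall x, \sum_i affine (lam i) x = 1)
  (lam_pt : forall x, x = bary_pt V (fun i => affine (lam i) x))
  (lam_bary : forall w i, \sum_j w j = 1 -> affine (lam i) (bary_pt V w) = w i).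
Implicit Types (x y : R * R) (i j k : 'I_3) (w : 'I_3 -> R).
Local Notation plane := (measurableTypeR R * measurableTypeR R)%type.

Lemma open_triE : open_tri V = [set x | forall i, 0 < affine (lam i) x].
Proof.
apply/seteqP; split=> [x [w [w0 w1 ->]] i|x x0]; first by rewrite lam_bary.
by exists (fun i => affine (lam i) x); split.
Qed.

Lemma closed_triE : closed_tri V = [set x | forall i, 0 <= affine (lam i) x].
Proof.
apply/seteqP; split=> [x [w [w0 w1 ->]] i|x x0]; first by rewrite lam_bary.
by exists (fun i => affine (lam i) x); split.
Qed.

Lemma lam_vertex i j : affine (lam i) (V j) = (i == j)%:R.
Proof.
have -> : V j = bary_pt V (fun k => (k == j)%:R).
  rewrite /bary_pt (bigD1 j)//= eqxx scale1r big1 ?addr0// => k /negbTE ->.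
  exact: scale0r.
rewrite lam_bary// (bigD1 j)//= eqxx big1 ?addr0// => k /negbTE -> //.
Qed.

Lemma dot_edge i j k : dot (lam i).1 (V j - V k) = (i == j)%:R - (i == k)%:R.
Proof.
rewrite -!lam_vertex /affine /dot /=; ring.
Qed.

Lemma lam_neq0 i : (lam i).1 != 0.
Proof.
apply/eqP => l0; have [j ij] : exists j, j != i.
  by case: (eqVneq i ord0) => [->|]; [exists ord_max|exists ord0; rewrite eq_sym].
have := dot_edge i i j; rewrite l0 /dot /= !mul0r addr0 eqxx eq_sym (negbTE ij) subr0.
by move/eqP; rewrite eq_sym oner_eq0.
Qed.

Lemma open_open_affine (a : (R * R) * R) (c : R) : open [set x | c < affine a x].
Proof.
rewrite (_ : [set x | _] = affine a @^-1` [set t | c < t])//.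
by apply: open_comp => [x _|]; [exact: continuous_affine|exact: open_gt].
Qed.

Lemma open_open_tri : open (open_tri V).
Proof.
rewrite openE open_triE => x x0; rewrite /interior /=.
have : \forall y \near x, forall i, 0 < affine (lam i) y; last exact.
apply: (@filter_forall _ _ _ (nbhs x)) => i; have : open_nbhs x [set y | 0 < affine (lam i) y].
  by split; [exact: open_open_affine|exact: x0].
exact: open_nbhs_nbhs.
Qed.

Lemma closed_tri_ae : {ae leb2, forall x : plane, closed_tri V x -> open_tri V x}.
Proof.
have : {ae leb2, forall x : plane, forall i, affine (lam i) x != 0}.
  apply: ae_forall_fin => i; have := affine_null (lam_neq0 i).
  by apply: negligibleS => x /= /negP; rewrite negbK => /eqP.
apply: filterS => x x0; rewrite open_triE closed_triE => cx i.
by rewrite lt_neqAle eq_sym x0 cx.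
Qed.

(* A quarter of the side from [V i] to [V j] can be added to any point whose
   barycentric coordinate at [V i] exceeds 1/4. *)
Definition corner i : set (R * R) := [set x | open_tri V x /\ 4^-1 < affine (lam i) x].

Lemma open_corner i : open (corner i).
Proof. by apply: openI; [exact: open_open_tri|exact: open_open_affine]. Qed.

Lemma corner_segment i j x t : corner i x -> 0 <= t <= 1 ->
  open_tri V (x + t *: (4^-1 *: (V j - V i))).
Proof.
move=> [+ xi] /andP[t0 t1]; rewrite open_triE => x0 k /=.
rewrite affine_line dotZr dot_edge; have xk := x0 k.
have t4 : t * 4^-1 <= 4^-1 by rewrite ler_piMl.
have t40 : 0 <= t * 4^-1 by rewrite mulr_ge0.
move: xk; rewrite mulrA; move: (t * 4^-1) t4 t40 => s s4 s0.
case: (eqVneq k i) => [->|_]; case: (_ == j) => /= xk; lra.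
Qed.

(** Three barycentric coordinates that are at most a quarter cannot have sum [1]. *)
Lemma open_tri_corner x : open_tri V x -> exists i, corner i x.
Proof.
move=> Tx; apply: contrapT => nx.
have le4 i : affine (lam i) x <= 4^-1.
  by rewrite leNgt; apply/negP => xi; apply: nx; exists i; split.
have := lam_sum x; have := ler_sum (index_enum 'I_3) (P := xpredT) (fun i _ => le4 i).
move=> + E; rewrite E sumr_const card_ord; lra.
Qed.

(** The gradients of the coordinates measure the differences of the barycentric coordinates of
    [evec a] and of the origin. These differences add up to zero, so [V i] may be subtracted from
    every vertex; [4] undoes the shortening of the sides. *)
Lemma evec_edges (a : 'I_2) i :
  evec a = \sum_j (4 * dot (lam j).1 (evec a)) *: (4^-1 *: (V j - V i)).
Proof.
have dE j : dot (lam j).1 (evec a) = affine (lam j) (evec a) - affine (lam j) 0.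
  by rewrite /affine /dot /=; ring.
have s0 : \sum_j dot (lam j).1 (evec a) = 0.
  by under eq_bigr do rewrite dE; rewrite sumrB !lam_sum subrr.
under eq_bigr do rewrite scalerA mulrAC mulfV// mul1r scalerBr.
rewrite sumrB -scaler_suml s0 scale0r subr0.
have -> : evec a = evec a - 0 :> R * R by rewrite subr0.
rewrite {1}(lam_pt (evec a)) {1}(lam_pt 0) /bary_pt -sumrB; apply: eq_bigr => j _.
by rewrite subr0 dE scalerBl.
Qed.

End Triangle.

Section Patch.
Context d (T : measurableType d) (R : realType).
Variable mu : {measure set T -> \bar R}.
Variables D : set T.
Hypotheses (mD : measurable D).
Implicit Types (f g v : T -> R) (A : set T).

Lemma sqint_patch A g : measurable A -> A `<=` D -> sqint mu A g -> sqint mu D (g \_ A).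
Proof.
move=> mA AD /(sqint_Lfun _ mA) H; apply/(sqint_Lfun _ mD).
suff -> : (g \_ A) \_ D = g \_ A by [].
apply/funext => x; rewrite !patchE; case: ifPn => // xD; case: ifPn => // /set_mem/AD/mem_set.
by rewrite (negbTE xD).
Qed.

Lemma inn_patch A v g : measurable A -> A `<=` D -> inn mu A v g = inn mu D v (g \_ A).
Proof.
move=> mA AD; rewrite -(@inn_supp _ _ _ _ _ _ AD v (g \_ A)).
  by apply: eq_inn => // x Ax; rewrite patchE mem_set.
by move=> x Ax; rewrite patchE memNset ?mulr0.
Qed.

(** [h] is [g] times the number of pieces that contain the point, which merges the sum into one
    integral; disjointness makes that number at most one. *)
Lemma inn_disjoint_le (I : finType) (A : I -> set T) g : (forall i, measurable (A i)) ->
  (forall i, A i `<=` D) -> (forall i j x, A i x -> A j x -> i = j) -> sqint mu D g ->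
  \sum_i inn mu (A i) g g <= inn mu D g g.
Proof.
move=> mA AD dA sg; have sA i : sqint mu D (g \_ (A i)).
  by apply: sqint_patch => //; exact: sqintS sg.
pose h x := \sum_i (g \_ (A i)) x; have sh : sqint mu D h by exact: sqint_sum.
have -> : \sum_i inn mu (A i) g g = inn mu D g h.
  transitivity (\sum_i inn mu D g (g \_ (A i))); first by apply: eq_bigr => i _; exact: inn_patch.
  rewrite /inn -Rintegral_sum//; last by move=> i; exact: sqint_integrable_mul.
  by apply: eq_Rintegral => x _; rewrite mulr_sumr.
apply: le_Rintegral => //; try exact: sqint_integrable_mul.
move=> x _; have [[i Aix]|nA] := pselect (exists i, A i x).
  rewrite /h (bigD1 i)//= patchE mem_set// big1 ?addr0// => j ji.
  by rewrite patchE memNset// => /(dA _ _ _ Aix) ij; rewrite ij eqxx in ji.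
rewrite /h big1 ?mulr0 -?expr2 ?sqr_ge0// => i _.
by rewrite patchE memNset// => Aix; apply: nA; exists i.
Qed.

(** The same [h] as for disjoint pieces, with a number that is now at least one almost
    everywhere. *)
Lemma inn_cover_le (I : finType) (A : I -> set T) g : (forall i, measurable (A i)) ->
  (forall i, A i `<=` D) -> {ae mu, forall x, D x -> exists i, A i x} -> sqint mu D g ->
  inn mu D g g <= \sum_i inn mu (A i) g g.
Proof.
move=> mA AD cA sg; have sA i : sqint mu D (g \_ (A i)).
  by apply: sqint_patch => //; exact: sqintS sg.
pose h x := \sum_i (g \_ (A i)) x; have sh : sqint mu D h by exact: sqint_sum.
have -> : \sum_i inn mu (A i) g g = inn mu D g h.
  transitivity (\sum_i inn mu D g (g \_ (A i))); first by apply: eq_bigr => i _; exact: inn_patch.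
  rewrite /inn -Rintegral_sum//; last by move=> i; exact: sqint_integrable_mul.
  by apply: eq_Rintegral => x _; rewrite mulr_sumr.
have gA i x : 0 <= g x * (g \_ (A i)) x.
  by rewrite patchE; case: ifP; rewrite ?mulr0 -?expr2 ?sqr_ge0.
rewrite -lee_fin !EFin_inn//; apply: ae_ge0_le_integral => //.
- by move=> x _; rewrite lee_fin -expr2 sqr_ge0.
- by case: sg => mg _; apply/measurable_EFinP/measurable_funM.
- by move=> x _; rewrite lee_fin /h mulr_sumr; apply: sumr_ge0 => i _.
- by case: sg sh => mg _ [mh _]; apply/measurable_EFinP/measurable_funM.
apply: filterS cA => x cx Dx; have [i Aix] := cx Dx.
rewrite lee_fin /h mulr_sumr (bigD1 i)//= patchE mem_set// lerDl.
by apply: sumr_ge0 => j _.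
Qed.

Lemma inn_sum3_le (F : 'I_3 -> T -> R) : (forall j, sqint mu D (F j)) ->
  inn mu D (fun x => \sum_j F j x) (fun x => \sum_j F j x) <= 4 * \sum_j inn mu D (F j) (F j).
Proof.
move=> sF; rewrite !big_ord_recl big_ord0 addr0.
have -> : (fun x => \sum_j F j x) = fun x => F ord0 x + 1 * (F (lift ord0 ord0) x +
    1 * F (lift ord0 (lift ord0 ord0)) x).
  by apply/funext => x; rewrite !big_ord_recl big_ord0 addr0 !mul1r.
have s12 := sqintD mD (sF (lift ord0 ord0)) (sqintZ mD 1 (sF (lift ord0 (lift ord0 ord0)))).
have h := inn_sqrD_le mD 1 (sF ord0) s12.
have h' := inn_sqrD_le mD 1 (sF (lift ord0 ord0)) (sF (lift ord0 (lift ord0 ord0))).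
apply: (le_trans h); move: h'; have := inn_ge0 mu D (F ord0).
rewrite expr1n !mulr1; move: (inn _ _ _ _) (inn _ _ _ _) (inn _ _ _ _) (inn _ _ _ _) => a b c e; lra.
Qed.

End Patch.

(** * Interior of the closure of a Lipschitz domain *)

Section LipschitzInterior.
Context {R : realType}.
Implicit Types (x y z d : R * R).

Lemma dot_rot90 d : elen d = 1 -> [/\ dot (rot90 d) (rot90 d) = 1, dot d d = 1 &
  dot (rot90 d) d = 0].
Proof.
rewrite /elen => d1; have dd : dot d d = 1.
  rewrite -(sqr_sqrtr (_ : 0 <= dot d d)) ?d1 ?expr1n//.
  by rewrite /dot addr_ge0// -expr2 sqr_ge0.
by split => //; rewrite -?dd /dot /rot90 /=; ring.
Qed.

Lemma orthonormal_decomposition d x z : elen d = 1 ->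
  z = x + dot (rot90 d) (z - x) *: rot90 d + dot d (z - x) *: d.
Proof.
move=> /dot_rot90[_ dd _]; case: d x z dd => [d1 d2] [x1 x2] [z1 z2].
rewrite /dot /rot90 /= => dd; congr (_, _); rewrite /= /GRing.scale /=.
  have -> : x1 + (- d2 * (z1 - x1) + d1 * (z2 - x2)) * - d2 + (d1 * (z1 - x1) + d2 * (z2 - x2)) * d1
    = x1 + (d1 * d1 + d2 * d2) * (z1 - x1) by ring.
  by rewrite dd; ring.
have -> : x2 + (- d2 * (z1 - x1) + d1 * (z2 - x2)) * d1 + (d1 * (z1 - x1) + d2 * (z2 - x2)) * d2
  = x2 + (d1 * d1 + d2 * d2) * (z2 - x2) by ring.
by rewrite dd; ring.
Qed.

Lemma unit_entries d : elen d = 1 -> `|d.1| <= 1 /\ `|d.2| <= 1.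
Proof.
move=> /dot_rot90[_ dd _]; rewrite /dot in dd.
have le1 (a b : R) : a * a + b * b = 1 -> `|a| <= 1.
  by rewrite -!expr2 -(real_normK (num_real a)) => ab; have := sqr_ge0 b; have := normr_ge0 a; nra.
by split; [exact: le1 dd|apply: (le1 _ d.1); rewrite addrC].
Qed.

Lemma unit_dot_lt d z (e : R) : elen d = 1 -> `|z.1| < e -> `|z.2| < e -> `|dot d z| < 2 * e.
Proof.
move=> /unit_entries[d1 d2] z1 z2; apply: (le_lt_trans (ler_normD _ _)); rewrite !normrM.
have : `|d.1| * `|z.1| <= `|z.1| by rewrite ler_piMl.
have : `|d.2| * `|z.2| <= `|z.2| by rewrite ler_piMl.
lra.
Qed.

(** A mesh covers the closure, so its open triangles are seen at first only inside the interior of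
    the closure. A point there outside [om] would be a boundary point with points of [om] above the
    local graph, which [lipschitz_boundary] excludes. *)
Lemma interior_closure_lipschitz (om : set (R * R)) : open om -> lipschitz_boundary om ->
  interior (closure om) `<=` om.
Proof.
move=> oom lip x ix; apply: contrapT => nx.
have bx : bdry om x.
  by split; [exact: interior_subset ix|rewrite (interior_id om).1].
have [d [r [k [g [d1 r0 gk omg]]]]] := lip x bx.
have [rr dd rd] := dot_rot90 d1.
have g0 : g 0 <= 0.
  rewrite leNgt; apply/negP => g0; apply: nx.
  have H0 : `|0 : R| < r by rewrite normr0.
  by have := (omg 0 0 H0 H0).2; rewrite !scale0r !addr0; exact.
have /nbhs_ballP[eps /= eps0 xeps] : nbhs x (closure om) by [].
pose t := Num.min r eps / 3; have m0 : 0 < Num.min r eps by rewrite lt_min r0.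
have t0 : 0 < t by rewrite divr_gt0.
have tr : 3 * t <= r by rewrite /t mulrC divfK// ge_min lexx.
have te : 3 * t <= eps by rewrite /t mulrC divfK// ge_min lexx orbT.
have cy : closure om (x + t *: d).
  apply: xeps; apply/ballP2; have [u1 u2] := unit_entries d1; split; rewrite /= opprD addNKr normrN normrM gtr0_norm//.
    by rewrite (@le_lt_trans _ _ t)// ?ler_piMr ?(ltW t0)//; lra.
  by rewrite (@le_lt_trans _ _ t)// ?ler_piMr ?(ltW t0)//; lra.
have K0 : 0 < `|k| + 1 by rewrite ltr_wpDl.
(* So small that points within [e / 2] of [x + t *: d] stay above the graph, which has height at
   most [0] at the origin of the frame and rises by at most the Lipschitz bound over a width [e]. *)
pose e := Num.min t (t / (`|k| + 1)).
have e0 : 0 < e by rewrite lt_min t0 divr_gt0.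
have et : e <= t by rewrite ge_min lexx.
have ek : `|k| * e + e <= t.
  have : e <= t / (`|k| + 1) by rewrite ge_min lexx orbT.
  by rewrite ler_pdivlMr// mulrDr mulr1 mulrC.
have e20 : 0 < e / 2 by rewrite divr_gt0.
have [z [omz]] := cy _ (nbhsx_ballx (x + t *: d) _ e20).
move=> /ballP2[/=]; rewrite distrC => z1; rewrite distrC => z2.
pose y := z - (x + t *: d).
have rl : elen (rot90 d) = 1 by rewrite /elen rr sqrtr1.
have s_lt := unit_dot_lt (z := y) rl z1 z2; have t_lt := unit_dot_lt (z := y) d1 z1 z2.
have zE : z - x = y + t *: d by rewrite /y opprD addrA subrK.
have sE : dot (rot90 d) (z - x) = dot (rot90 d) y by rewrite zE dotDr dotZr rd mulr0 addr0.
have tE : dot d (z - x) = dot d y + t by rewrite zE dotDr dotZr dd mulr1.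
have := orthonormal_decomposition x z d1; rewrite sE tE => zE'.
rewrite mulrC divfK// in s_lt t_lt.
have kle : k * `|dot (rot90 d) y| <= `|k| * e.
  by rewrite (le_trans (ler_norm _))// normrM normr_id ler_wpM2l// ltW.
have := gk (dot (rot90 d) y) 0; rewrite subr0 => gle.
have := ler_norm (g (dot (rot90 d) y) - g 0) => gle'.
move: (t_lt); rewrite ltr_norml => /andP[t1 t2].
have sr : `|dot (rot90 d) y| < r by lra.
have tr' : `|dot d y + t| < r by rewrite ltr_norml; apply/andP; split; lra.
have := (omg _ _ sr tr').1; rewrite -zE' => /(_ omz); lra.
Qed.

End LipschitzInterior.

Section Lines.
Context {R : realType}.
Implicit Types (x y a b : R * R).

Lemma dot_eq0 a : dot a a = 0 -> a = 0.
Proof.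
case: a => a1 a2; rewrite /dot /= => /eqP.
by rewrite paddr_eq0 -?expr2 ?sqr_ge0// !sqrf_eq0 => /andP[/eqP -> /eqP ->].
Qed.

(** A small move from [x] along the gradient [l.1] stays in [U] and changes the value of the affine
    function. *)
Lemma open_not_line (U : set (R * R)) (l : (R * R) * R) x : open U -> l.1 != 0 ->
  (forall y, U y -> affine l y = 0) -> ~ U x.
Proof.
move=> oU l0 Ul Ux; have /nbhs_ballP[e /= e0 xe] := open_nbhs_nbhs (conj oU Ux).
pose n : R := `|l.1.1| + `|l.1.2| + 1.
have n0 : 0 < n by rewrite ltr_wpDl// addr_ge0.
pose s := e / 2 / n; have s0 : 0 < s by rewrite !divr_gt0.
have sn : s * n < e by rewrite /s divfK ?gt_eqF//; lra.
have small (u : R) : `|u| <= n -> `|s * u| < e.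
  by move=> un; apply: le_lt_trans sn; rewrite normrM gtr0_norm// ler_pM2l.
have : U (x + s *: l.1).
  apply: xe; apply/ballP2; rewrite /= !opprD !addNKr !normrN; split; apply: small; rewrite /n.
    by have := normr_ge0 l.1.2; lra.
  by have := normr_ge0 l.1.1; lra.
move=> /Ul; rewrite affine_line (Ul _ Ux) add0r => /eqP; rewrite mulf_eq0 gt_eqF//= => /eqP /dot_eq0.
exact/eqP.
Qed.

Lemma closed_seg_line a b : exists2 l : (R * R) * R, l.1 != 0 &
  forall x, closed_seg a b x -> affine l x = 0.
Proof.
have [ab|ab] := eqVneq (b - a) 0.
  exists ((1, 0), - a.1); first by apply/eqP => -[/eqP]; rewrite oner_eq0.
  move=> _ [s _ <-]; rewrite /seg_pt ab scaler0 addr0 /affine /dot /=; ring.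
exists (rot90 (b - a), - dot (rot90 (b - a)) a).
  apply: contra ab => /eqP r0; apply/eqP/dot_eq0; have := f_equal (fun r => dot r r) r0.
  by rewrite /dot /rot90 /= !mulr0 addr0 => <-; ring.
move=> _ [s _ <-]; rewrite /seg_pt affine_line.
have -> : dot (rot90 (b - a)) (b - a) = 0 by rewrite /dot /rot90 /=; ring.
by rewrite /affine /= mulr0 addr0 subrr.
Qed.

End Lines.

Section Mesh.
Context {R : realType}.
Variables (om : set (R * R)) (kappa : R) (N : nat) (T : 'I_N -> 'I_3 -> R * R).
Hypotheses (oom : open om) (bom : bounded_set om) (lip : lipschitz_boundary om)
  (mesh : regular_mesh om kappa T).
Implicit Types (phi v : R * R -> R) (M Q : R * R -> 'M[R]_2) (k l : 'I_N) (i j : 'I_3).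
Local Notation plane := (measurableTypeR R * measurableTypeR R)%type.
Local Notation tri k := (open_tri (T k)).

Let mom : measurable (om : set plane) := open_measurable_plane oom.

Let lamP k := bary_coords (mesh_nondegenerate mesh k).

Lemma open_tri_open k : open (tri k).
Proof. by have [lam [s p b]] := lamP k; exact: (open_open_tri s p b). Qed.

Lemma open_tri_sub k : tri k `<=` om.
Proof.
have sub : tri k `<=` closure om.
  rewrite -(mesh_covers mesh) => x [w [w0 w1 ->]]; exists k => //.
  by exists w; split => // i; exact: ltW.
move=> x kx; apply: (interior_closure_lipschitz oom lip).
by apply: (interiorS sub); rewrite (interior_id _).1//; exact: open_tri_open.
Qed.

Lemma mesh_ae_cover : {ae leb2, forall x : plane, om x -> exists k, tri k x}.
Proof.
have : {ae leb2, forall x : plane, forall k, closed_tri (T k) x -> tri k x}.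
  by apply: ae_forall_fin => k; have [lam [s p b]] := lamP k; exact: (closed_tri_ae s p b).
apply: filterS => x H omx.
have : closure om x by exact: subset_closure.
by rewrite -(mesh_covers mesh) => -[k _ /H kx]; exists k.
Qed.

(** By conformity two distinct elements meet inside a segment, and no nonempty open set lies in a
    line. *)
Lemma open_tri_inj k l x : tri k x -> tri l x -> k = l.
Proof.
move=> kx lx; apply/eqP/negPn/negP => kl.
have oU : open (tri k `&` tri l) by apply: openI; exact: open_tri_open.
suff [a a0 Ua] : exists2 a : (R * R) * R, a.1 != 0 &
    forall y, (tri k `&` tri l) y -> affine a y = 0.
  exact: (open_not_line oU a0 Ua (conj kx lx)).
have cl k' : tri k' `<=` closed_tri (T k').
  by move=> z [w [w0 w1 ->]]; exists w; split => // i; exact: ltW.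
have sub : tri k `&` tri l `<=` closed_tri (T k) `&` closed_tri (T l) by exact: setISS.
have [E|[i [j [_ E]]]|[i [i' [j [j' [_ _ _ E]]]]]] := mesh_conforming mesh kl.
- by have := sub x (conj kx lx); rewrite E.
(* A common vertex is treated as a degenerate segment. *)
- have [a a0 Ha] := closed_seg_line (T k i) (T k i); exists a => // y /sub; rewrite E => ->.
  by apply: Ha; exists 0; [rewrite /= in_itv/= lexx ler01|rewrite /seg_pt scale0r addr0].
- have [a a0 Ha] := closed_seg_line (T k i) (T k i'); exists a => // y /sub; rewrite E.
  exact: Ha.
Qed.

Lemma measurable_open_tri k : measurable (tri k : set plane).
Proof. exact: (open_measurable_plane (@open_tri_open k)). Qed.

Lemma triangle_gradient k : exists C : R, forall phi (a : 'I_2), smooth phi ->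
  inn leb2 (tri k) (pd a phi) (pd a phi) <= C * form2 om phi phi.
Proof.
have [lam [s p b]] := lamP k.
pose W i : set (R * R) := corner (T k) lam i.
have oW i : open (W i) by exact: (@open_corner _ _ _ s p b i).
have mW i : measurable (W i : set plane) by exact: (open_measurable_plane (oW i)).
have WT i : W i `<=` tri k by move=> x [].
have mT := measurable_open_tri k.
pose e i j : R * R := 4^-1 *: (T k j - T k i).
pose A i j : R := 72 + 2 * ((e i j).1 ^+ 2 + (e i j).2 ^+ 2) ^+ 2.
have dirb i j phi : smooth phi -> inn leb2 (W i) ('D_(e i j) phi) ('D_(e i j) phi) <= A i j * form2 om phi phi.
  move=> sp; apply: segment_gradient_le => // x t Wx t01; apply: (@open_tri_sub k).
  exact: (corner_segment s p b j Wx t01).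
have sqW i f : smooth f -> sqint leb2 (W i) f.
  move=> sf; have Wom : W i `<=` om by exact: (subset_trans (WT i) (@open_tri_sub k)).
  exact: (sqintS (mW i) mom Wom (continuous_sqint_plane mom bom (smooth_continuous sf))).
pose c (a : 'I_2) j : R := 4 * dot (lam j).1 (evec a).
have A0 i j : 0 <= A i j by rewrite addr_ge0// mulr_ge0// sqr_ge0.
have corner_bound i a phi : smooth phi -> inn leb2 (W i) (pd a phi) (pd a phi) <=
    (4 * \sum_j c a j ^+ 2 * A i j) * form2 om phi phi.
  move=> sp; have sD j := sqW i _ (smooth_derive (e i j) sp).
  have E : pd a phi = fun x => \sum_j c a j * 'D_(e i j) phi x.
    apply/funext => x; have C1p := smooth_C1 sp.
    rewrite /pd (C1_derive_dir x _ C1p) (evec_edges s p a i) sum_pair /=.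
    rewrite !mulr_suml -big_split; apply: eq_bigr => j _ /=.
    rewrite (C1_derive_dir x _ C1p) /c /e /= /GRing.scale /=; move: (pd ord0 phi x) (pd ord_max phi x) => p0 p1.
    ring.
  rewrite E (le_trans (inn_sum3_le (mW i) (fun j => sqintZ (mW i) (c a j) (sD j))))//.
  rewrite -mulrA ler_pM2l// mulr_suml; apply: ler_sum => j _.
  rewrite (innZl (mW i) _ (sD j) (sqintZ (mW i) _ (sD j))) (innZr (mW i) _ (sD j) (sD j)) mulrA.
  by rewrite -expr2 -mulrA; apply: ler_wpM2l; [exact: sqr_ge0|exact: dirb].
(* Summing over both coordinates makes the constant independent of [a]. *)
exists (\sum_i \sum_(a < 2) 4 * \sum_j c a j ^+ 2 * A i j) => phi a sp.
have sT : sqint leb2 (tri k) (pd a phi).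
  by apply: (sqintS mT mom (@open_tri_sub k)); exact/(L2P _ oom)/L2_smooth/smooth_pd.
have cover : {ae leb2, forall x : plane, tri k x -> exists i, W i x}.
  by apply: aeW => x kx; exact: (open_tri_corner s).
apply: (le_trans (inn_cover_le mT mW WT cover sT)); rewrite mulr_suml; apply: ler_sum => i _.
apply: (le_trans (corner_bound i a phi sp)); apply: ler_wpM2r; first exact: form2_ge0.
rewrite (bigD1 a)//= lerDl; apply: sumr_ge0 => a' _; rewrite mulr_ge0//.
by apply: sumr_ge0 => j _; rewrite mulr_ge0// sqr_ge0.
Qed.

(** The constant depends on the mesh. This is harmless, because it is used only through the
    description [H20P] of [H20]. *)
Lemma mesh_gradient : exists C : R, forall (a : 'I_2) phi, smooth phi ->
  ip om (pd a phi) (pd a phi) <= C * form2 om phi phi.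
Proof.
have [C CP] := choice triangle_gradient; exists (\sum_k C k) => a phi sp.
have sT : sqint leb2 om (pd a phi) by exact/(L2P _ oom)/L2_smooth/smooth_pd.
apply: (le_trans (inn_cover_le mom measurable_open_tri open_tri_sub mesh_ae_cover sT)).
by rewrite mulr_suml; apply: ler_sum => k _; exact: CP.
Qed.

End Mesh.

(** * Broken divergence *)

Section BrokenDivergence.
Context {R : realType}.
Variables (om : set (R * R)) (kappa : R) (N : nat) (T : 'I_N -> 'I_3 -> R * R).
Hypotheses (oom : open om) (bom : bounded_set om) (lip : lipschitz_boundary om)
  (mesh : regular_mesh om kappa T).
Implicit Types (phi u v g : R * R -> R) (M Q : R * R -> 'M[R]_2) (k : 'I_N) (c : R).
Local Notation plane := (measurableTypeR R * measurableTypeR R)%type.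
Local Notation tri k := (open_tri (T k)).

Let mom : measurable (om : set plane) := open_measurable_plane oom.
Let otri k : open (tri k) := open_tri_open mesh (k:=k).
Let mtri k : measurable (tri k : set plane) := measurable_open_tri mesh k.
Let tri_sub k : tri k `<=` om := open_tri_sub oom lip mesh (k:=k).

Lemma L2_tri k g : L2 om g -> L2 (tri k) g.
Proof.
move=> /(L2P _ oom) sg; apply/(L2P _ (@otri k)); exact: (sqintS (mtri k) mom (@tri_sub k) sg).
Qed.

Lemma L2S_tri k M : L2S om M -> L2S (tri k) M.
Proof.
by move=> [sM LM]; split; [move=> x /tri_sub; exact: sM|move=> i j; exact/L2_tri/LM].
Qed.

Lemma is_dDiv_lin (A : set (R * R)) c M Q g h : open A -> L2S A M -> L2S A Q ->
  is_dDiv A M g -> is_dDiv A Q h -> is_dDiv A (M + c *: Q) (g + c *: h).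
Proof.
move=> oA LM LQ [Lg Hg] [Lh Hh]; split; first exact: L2_lin.
move=> phi tphi; have Lphi : L2 A phi by apply/(L2P _ oA); exact: L2_test tphi.
have Lc : L2S A (chess phi).
  split; first by move=> p _; apply/matrixP => i j; rewrite !mxE smooth_schwarz//; exact: test_smooth tphi.
  move=> i j; apply/(L2P _ oA); have := L2_test oA (test_pd i (test_pd j tphi)).
  by rewrite (_ : (fun p => chess phi p i j) = pd i (pd j phi))//; apply/funext => p; rewrite mxE.
by rewrite ipS_lin// ip_lin// Hg// Hh.
Qed.

Lemma is_dDiv_tri k M g : is_dDiv om M g -> is_dDiv (tri k) M g.
Proof.
move=> [Lg Hg]; split; first exact: L2_tri.
move=> phi tphi; have tom := test_sub (@tri_sub k) tphi.
have phi0 x : ~ tri k x -> phi x = 0 by exact: (test_out tphi).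
have cphi0 x : ~ tri k x -> chess phi x = 0.
  by move=> kx; apply/matrixP => i j; rewrite !mxE (test_out (test_pd i (test_pd j tphi))).
have := Hg _ tom; rewrite /ip -/(inn leb2 om g phi) -/(inn leb2 (tri k) g phi).
rewrite -(@inn_supp _ plane R leb2 _ _ (@tri_sub k) g phi); last by move=> x /phi0 ->; rewrite mulr0.
move=> <-; rewrite /ipS [LHS]Rintegral_mkcond [RHS]Rintegral_mkcond.
apply: eq_Rintegral => x _; rewrite !patchE; case: ifPn => [/set_mem/tri_sub/mem_set -> //|kx].
case: ifP => // _; rewrite cphi0; last by move=> /mem_set; exact/negP.
by rewrite /frob big1// => i _; rewrite big1// => j _; rewrite mxE mulr0.
Qed.

(** Glues the elementwise representatives into one function on [om], so that [ip_dDivT] becomes a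
    single inner product. *)
Definition broken_dDiv M : R * R -> R :=
  fun x => \sum_k ((dDiv (tri k) M) \_ (tri k)) x.

Let dDiv_tri k M : HdDivT om T M -> is_dDiv (tri k) M (dDiv (tri k) M).
Proof. by move=> [_ /(_ k)[_ [g Hg]]]; exact: dDivP Hg. Qed.

Let sqint_patch_dDiv k M : HdDivT om T M ->
  sqint leb2 om ((dDiv (tri k) M) \_ (tri k)).
Proof.
move=> HM; apply: (sqint_patch mom (mtri k) (@tri_sub k)).
by apply/(L2P _ (@otri k)); case: (dDiv_tri k HM).
Qed.

Lemma L2_broken_dDiv M : HdDivT om T M -> L2 om (broken_dDiv M).
Proof.
move=> HM; apply/(L2P _ oom); apply: sqint_sum => // k; exact: sqint_patch_dDiv.
Qed.

Lemma ip_dDivTE v M : L2 om v -> HdDivT om T M -> ip_dDivT T v M = ip om v (broken_dDiv M).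
Proof.
move=> /(L2P _ oom) sv HM; rewrite /ip_dDivT.
transitivity (\sum_k inn leb2 om v ((dDiv (tri k) M) \_ (tri k))).
  by apply: eq_bigr => k _; apply: (@inn_patch _ plane R leb2 om (tri k)); [exact: mtri|exact: tri_sub].
rewrite /inn -Rintegral_sum//; last by move=> k; apply: sqint_integrable_mul => //; exact: sqint_patch_dDiv.
by apply: eq_Rintegral => x _; rewrite mulr_sumr.
Qed.

Lemma HdDivT_lin c M Q : HdDivT om T M -> HdDivT om T Q -> HdDivT om T (M + c *: Q).
Proof.
move=> HM HQ; have [LM HM'] := HM; have [LQ HQ'] := HQ; split; first exact: L2S_lin.
move=> k; split; first by apply: L2S_lin => //; exact: L2S_tri.
exists (dDiv (tri k) M + c *: dDiv (tri k) Q).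
by apply: is_dDiv_lin; [exact: otri|exact: L2S_tri|exact: L2S_tri|exact: dDiv_tri|exact: dDiv_tri].
Qed.

Lemma ip_dDivT_lin c v M Q : L2 om v -> HdDivT om T M -> HdDivT om T Q ->
  ip_dDivT T v (M + c *: Q) = ip_dDivT T v M + c * ip_dDivT T v Q.
Proof.
move=> Lv HM HQ; rewrite /ip_dDivT mulr_sumr -big_split; apply: eq_bigr => k _ /=.
have dM := dDiv_tri k HM; have dQ := dDiv_tri k HQ.
have dMQ := is_dDiv_lin c (@otri k) (L2S_tri k HM.1) (L2S_tri k HQ.1) dM dQ.
have Lvk := L2_tri k Lv.
rewrite (ip_sym (tri k) v) (ip_ae (@otri k) _ _ Lvk (dDiv_ae (@otri k) dMQ)).
- by rewrite (ip_lin (@otri k))// ?(ip_sym _ _ v)//; [case: dM|case: dQ].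
- by have [] := dDivP dMQ.
- by case: dMQ.
Qed.

Lemma HdDivT_of_dDiv M g : L2S om M -> is_dDiv om M g -> HdDivT om T M.
Proof.
move=> LM dM; split=> // k; split; first exact: L2S_tri.
by exists g; exact: is_dDiv_tri.
Qed.

(** A double divergence on [om] restricts to every element and agrees there almost everywhere with
    the chosen representative; the elements cover [om] up to a null set, so the skeleton contributes
    nothing. *)
Lemma ip_dDivT_dDiv v M g : L2 om v -> L2S om M -> is_dDiv om M g -> ip_dDivT T v M = ip om v g.
Proof.
move=> Lv LM dM; have HM := HdDivT_of_dDiv LM dM; rewrite ip_dDivTE//.
have [Lg _] := dM; rewrite !(ip_sym om v); apply: (ip_ae oom) => //; first exact: L2_broken_dDiv.
have dk : {ae leb2, forall x : plane, forall k, tri k x -> dDiv (tri k) M x = g x}.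
  by apply: ae_forall_fin => k; apply: dDiv_ae => //; exact: is_dDiv_tri.
have := mesh_ae_cover mesh; apply: filterS2 dk => x dk cx /cx[k kx].
rewrite /broken_dDiv (bigD1 k)//= patchE mem_set// dk// big1 ?addr0// => l lk.
by rewrite patchE memNset// => lx; rewrite (open_tri_inj mesh lx kx) eqxx in lk.
Qed.

Lemma norm_dDivT_le M g : L2S om M -> is_dDiv om M g ->
  norm_dDivT T M ^+ 2 <= ipS om M M + ip om g g.
Proof.
move=> LM dM; have [Lg _] := dM.
have nk k : norm_dDiv (tri k) M ^+ 2 =
    (\sum_i \sum_j inn leb2 (tri k) (fun p => M p i j) (fun p => M p i j)) + inn leb2 (tri k) g g.
  rewrite /norm_dDiv /norm_L2S /norm_L2 !sqr_sqrtr ?ipS_ge0 ?ip_ge0 ?addr_ge0 ?ipS_ge0 ?ip_ge0//.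
  rewrite (ipSE (@otri k) (L2S_tri k LM) (L2S_tri k LM)); congr (_ + _).
  have dk := is_dDiv_tri k dM; have [L1 _] := dDivP dk; have [L2' _] := dk.
  have E := dDiv_ae (@otri k) dk.
  by rewrite (ip_ae (@otri k) L1 L2' L1 E) ip_sym (ip_ae (@otri k) L1 L2' L2' E).
rewrite /norm_dDivT sqr_sqrtr; last by apply: sumr_ge0 => k _; exact: sqr_ge0.
under eq_bigr do rewrite nk.
rewrite big_split /= ipSE//; apply: lerD.
  rewrite exchange_big /=; apply: ler_sum => i _.
  rewrite exchange_big /=; apply: ler_sum => j _.
  exact: (inn_disjoint_le mom mtri tri_sub (open_tri_inj mesh) (L2S_entry oom i j LM)).
have sg : sqint leb2 om g by exact/(L2P _ oom).
exact: (inn_disjoint_le mom mtri tri_sub (open_tri_inj mesh) sg).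
Qed.

End BrokenDivergence.

(** * Elasticity tensor *)

Section AlmostEverywhereIntegral.
Context d (T : measurableType d) (R : realType).
Variable mu : {measure set T -> \bar R}.
Implicit Types (D : set T) (f g : T -> \bar R).

Import HBNNSimple.

(** The integral of a nonnegative function is a supremum over simple functions below it. Such a
    function below [f], cut off on the null set where [f] and [g] may differ, lies below [g] and
    keeps its integral. *)
Lemma ge0_ae_le_integral_total f g : (forall x, (0 <= f x)%E) -> (forall x, (0 <= g x)%E) ->
  {ae mu, forall x, f x = g x} -> (\int[mu]_x f x <= \int[mu]_x g x)%E.
Proof.
move=> f0 g0 [N [mN N0 fgN]]; rewrite !ge0_integralTE//.
apply: ge_ereal_sup => _ [h /= hf <-].
have mNC : measurable (~` N) by exact: measurableC.
pose h' := mul_nnsfun h (indic_nnsfun R mNC).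
have h'E x : h' x = h x * \1_(~` N) x by [].
have -> : sintegral mu h = sintegral mu h'.
  have tot (k : {nnsfun T >-> R}) : sintegral mu k = (\int[mu]_x (k x)%:E)%E.
    by rewrite integral_nnsfun// patch_setT.
  rewrite !tot; apply: ge0_ae_eq_integral => //.
  - by apply/measurable_EFinP; exact: measurable_funPT.
  - by apply/measurable_EFinP; exact: measurable_funPT.
  - by move=> x _; rewrite lee_fin; exact: fun_ge0.
  - by move=> x _; rewrite lee_fin; exact: fun_ge0.
  exists N; split=> // x /= nx; apply: contrapT => Nx; apply: nx => _.
  by rewrite -[mindic R mNC x]/(\1_(~` N) x) indicE mem_set ?mulr1.
apply: ereal_sup_ubound; exists h' => // x; rewrite h'E indicE.
have [Nx|Nx] := pselect (N x); first by rewrite memNset ?mulr0.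
rewrite mem_set// mulr1 -(_ : f x = g x); first exact: hf.
by apply: contrapT => fg; apply: Nx; exact: fgN.
Qed.

(* Stated without measurability: [Cinv] is arbitrary on the null set where the
   tensor field is not invertible. *)
Lemma ae_eq_integral_total D f g : {ae mu, forall x, D x -> f x = g x} ->
  (\int[mu]_(x in D) f x = \int[mu]_(x in D) g x)%E.
Proof.
move=> fg; have half (p q : T -> \bar R) : (forall x, (0 <= p x)%E) -> (forall x, (0 <= q x)%E) ->
    {ae mu, forall x, D x -> p x = q x} -> (\int[mu]_(x in D) p x = \int[mu]_(x in D) q x)%E.
  move=> p0 q0 pq; rewrite [LHS]integral_mkcond [RHS]integral_mkcond.
  have pq' : {ae mu, forall x, (p \_ D) x = (q \_ D) x}.
    by apply: filterS pq => x H; rewrite !patchE; case: ifPn => // /set_mem /H.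
  have pos (r : T -> \bar R) x : (forall x, (0 <= r x)%E) -> (0 <= (r \_ D) x)%E.
    by move=> r0; rewrite patchE; case: ifP.
  apply/eqP; rewrite eq_le !ge0_ae_le_integral_total//; try (by move=> x; exact: pos).
  by apply: filterS pq' => x ->.
rewrite [LHS]integralE [RHS]integralE; congr (_ - _)%E; apply: half => //;
  by apply: filterS fg => x H /H fgx; rewrite ?funeposE ?funenegE fgx.
Qed.

End AlmostEverywhereIntegral.

Section Elasticity.
Context {R : realType}.
Variables (om Z : set (R * R)) (C : R * R -> {linear 'M[R]_2 -> 'M[R]_2}) (cb ce : R).
Hypotheses (oom : open om) (bom : bounded_set om).
Implicit Types (M Q N B : R * R -> 'M[R]_2) (A : 'M[R]_2) (x : R * R) (i j : 'I_2) (c : R).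
Local Notation plane := (measurableTypeR R * measurableTypeR R)%type.
Hypotheses (mC : forall A, symm A -> forall i j, measurable_fun (om : set plane) (fun x => C x A i j))
  (mZ : measurable (Z : set plane)) (Z0 : leb2 Z = 0%E)
  (cb1 : 1 <= cb) (ce0 : 0 < ce) (ce1 : ce <= 1)
  (good : forall x, om x -> ~ Z x -> [/\ forall A, symm A -> symm (C x A),
     forall A, symm A -> frob (C x A) (C x A) <= cb * frob A A,
     forall A (A' : 'M[R]_2), symm A -> symm A' -> frob (C x A) A' = frob A (C x A') &
     forall A, symm A -> ce * frob A A <= frob (C x A) A]).

Let mom : measurable (om : set plane) := open_measurable_plane oom.

(* The tensor field, replaced by the identity on the null set [Z] where the
   pointwise properties may fail. *)
Definition stress M x : 'M[R]_2 := \1_Z x *: M x + \1_(~` Z) x *: C x (M x).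

Lemma stressE M x : stress M x = if x \in Z then M x else C x (M x).
Proof.
rewrite /stress !indicE in_setC; case: (x \in Z); rewrite /= scale1r scale0r ?addr0//.
exact: add0r.
Qed.

(** [elast_measurable] speaks of fixed matrices. In this basis [C x (M x)] becomes a combination of
    measurable fields with measurable coefficients. *)
Lemma symm_decomposition A : symm A -> A = A ord0 ord0 *: delta_mx ord0 ord0 +
  A ord0 ord_max *: (delta_mx ord0 ord_max + delta_mx ord_max ord0) +
  A ord_max ord_max *: delta_mx ord_max ord_max.
Proof.
move=> /matrixP/(_ ord_max ord0); rewrite mxE => A01; apply/matrixP => i j; rewrite !mxE.
have [-> | ->] := ord2P i; have [-> | ->] := ord2P j;
  by rewrite /= !(mulr0, mulr1, addr0, add0r) ?A01.
Qed.

Lemma stress_lin c M Q : stress (M + c *: Q) = stress M + c *: stress Q.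
Proof.
apply/funext => x; change (stress (M + c *: Q) x = stress M x + c *: stress Q x).
rewrite !stressE; case: ifP => // _.
by change (C x (M x + c *: Q x) = C x (M x) + c *: C x (Q x)); rewrite linearD linearZ.
Qed.

Lemma stress_symm M x : om x -> symm (M x) -> symm (stress M x).
Proof.
move=> omx sM; rewrite stressE; case: ifPn => // /negP xZ.
by have [+ _ _ _] := good omx (contra_not (@mem_set _ Z x) xZ); exact.
Qed.

Lemma stress_bound M x : om x -> symm (M x) ->
  frob (stress M x) (stress M x) <= cb * frob (M x) (M x).
Proof.
move=> omx sM; rewrite stressE; case: ifPn => [_|/negP xZ].
  by rewrite ler_peMl ?frob_ge0.
by have [_ + _ _] := good omx (contra_not (@mem_set _ Z x) xZ); exact.
Qed.

Lemma stress_adjoint M Q x : om x -> symm (M x) -> symm (Q x) ->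
  frob (stress M x) (Q x) = frob (M x) (stress Q x).
Proof.
move=> omx sM sQ; rewrite !stressE; case: ifPn => // /negP xZ.
by have [_ _ + _] := good omx (contra_not (@mem_set _ Z x) xZ); exact.
Qed.

Lemma stress_coercive M x : om x -> symm (M x) ->
  ce * frob (M x) (M x) <= frob (stress M x) (M x).
Proof.
move=> omx sM; rewrite stressE; case: ifPn => [_|/negP xZ].
  by rewrite ler_piMl ?frob_ge0.
by have [_ _ _ +] := good omx (contra_not (@mem_set _ Z x) xZ); exact.
Qed.

Lemma stress_ae M : {ae leb2, forall x : plane, stress M x = C x (M x)}.
Proof.
exists Z; split=> // x /= nx; apply: contrapT => xZ; apply: nx.
by rewrite stressE memNset.
Qed.

Lemma measurable_stress M i j : L2S om M -> measurable_fun (om : set plane) (fun x => stress M x i j).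
Proof.
move=> LM; have mM k l : measurable_fun (om : set plane) (fun x => M x k l).
  by have [] := L2S_entry oom k l LM.
have mCM : measurable_fun (om : set plane) (fun x => C x (M x) i j).
  have sd (k : 'I_2) : symm (delta_mx k k : 'M[R]_2) by rewrite /symm trmx_delta.
  have s01 : symm (delta_mx ord0 ord_max + delta_mx ord_max ord0 : 'M[R]_2).
    by rewrite /symm raddfD /= !trmx_delta addrC.
  apply: (@eq_measurable_fun _ _ _ _ _ (fun x => M x ord0 ord0 * C x (delta_mx ord0 ord0) i j +
      M x ord0 ord_max * C x (delta_mx ord0 ord_max + delta_mx ord_max ord0) i j +
      M x ord_max ord_max * C x (delta_mx ord_max ord_max) i j)).
    move=> x /set_mem omx; have [sM _] := LM.
    rewrite [in RHS](symm_decomposition (sM x omx)).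
    move: (delta_mx ord0 ord_max + delta_mx ord_max ord0) => D.
    by rewrite !linearD !linearZ !mxE.
  apply: measurable_funD; first apply: measurable_funD.
  - by apply: measurable_funM; [exact: mM|exact: (mC (sd ord0) i j)].
  - by apply: measurable_funM; [exact: mM|exact: (mC s01 i j)].
  - by apply: measurable_funM; [exact: mM|exact: (mC (sd ord_max) i j)].
apply: (@eq_measurable_fun _ _ _ _ _ (fun x => \1_Z x * M x i j + \1_(~` Z) x * C x (M x) i j)).
  by move=> x _; rewrite !mxE.
have m1 : measurable_fun (om : set plane) (\1_Z : plane -> R) by exact: measurable_indic.
have m2 : measurable_fun (om : set plane) (\1_(~` Z) : plane -> R).
  by apply: measurable_indic; exact: measurableC.
by apply: measurable_funD; [exact: measurable_funM m1 (mM i j)|exact: measurable_funM m2 mCM].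
Qed.

Lemma entry_sqr_le_frob A i j : A i j ^+ 2 <= frob A A.
Proof.
rewrite /frob (bigD1 i)//= (bigD1 j)//= expr2 -addrA lerDl.
apply: addr_ge0; first by apply: sumr_ge0 => ? _; rewrite -expr2 sqr_ge0.
by apply: sumr_ge0 => ? _; apply: sumr_ge0 => ? _; rewrite -expr2 sqr_ge0.
Qed.

Lemma L2S_stress M : L2S om M -> L2S om (stress M).
Proof.
move=> LM; have [sM _] := LM; split; first by move=> x omx; exact: stress_symm (sM x omx).
move=> i j; apply/(L2P _ oom); split; first exact: measurable_stress.
have cb0 : 0 <= cb by exact: le_trans cb1.
have I := integrableZl mom cb (integrable_frob oom LM LM).
apply: le_integrable I => //.
  by apply/measurable_EFinP; apply: measurable_funX; exact: measurable_stress.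
move=> x omx /=; rewrite lee_fin ger0_norm ?sqr_ge0// ger0_norm; last by rewrite mulr_ge0 ?frob_ge0.
exact: le_trans (entry_sqr_le_frob _ i j) (stress_bound omx (sM x omx)).
Qed.

Lemma stress_selfadjoint M Q : L2S om M -> L2S om Q -> ipS om (stress M) Q = ipS om M (stress Q).
Proof.
move=> [sM _] [sQ _]; apply: eq_Rintegral => x /set_mem omx.
by apply: stress_adjoint => //; [exact: sM|exact: sQ].
Qed.

Lemma ipS_stress_le M : L2S om M -> ipS om (stress M) (stress M) <= cb * ipS om M M.
Proof.
move=> LM; have [sM _] := LM; have LS := L2S_stress LM.
have I := integrable_frob oom LM LM; have IS := integrable_frob oom LS LS.
rewrite /ipS -RintegralZl//; apply: le_Rintegral => //; first exact: (integrableZl mom _ I).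
by move=> x omx; exact: stress_bound (sM x omx).
Qed.

Lemma ipS_stress_coercive M : L2S om M -> ce * ipS om M M <= ipS om (stress M) M.
Proof.
move=> LM; have [sM _] := LM; have LS := L2S_stress LM.
have I := integrable_frob oom LM LM; have IS := integrable_frob oom LS LM.
rewrite /ipS -RintegralZl//; apply: le_Rintegral => //; first exact: (integrableZl mom _ I).
by move=> x omx; exact: stress_coercive (sM x omx).
Qed.

(** Expanding the squared norm of [stress M - M], which is nonnegative, bounds twice the mixed term
    by the two squares. *)
Lemma stress_bounded_form M : L2S om M -> ipS om (stress M) M <= cb * ipS om M M + ipS om M M.
Proof.
move=> LM; have LS := L2S_stress LM; have LD := L2S_sub oom LS LM.
have := ipS_ge0 om (stress M - M); have S_ge := ipS_ge0 om (stress M).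
rewrite -scaleN1r ipS_lin//; last by rewrite scaleN1r.
rewrite (ipS_sym om (stress M)) (ipS_sym om M (stress M + _)) !ipS_lin// (ipS_sym om M (stress M)).
have := ipS_stress_le LM; have := ipS_ge0 om M.
move: (ipS _ _ _) (ipS _ _ _) (ipS _ _ _) S_ge => a b c; nra.
Qed.

(** Riesz's theorem for the form [a] and the functional [ipS om M] yields a preimage that is square
    integrable from the start, whereas a pointwise inverse would have to be shown measurable. *)
Lemma stress_surjective M : L2S om M ->
  exists2 B, L2S om B & {ae leb2, forall x : plane, om x -> stress B x = M x}.
Proof.
move=> LM.
pose a (B N : R * R -> 'M[R]_2) : R := ipS om (stress B) N.
have aS B N : L2S om B -> L2S om N -> a B N = a N B.
  by move=> LB LN; rewrite /a stress_selfadjoint// ipS_sym.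
have alin c B Q N : L2S om B -> L2S om Q -> L2S om N -> a (B + c *: Q) N = a B N + c * a Q N.
  by move=> LB LQ LN; rewrite /a stress_lin ipS_lin//; exact: L2S_stress.
have a0 B : L2S om B -> 0 <= a B B.
  move=> LB; apply: le_trans (ipS_stress_coercive LB); rewrite mulr_ge0 ?ipS_ge0//; exact: ltW.
have cb0 : 0 < cb + 1 by apply: addr_gt0 => //; exact: lt_le_trans cb1.
have compl (B_ : nat -> R * R -> 'M[R]_2) : (forall n, L2S om (B_ n)) ->
    (forall e, 0 < e -> exists k, forall m n, (k <= m)%N -> (k <= n)%N ->
      a (B_ m - B_ n) (B_ m - B_ n) <= e) ->
    exists2 B, L2S om B & (fun n => a (B_ n - B) (B_ n - B)) @ \oo --> (0 : R).
  move=> LB cB; have [B LB' cvB] : exists2 B, L2S om B &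
      (fun n => ipS om (B_ n - B) (B_ n - B)) @ \oo --> (0 : R).
    apply: (L2S_complete oom bom LB) => e e0; have [k H] := cB (ce * e) (mulr_gt0 ce0 e0).
    exists k => m n km kn; rewrite -(ler_pM2l ce0); apply: le_trans (H m n km kn).
    by apply: ipS_stress_coercive; exact: L2S_sub.
  exists B => //; apply: (@cvg0_le _ _ (fun n => ipS om (B_ n - B) (B_ n - B) * (cb + 1))).
  - by move=> n; apply: a0; exact: L2S_sub.
  - move=> n; apply: (le_trans (stress_bounded_form (L2S_sub oom (LB n) LB'))).
    by rewrite mulrDr mulr1 mulrC.
  - by rewrite -(mul0r (cb + 1)); exact: cvgMl.
have Llin c B N : L2S om B -> L2S om N -> ipS om M (B + c *: N) = ipS om M B + c * ipS om M N.
  by move=> LB LN; rewrite !(ipS_sym om M) ipS_lin.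
have Lbd B : L2S om B -> ipS om M B ^+ 2 <= ipS om M M / ce * a B B.
  move=> LB; apply: (@le_trans _ _ (ipS om M M * ipS om B B)).
    apply: (@form_cauchy_schwarz _ _ (L2S om) (ipS om) (@L2S_lin _ _ oom)) => //.
    - by move=> *; exact: ipS_sym.
    - by move=> *; exact: ipS_lin.
    - by move=> *; exact: ipS_ge0.
  rewrite -mulrA; apply: ler_wpM2l; first exact: ipS_ge0.
  by rewrite mulrC ler_pdivlMr// mulrC; exact: ipS_stress_coercive.
have [B LB HB] := riesz_representation (@L2S_lin _ _ oom) aS alin a0 (L2S0 oom) compl Llin Lbd.
exists B => //; have LD := L2S_sub oom (L2S_stress LB) LM.
have E0 : ipS om (stress B - M) (stress B - M) = 0.
  have := HB _ LD; rewrite /a => H.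
  by rewrite -[X in ipS om X _]/(stress B - M) -{1}scaleN1r ipS_lin ?H//; [rewrite mulN1r subrr|exact: L2S_stress].
have := ipS_eq0 oom LD E0; apply: filterS => x H /H E.
by apply/eqP; rewrite -subr_eq0; apply/eqP; exact: E.
Qed.

(** Coercivity makes [C x] injective on symmetric matrices, so the choice in [Cinv] has a single
    candidate. *)
Lemma CinvE x (A : 'M[R]_2) (A' : 'M[R]_2) : om x -> ~ Z x -> symm A' -> C x A' = A ->
  Cinv C x A = A'.
Proof.
move=> omx Zx sA' CA'; have [_ _ _ pos] := good omx Zx.
have [sB CB] : symm (Cinv C x A) /\ C x (Cinv C x A) = A.
  exact: (@getPex _ [set B | symm B /\ C x B = A] (ex_intro _ A' (conj sA' CA'))).
have sD : symm (Cinv C x A - A') by rewrite -scaleN1r; exact: symm_lin.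
have := pos _ sD; rewrite linearB /= CB CA' subrr.
rewrite [X in _ <= X](_ : _ = 0); last first.
  by rewrite /frob big1// => i _; rewrite big1// => j _; rewrite mxE mul0r.
rewrite pmulr_rle0// => D0; apply/eqP; rewrite -subr_eq0; apply/eqP/frob_eq0.
by apply/eqP; rewrite eq_le D0 frob_ge0.
Qed.

Lemma Cinv_L2S M : L2S om M -> exists2 B, L2S om B &
  {ae leb2, forall x : plane, om x -> stress B x = M x /\ Cinv C x (M x) = B x}.
Proof.
move=> LM; have [B LB BM] := stress_surjective LM; exists B => //.
have Zae : {ae leb2, forall x : plane, ~ Z x}.
  by exists Z; split=> // x /= /contrapT.
apply: filterS2 BM Zae => x BM Zx omx; split; first exact: BM.
have [sB _] := LB; apply: CinvE (sB x omx) _ => //.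
by rewrite -(BM omx) stressE memNset.
Qed.

End Elasticity.

(* [S M] stands for the field [C M]: it is a square integrable representative,
   symmetric everywhere. *)
Record stress_operator (R : realType) (om : set (R * R))
    (C : R * R -> {linear 'M[R]_2 -> 'M[R]_2})
    (S : (R * R -> 'M[R]_2) -> R * R -> 'M[R]_2) (cb ce : R) : Prop := {
  stress_upper : 0 < cb;
  stress_lower : 0 < ce;
  stress_linear : forall c M Q, S (M + c *: Q) = S M + c *: S Q;
  stress_local : forall M Q x, M x = Q x -> S M x = S Q x;
  stress_eq : forall M, {ae leb2, forall x, S M x = C x (M x)};
  stress_L2S : forall M, L2S om M -> L2S om (S M);
  stress_sym : forall M Q, L2S om M -> L2S om Q -> ipS om (S M) Q = ipS om M (S Q);
  stress_le : forall M, L2S om M -> ipS om (S M) (S M) <= cb * ipS om M M;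
  stress_form_le : forall M, L2S om M -> ipS om (S M) M <= cb * ipS om M M;
  stress_ge : forall M, L2S om M -> ce * ipS om M M <= ipS om (S M) M;
  stress_inv : forall M, L2S om M -> exists2 B, L2S om B &
    {ae leb2, forall x, om x -> S B x = M x /\ Cinv C x (M x) = B x} }.

Lemma elasticity_stress (R : realType) (om : set (R * R))
    (C : R * R -> {linear 'M[R]_2 -> 'M[R]_2}) :
  open om -> bounded_set om -> elasticity_tensor om C ->
  exists S cb ce, stress_operator om C S cb ce.
Proof.
move=> oom bom [mC sC [c bC] aC [c' c'0 pC]].
have [Z [mZ Z0 subZ]] := filterI (filterI sC bC) (filterI aC pC).
(* Compared with [1] because the field is the identity on [Z]. *)
pose cb := Num.max 1 c; pose ce := Num.min 1 c'.
have cb1 : 1 <= cb by rewrite le_max lexx.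
have ce0 : 0 < ce by rewrite lt_min ltr01.
have ce1 : ce <= 1 by rewrite ge_min lexx.
have good x : om x -> ~ Z x -> [/\ forall A : 'M[R]_2, symm A -> symm (C x A),
     forall A : 'M[R]_2, symm A -> frob (C x A) (C x A) <= cb * frob A A,
     forall A A' : 'M[R]_2, symm A -> symm A' -> frob (C x A) A' = frob A (C x A') &
     forall A : 'M[R]_2, symm A -> ce * frob A A <= frob (C x A) A].
  move=> omx Zx; have [[g1 g2] [g3 g4]] : ((om x -> forall A, symm A -> symm (C x A)) /\
      (om x -> forall A, symm A -> frob (C x A) (C x A) <= c * frob A A)) /\
      ((om x -> forall A B, symm A -> symm B -> frob (C x A) B = frob A (C x B)) /\
      (om x -> forall A, symm A -> c' * frob A A <= frob (C x A) A)).
    by apply: contrapT => H; apply: Zx; exact: subZ.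
  split=> [A sA|A sA|A A' sA sA'|A sA].
  - exact: g1.
  - by apply: (le_trans (g2 omx A sA)); rewrite ler_wpM2r ?frob_ge0// le_max lexx orbT.
  - exact: g3.
  - by apply: le_trans (g4 omx A sA); rewrite ler_wpM2r ?frob_ge0// ge_min lexx orbT.
have cb0 : 0 < cb by exact: lt_le_trans cb1.
(* [cb + 1] serves both upper bounds; the one from [stress_bounded_form] has an additional
   [ipS om M M]. *)
exists (stress Z C), (cb + 1), ce; split.
- exact: addr_gt0.
- exact: ce0.
- exact: stress_lin.
- by move=> M Q x MQ; rewrite /stress MQ.
- exact: stress_ae.
- exact: (L2S_stress oom mC mZ cb1 good).
- exact: (stress_selfadjoint good).
- move=> M LM; apply: (le_trans (ipS_stress_le oom mC mZ cb1 good LM)).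
  by rewrite ler_wpM2r ?ipS_ge0// lerDl.
- move=> M LM; apply: (le_trans (stress_bounded_form oom mC mZ cb1 good LM)).
  by rewrite mulrDl mul1r.
- exact: (ipS_stress_coercive oom mC mZ cb1 ce1 good).
- exact: (Cinv_L2S oom bom mC mZ Z0 cb1 ce0 ce1 good).
Qed.

(** * Kirchhoff-Love problem *)

Section KirchhoffLove.
Context {R : realType}.
Variables (om : set (R * R)) (m : nat) (E : 'I_m -> (R * R) * (R * R))
  (C : R * R -> {linear 'M[R]_2 -> 'M[R]_2})
  (S : (R * R -> 'M[R]_2) -> R * R -> 'M[R]_2) (cb ce KP : R).
Hypotheses (oom : open om) (bom : bounded_set om)
  (bdryE : bdry om = \bigcup_k closed_seg (E k).1 (E k).2)
  (grad_bound : exists K : R, forall i phi, smooth phi ->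
    ip om (pd i phi) (pd i phi) <= K * form2 om phi phi)
  (hS : stress_operator om C S cb ce) (KP0 : 0 < KP)
  (poincare : forall v, hasH om v -> zero_trace om E v -> ip om v v <= KP * hform om v v).
Implicit Types (f u v w phi : R * R -> R) (c : R).
Local Notation plane := (measurableTypeR R * measurableTypeR R)%type.
Local Notation H20 := (H20 om E).

Definition energy u v : R := ipS om (S (hess om u)) (hess om v).

Definition kl_solution f u := H20 u /\ forall v, H20 v -> energy u v = ip om f v.

Let H20_hasH v : H20 v -> hasH om v.
Proof. by case=> /H2_hasH. Qed.

Let poincareH v : H20 v -> ip om v v <= KP * hform om v v.
Proof. by move=> Hv; have [H z] := (H20P E oom bom grad_bound v).1 Hv; exact: poincare. Qed.

Lemma energy_sym u v : hasH om u -> hasH om v -> energy u v = energy v u.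
Proof. by move=> /hasH_L2S Lu /hasH_L2S Lv; rewrite /energy (stress_sym hS)// ipS_sym. Qed.

Lemma stress_hess_ae u (M : R * R -> 'M[R]_2) :
  {ae leb2, forall x : plane, om x -> hess om u x = M x} ->
  {ae leb2, forall x : plane, om x -> S (hess om u) x = S M x}.
Proof. by apply: filterS => x H /H; exact: (stress_local hS). Qed.

Lemma energy_lin c u v w : hasH om u -> hasH om v -> hasH om w ->
  energy (u + c *: v) w = energy u w + c * energy v w.
Proof.
move=> Hu Hv Hw; have Lu := hasH_L2S Hu; have Lv := hasH_L2S Hv; have Lw := hasH_L2S Hw.
have Luv := hasH_L2S (hasH_lin oom c Hu Hv).
have LS := stress_L2S hS.
rewrite /energy -ipS_lin//; try exact: LS.
rewrite -(stress_linear hS); apply: (ipS_ae oom) => //; [exact: LS|exact/LS/L2S_lin|].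
exact: stress_hess_ae (hess_lin oom c Hu Hv).
Qed.

Lemma energy_ge u : hasH om u -> ce * hform om u u <= energy u u.
Proof. by move=> /hasH_L2S; exact: (stress_ge hS). Qed.

Lemma energy_le u : hasH om u -> energy u u <= cb * hform om u u.
Proof. by move=> /hasH_L2S; exact: (stress_form_le hS). Qed.

Lemma H20_0 : H20 0.
Proof.
(* Smoothness of zero comes from [smooth_lin], as the difference of a bump function with itself. *)
have s0 := smooth_lin (-1) (@smooth_bump R 0 1 0 1 1) (@smooth_bump R 0 1 0 1 1).
have E0 : (fun p => bump 0 1 0 1 1 p + -1 * bump 0 1 0 1 1 p) = 0 :> (R * R -> R).
  by apply/funext => p; rewrite mulN1r subrr.
rewrite E0 in s0; apply: H20_test => //.
have e : closure [set x : R * R | (0 : R * R -> R) x != 0] = set0.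
  by rewrite (_ : [set x | _] = set0) ?closure0//; apply/seteqP; split=> x //=; rewrite eqxx.
by split; rewrite ?e//; exact: compact0.
Qed.

Lemma ip_sqr_le f v : L2 om f -> L2 om v -> ip om f v ^+ 2 <= ip om f f * ip om v v.
Proof.
move=> /(L2P _ oom) sf /(L2P _ oom) sv; exact: (cauchy_schwarz (open_measurable_plane oom) sf sv).
Qed.

Lemma kl_exists f : L2 om f -> exists u, kl_solution f u.
Proof.
move=> Lf; have ce0 := stress_lower hS.
(* Coercivity constant in the full norm: by the Poincare inequality [form2] is at most [KP + 1]
   times the Hessian form, which [ce] compares with the energy. *)
have cK0 : 0 < ce / (KP + 1) by rewrite divr_gt0// addr_gt0.
have form2_le v : H20 v -> ce / (KP + 1) * form2 om v v <= energy v v.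
  move=> Hv; apply: le_trans (energy_ge (H20_hasH Hv)).
  rewrite -mulrA ler_pM2l// mulrC ler_pdivrMr ?addr_gt0// /form2 mulrDr mulr1 mulrC.
  by rewrite lerD2r; exact: poincareH.
have energy0 v : H20 v -> 0 <= energy v v.
  by move=> Hv; apply: le_trans (form2_le v Hv); apply: mulr_ge0; [exact: ltW|exact: form2_ge0].
have compl (u_ : nat -> R * R -> R) : (forall n, H20 (u_ n)) ->
    (forall e, 0 < e -> exists k, forall m n, (k <= m)%N -> (k <= n)%N ->
      energy (u_ m - u_ n) (u_ m - u_ n) <= e) ->
    exists2 u, H20 u & (fun n => energy (u_ n - u) (u_ n - u)) @ \oo --> (0 : R).
  move=> Hu cu; have Hsub (u v : R * R -> R) : H20 u -> H20 v -> H20 (u - v).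
    by move=> ? ?; rewrite -scaleN1r; apply: H20_lin.
  have [u Hu' cvu] : exists2 u, H20 u & (fun n => form2 om (u_ n - u) (u_ n - u)) @ \oo --> (0 : R).
    apply: H20_complete => // e e0; have [k H] := cu _ (mulr_gt0 cK0 e0).
    exists k => p n kp kn; rewrite -(ler_pM2l cK0); apply: le_trans (H p n kp kn).
    exact: (form2_le _ (Hsub _ _ (Hu p) (Hu n))).
  exists u => //; apply: (@cvg0_le _ _ (fun n => form2 om (u_ n - u) (u_ n - u) * cb)).
  - move=> n; exact: (energy0 _ (Hsub _ _ (Hu n) Hu')).
  - move=> n; have Hn := H20_hasH (Hsub _ _ (Hu n) Hu').
    apply: (le_trans (energy_le Hn)); rewrite mulrC; apply: ler_wpM2r; last exact: hform_le_form2.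
    exact/ltW/(stress_upper hS).
  - by rewrite -(mul0r cb); exact: cvgMl.
have Llin c u v : H20 u -> H20 v -> ip om f (u + c *: v) = ip om f u + c * ip om f v.
  by move=> /H20_hasH[Lu _] /H20_hasH[Lv _]; rewrite !(ip_sym om f) ip_lin.
have Lbd v : H20 v -> ip om f v ^+ 2 <= ip om f f / (ce / (KP + 1)) * energy v v.
  move=> Hv; have [Lv _] := H20_hasH Hv; apply: (le_trans (ip_sqr_le Lf Lv)).
  rewrite -mulrA; apply: ler_wpM2l; first exact: ip_ge0.
  rewrite mulrC ler_pdivlMr// mulrC; apply: le_trans (form2_le v Hv).
  by rewrite ler_pM2l//; exact: ip_le_form2.
have elin c u v w : H20 u -> H20 v -> H20 w ->
    energy (u + c *: v) w = energy u w + c * energy v w.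
  by move=> /H20_hasH Hu /H20_hasH Hv /H20_hasH Hw; exact: energy_lin.
have esym u v : H20 u -> H20 v -> energy u v = energy v u.
  by move=> /H20_hasH Hu /H20_hasH Hv; exact: energy_sym.
have [u Hu Hsol] := riesz_representation (fun c u v => @H20_lin _ _ _ _ oom bom grad_bound c u v)
  esym elin energy0 H20_0 compl Llin Lbd.
by exists u; split.
Qed.

Lemma kl_L2S f u : kl_solution f u -> L2S om (S (hess om u)).
Proof. by move=> [/H20_hasH/hasH_L2S Lu _]; exact: (stress_L2S hS). Qed.

(** Test functions belong to [H20], so the variational equation contains the distributional one. *)
Lemma kl_dDiv f u : L2 om f -> kl_solution f u -> is_dDiv om (S (hess om u)) f.
Proof.
move=> Lf hu; have [Hu Hsol] := hu; split=> // phi tphi.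
have Hphi := H20_test oom bom bdryE grad_bound tphi.
rewrite -Hsol// /energy; have LS := kl_L2S hu.
have [Lc _] := is_hess_smooth oom bom (test_smooth tphi).
rewrite ipS_sym [RHS]ipS_sym; apply: (ipS_ae oom) => //; first exact/hasH_L2S/H20_hasH.
have := hess_smooth oom bom (test_smooth tphi).
by apply: filterS => x H /H ->.
Qed.

(** Testing with [u] bounds [ce] times the Hessian form [h] by [ip om f u], whose square is at most
    [KP * h] times [ip om f f]. Dividing by [h] bounds [h], and the other two bounds follow from
    it. *)
Lemma kl_bounds f u : L2 om f -> kl_solution f u ->
  [/\ ip om u u <= KP ^+ 2 / ce ^+ 2 * ip om f f, hform om u u <= KP / ce ^+ 2 * ip om f f &
      ipS om (S (hess om u)) (S (hess om u)) <= cb * (KP / ce ^+ 2) * ip om f f].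
Proof.
move=> Lf [Hu Hsol]; have H := H20_hasH Hu; have ce0 := stress_lower hS; have [Lu _] := H.
have e1 := energy_ge H; rewrite Hsol// in e1.
have e2 := ip_sqr_le Lf Lu; have e3 := poincareH Hu.
have h0 := hform_ge0 om u; have f0 := ip_ge0 om f.
have hb : hform om u u <= KP / ce ^+ 2 * ip om f f.
  rewrite mulrAC ler_pdivlMr ?exprn_gt0//.
  have : (ce * hform om u u) ^+ 2 <= ip om f f * (KP * hform om u u).
    apply: (@le_trans _ _ (ip om f u ^+ 2)).
      by rewrite lerXn2r// nnegrE ?mulr_ge0//; [exact: ltW|apply: le_trans e1; rewrite mulr_ge0// ltW].
    by apply: (le_trans e2); apply: ler_wpM2l.
  move: h0; rewrite le_eqVlt => /predU1P[<- _|h0]; first by rewrite mul0r mulr_ge0// ltW.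
  rewrite exprMn (expr2 (hform _ _ _)) !mulrA ler_pM2r//.
  by rewrite expr2 -(mulrA _ ce ce) (mulrC _ (ce * ce)) (mulrC KP).
split => //.
- apply: (le_trans e3); rewrite expr2 -!mulrA ler_pM2l//.
  by rewrite !mulrA.
- apply: (le_trans (stress_le hS (hasH_L2S H))); rewrite -mulrA; apply: ler_wpM2l => //.
  exact/ltW/(stress_upper hS).
Qed.

End KirchhoffLove.

(** * Mixed hybrid formulation *)

Section MixedHybrid.
Context {R : realType}.
Variables (om : set (R * R)) (m : nat) (E : 'I_m -> (R * R) * (R * R))
  (C : R * R -> {linear 'M[R]_2 -> 'M[R]_2})
  (S : (R * R -> 'M[R]_2) -> R * R -> 'M[R]_2) (cb ce KP : R)
  (kappa : R) (N : nat) (T : 'I_N -> 'I_3 -> R * R).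
Hypotheses (oom : open om) (bom : bounded_set om) (lip : lipschitz_boundary om)
  (bdryE : bdry om = \bigcup_k closed_seg (E k).1 (E k).2)
  (hS : stress_operator om C S cb ce) (KP0 : 0 < KP)
  (poincare : forall v, hasH om v -> zero_trace om E v -> ip om v v <= KP * hform om v v)
  (mesh : regular_mesh om kappa T).
Implicit Types (f g u v w : R * R -> R) (M Q B : R * R -> 'M[R]_2) (c : R)
  (psi : (R * R -> 'M[R]_2) -> R).
Local Notation plane := (measurableTypeR R * measurableTypeR R)%type.

Let grad_bound := mesh_gradient oom bom lip mesh.
Let H20E := H20P E oom bom grad_bound.

Let H20_hasH v : H20 om E v -> hasH om v.
Proof. by case=> /H2_hasH. Qed.

Lemma ip_sub f g h : L2 om f -> L2 om g -> L2 om h -> ip om (f - g) h = ip om f h - ip om g h.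
Proof. by move=> Lf Lg Lh; rewrite -scaleN1r ip_lin// mulN1r. Qed.

Lemma ipS_sub M Q B : L2S om M -> L2S om Q -> L2S om B ->
  ipS om (M - Q) B = ipS om M B - ipS om Q B.
Proof. by move=> LM LQ LB; rewrite -scaleN1r ipS_lin// mulN1r. Qed.

Lemma ip_dDivT_subl u v Q : L2 om u -> L2 om v -> HdDivT om T Q ->
  ip_dDivT T (u - v) Q = ip_dDivT T u Q - ip_dDivT T v Q.
Proof.
move=> Lu Lv HQ; have Luv : L2 om (u - v) by rewrite -scaleN1r; exact: L2_lin.
have LQ := L2_broken_dDiv oom lip mesh HQ.
by rewrite !(ip_dDivTE oom lip mesh)// ip_sub.
Qed.

Lemma is_hess_ae_eq u v M : L2 om u -> L2 om v -> {ae leb2, forall x : plane, om x -> u x = v x} ->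
  is_hess om v M -> is_hess om u M.
Proof.
move=> Lu Lv uv [LM HM]; split=> // phi tphi i j; rewrite -HM//; apply: (ip_ae oom) => //.
exact/(L2P _ oom)/L2_test/test_pd/test_pd.
Qed.

(** Both functions have the same set of admissible Hessians, so the choice operator returns the same
    field and the equality is literal. *)
Lemma hess_ae_eq u v : L2 om u -> L2 om v -> {ae leb2, forall x : plane, om x -> u x = v x} ->
  hess om u = hess om v.
Proof.
move=> Lu Lv uv; rewrite /hess; congr (get _); apply/seteqP; split=> M.
  by apply: is_hess_ae_eq => //; apply: filterS uv => x H /H.
exact: is_hess_ae_eq.
Qed.

Lemma H20_ae_eq u v : L2 om u -> H20 om E v -> {ae leb2, forall x : plane, om x -> u x = v x} ->
  H20 om E u.
Proof.
move=> Lu /H20E[Hv zv] uv; have [Lv [M HM]] := Hv.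
have Hu : hasH om u.
  by split; [exact: Lu|exists M; exact: is_hess_ae_eq Lu Lv uv HM].
apply/H20E; split; [exact: Hu|move=> e e0; have [phi [sp fp bp]] := zv e e0].
exists phi; split; [exact: sp| |exact: bp].
have Hp := hasH_smooth oom bom sp.
have [Lup _] := hasH_sub oom Hu Hp; have [Lvp _] := hasH_sub oom Hv Hp.
have E' : {ae leb2, forall x : plane, om x -> (u - phi) x = (v - phi) x}.
  by apply: filterS uv => x H /H ux; change (u x - phi x = v x - phi x); rewrite ux.
move: fp; rewrite /form2 (hess_ae_eq Lup Lvp E').
by rewrite (ip_ae oom Lup Lvp Lup E') (ip_sym om (v - phi)) (ip_ae oom Lup Lvp Lvp E').
Qed.

Lemma gamma2_sub u v Q : hasH om u -> hasH om v -> HdDivT om T Q ->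
  gamma2 om T (u - v) Q = gamma2 om T u Q - gamma2 om T v Q.
Proof.
move=> Hu Hv HQ; have [LQ _] := HQ.
have Lu := hasH_L2S Hu; have Lv := hasH_L2S Hv; have Luv := hasH_L2S (hasH_sub oom Hu Hv).
rewrite /gamma2 (ipS_ae oom Luv (L2S_sub oom Lu Lv) LQ (hess_sub oom Hu Hv)) ipS_sub//.
have [Lu' _] := Hu; have [Lv' _] := Hv; rewrite (ip_dDivT_subl Lu' Lv' HQ).
by rewrite !opprD !opprK addrACA.
Qed.

Lemma gamma2_ae_eq u v : L2 om u -> L2 om v -> {ae leb2, forall x : plane, om x -> u x = v x} ->
  eq_dual om T (gamma2 om T u) (gamma2 om T v).
Proof.
move=> Lu Lv uv Q HQ; rewrite /gamma2 (hess_ae_eq Lu Lv uv) !(ip_dDivTE oom lip mesh)//.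
by rewrite (ip_ae oom Lu Lv _ uv)//; exact: (L2_broken_dDiv oom lip mesh).
Qed.

(** The orthogonality behind existence and uniqueness: the stress field has its double divergence on
    all of [om], so the elementwise integrals add up to [ip om v f], which is also the energy of [u]
    and [v]. *)
Lemma gamma2_kl f u v : L2 om f -> kl_solution om E S f u -> H20 om E v ->
  gamma2 om T v (S (hess om u)) = 0.
Proof.
move=> Lf hu Hv; have [Lv _] := H20_hasH Hv; have LS := kl_L2S hS hu.
have dS := kl_dDiv oom bom bdryE grad_bound hS Lf hu.
rewrite /gamma2 (ip_dDivT_dDiv oom lip mesh Lv LS dS) ipS_sym -/(energy om S u v).
by have [_ ->] := hu; rewrite // ip_sym subrr.
Qed.

Lemma stress_injective B : L2S om B -> {ae leb2, forall x : plane, om x -> S B x = 0} ->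
  {ae leb2, forall x : plane, om x -> B x = 0}.
Proof.
move=> LB SB0; apply: (ipS_eq0 oom LB); have ce0 := stress_lower hS.
have := stress_ge hS LB; rewrite (ipS_ae oom (stress_L2S hS LB) (L2S0 oom) LB SB0).
have -> : ipS om 0 B = 0 by rewrite -(subrr B) ipS_sub// subrr.
by rewrite pmulr_rle0// => B0; apply/eqP; rewrite eq_le B0 ipS_ge0.
Qed.

(** Integrals of [Cinv] are replaced once and for all by those of a square integrable field, to
    which the calculus of [ipS] applies. *)
Lemma Cinv_ipS M : L2S om M -> exists2 B, L2S om B & [/\
  {ae leb2, forall x : plane, om x -> S B x = M x} &
  forall Q, ipS om (fun x => Cinv C x (M x)) Q = ipS om B Q].
Proof.
move=> LM; have [B LB H] := stress_inv hS LM; exists B => //; split.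
  by apply: filterS H => x H /H[].
move=> Q; rewrite /ipS /Rintegral; congr fine; apply: ae_eq_integral_total.
by apply: filterS H => x H /H[_ /= ->].
Qed.

Lemma Cinv_ipS_eq M B : L2S om M -> L2S om B ->
  {ae leb2, forall x : plane, om x -> S B x = M x} ->
  forall Q, L2S om Q -> ipS om (fun x => Cinv C x (M x)) Q = ipS om B Q.
Proof.
move=> LM LB BM Q LQ; have [B' LB' [BM' ->]] := Cinv_ipS LM.
have LD := L2S_sub oom LB' LB.
have D0 : {ae leb2, forall x : plane, om x -> S (B' - B) x = 0}.
  apply: filterS2 BM BM' => x BM BM' omx.
  rewrite -scaleN1r (stress_linear hS); change (S B' x + -1 *: S B x = 0).
  by rewrite BM// BM'// scaleN1r subrr.
apply: (ipS_ae oom) => //; have := stress_injective LD D0; apply: filterS => x H /H e.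
by apply/eqP; rewrite -subr_eq0; apply/eqP.
Qed.

Lemma Cinv_ipS_sub M M' Q : L2S om M -> L2S om M' -> L2S om Q ->
  ipS om (fun x => Cinv C x (M x - M' x)) Q =
  ipS om (fun x => Cinv C x (M x)) Q - ipS om (fun x => Cinv C x (M' x)) Q.
Proof.
move=> LM LM' LQ; have [B LB [BM ->]] := Cinv_ipS LM; have [B' LB' [BM' ->]] := Cinv_ipS LM'.
rewrite -ipS_sub//; apply: (@Cinv_ipS_eq (M - M')) => //; [exact: L2S_sub|exact: L2S_sub|].
apply: filterS2 BM BM' => x BM BM' omx.
rewrite -scaleN1r (stress_linear hS); change (S B x + -1 *: S B' x = M x - M' x).
by rewrite BM// BM'// scaleN1r.
Qed.

Lemma kl_is_solution f u : L2 om f -> kl_solution om E S f u ->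
  is_solution om E T C f (S (hess om u)) u (gamma2 om T u).
Proof.
move=> Lf hu; have [Hu Hsol] := hu; have H := H20_hasH Hu; have [Lu _] := H.
have LS := kl_L2S hS hu; have dS := kl_dDiv oom bom bdryE grad_bound hS Lf hu.
have HS := HdDivT_of_dDiv oom lip mesh LS dS.
split=> //; first by exists u.
- move=> dM HdM; have [LdM _] := HdM.
  rewrite (Cinv_ipS_eq LS (hasH_L2S H) _ LdM); last exact: aeW.
  by rewrite /gamma2 subrr.
- move=> du dpsi Ldu [v Hv dpsiE]; rewrite -dpsiE// (gamma2_kl Lf hu Hv) subr0.
  by rewrite (ip_dDivT_dDiv oom lip mesh Ldu LS dS) ip_sym.
Qed.

(** Reduces uniqueness and continuous dependence to statements about a single solution. *)
Lemma is_solution_sub f f' M u psi M' u' psi' : L2 om f -> L2 om f' ->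
  is_solution om E T C f M u psi -> is_solution om E T C f' M' u' psi' ->
  is_solution om E T C (fun x => f x - f' x) (fun x => M x - M' x) (fun x => u x - u' x)
    (fun Q => psi Q - psi' Q).
Proof.
move=> Lf Lf' [HM Lu [v Hv vpsi] e1 e2] [HM' Lu' [v' Hv' vpsi'] e1' e2'].
have [LM _] := HM; have [LM' _] := HM'.
split.
- have := HdDivT_lin oom lip mesh (-1) HM HM'; rewrite scaleN1r; exact.
- have := L2_lin oom (-1) Lu Lu'; rewrite scaleN1r; exact.
- exists (v - v').
    by rewrite -scaleN1r; exact: (H20_lin oom bom grad_bound).
  move=> Q HQ; rewrite gamma2_sub//; [|exact: H20_hasH|exact: H20_hasH].
  by rewrite vpsi// vpsi'.
- move=> dM HdM; have [LdM _] := HdM; rewrite Cinv_ipS_sub//.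
  rewrite (_ : ip_dDivT T (fun x => u x - u' x) dM = ip_dDivT T u dM - ip_dDivT T u' dM).
    by have := e1 _ HdM; have := e1' _ HdM; move: (ipS _ _ _) (ipS _ _ _) (ip_dDivT _ _ _) (ip_dDivT _ _ _) => a b c d; lra.
  exact: ip_dDivT_subl.
- move=> du dpsi Ldu Hdpsi; have [w Hw wpsi] := Hdpsi.
  have HMM : HdDivT om T (M - M') by rewrite -scaleN1r; exact: (HdDivT_lin oom lip mesh).
  have iE v0 : L2 om v0 -> ip_dDivT T v0 (M - M') = ip_dDivT T v0 M - ip_dDivT T v0 M'.
    move=> Lv0; have := ip_dDivT_lin oom lip mesh (-1) Lv0 HM HM'.
    by rewrite scaleN1r mulN1r.
  have [Lw _] := H20_hasH Hw.
  have sE : ipS om (hess om w) (M - M') = ipS om (hess om w) M - ipS om (hess om w) M'.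
    rewrite !(ipS_sym om (hess om w)); apply: ipS_sub => //; exact/hasH_L2S/H20_hasH.
  have dE : dpsi (M - M') = dpsi M - dpsi M'.
    rewrite -(wpsi _ HMM) -(wpsi _ HM) -(wpsi _ HM') /gamma2 sE (iE _ Lw).
    by rewrite !opprD !opprK addrACA.
  have fE : ip om (f - f') du = ip om f du - ip om f' du by exact: ip_sub.
  have e3 := e2 _ _ Ldu Hdpsi; have e3' := e2' _ _ Ldu Hdpsi.
  change (- ip_dDivT T du (M - M') - dpsi (M - M') = - ip om (f - f') du).
  rewrite (iE _ Ldu) dE fE; move: e3 e3'.
  move: (ip_dDivT T du M) (ip_dDivT T du M') (ip om f du) (ip om f' du) (dpsi M) (dpsi M').
  move=> a b c d e g; lra.
Qed.

(* Uniqueness: testing with the solution itself gives [M = 0]; then testing with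
   the stress field of the Kirchhoff-Love solution for the load [u], on which the
   traces of [H20] vanish, gives [u = 0]. *)
Lemma solution_zero f M u psi : L2 om f -> (forall v, L2 om v -> ip om f v = 0) ->
  is_solution om E T C f M u psi ->
  [/\ {ae leb2, forall x : plane, om x -> M x = 0},
      {ae leb2, forall x : plane, om x -> u x = 0} &
      forall Q, HdDivT om T Q -> psi Q = 0].
Proof.
move=> Lf f0 [HM Lu Hpsi e1 e2]; have [LM _] := HM; have [v Hv vpsi] := Hpsi.
have [B LB [BM kB]] := Cinv_ipS LM; have ce0 := stress_lower hS.
have LSB := stress_L2S hS LB.
(* The first equation with [dM = M] minus the second with [du = u] and [dpsi = psi]: the mixed terms
   cancel. *)
have BM0 : ipS om B M = 0.
  have := e1 _ HM; have := e2 _ _ Lu Hpsi; rewrite kB f0//.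
  move: (ipS _ _ _) (ip_dDivT _ _ _) (psi _) => a b c; lra.
have B0 : {ae leb2, forall x : plane, om x -> B x = 0}.
  apply: (ipS_eq0 oom LB); have := stress_ge hS LB.
  rewrite (ipS_ae oom LSB LM LB BM) ipS_sym BM0 pmulr_rle0// => B0.
  by apply/eqP; rewrite eq_le B0 ipS_ge0.
have M0 : {ae leb2, forall x : plane, om x -> M x = 0}.
  have S0 : S 0 = 0 by have := stress_linear hS (-1) 0 0; rewrite scaler0 addr0 scaleN1r subrr.
  apply: filterS2 B0 BM => x B0 BM omx; rewrite -BM//.
  by rewrite (stress_local hS (B0 omx : B x = (0 : R * R -> 'M[R]_2) x)) S0.
have kB0 Q : L2S om Q -> ipS om (fun x => Cinv C x (M x)) Q = 0.
  move=> LQ; rewrite kB (ipS_ae oom LB (L2S0 oom) LQ B0).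
  by rewrite -(subrr (0 : R * R -> 'M[R]_2)) ipS_sub ?subrr//; exact: L2S0.
have u0 : {ae leb2, forall x : plane, om x -> u x = 0}.
  have [z hz] := kl_exists oom bom bdryE grad_bound hS KP0 poincare Lu.
  have LS := kl_L2S hS hz; have dS := kl_dDiv oom bom bdryE grad_bound hS Lu hz.
  have HS := HdDivT_of_dDiv oom lip mesh LS dS.
  have := e1 _ HS; rewrite (kB0 _ LS) (ip_dDivT_dDiv oom lip mesh Lu LS dS) -vpsi// (gamma2_kl Lu hz Hv).
  rewrite subr0 sub0r => /eqP; rewrite oppr_eq0 => /eqP; apply: inn_eq0; first exact: open_measurable_plane.
  exact/(L2P _ oom).
split=> // Q HQ; have [LQ _] := HQ.
have := e1 _ HQ; rewrite (kB0 _ LQ) (ip_dDivTE oom lip mesh Lu HQ).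
have LbQ := L2_broken_dDiv oom lip mesh HQ.
have L0 : L2 om 0 by rewrite -(subrr u) -scaleN1r; exact: L2_lin.
rewrite (ip_ae oom Lu L0 LbQ u0) -(subrr u) ip_sub// subrr subr0 sub0r => /eqP.
by rewrite oppr_eq0 => /eqP.
Qed.

(** The difference of two solutions for one load solves the problem with zero load. Hence every
    property can be read off from [u0]. *)
Lemma solution_kl f M u psi u0 : L2 om f -> kl_solution om E S f u0 ->
  is_solution om E T C f M u psi ->
  [/\ {ae leb2, forall x : plane, om x -> M x = S (hess om u0) x},
      {ae leb2, forall x : plane, om x -> u x = u0 x} &
      eq_dual om T psi (gamma2 om T u0)].
Proof.
move=> Lf h0 hs; have h0s := kl_is_solution Lf h0.
have hd := is_solution_sub Lf Lf hs h0s.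
have L0 : L2 om (f - f) by rewrite -scaleN1r; exact: L2_lin.
have z0 v : L2 om v -> ip om (f - f) v = 0 by move=> Lv; rewrite ip_sub// subrr.
have [M0 u0' psi0] := solution_zero L0 z0 hd.
split.
- by apply: filterS M0 => x H /H e; apply/eqP; rewrite -subr_eq0; apply/eqP.
- by apply: filterS u0' => x H /H e; apply/eqP; rewrite -subr_eq0; apply/eqP.
- by move=> Q HQ; apply/eqP; rewrite -subr_eq0; apply/eqP; exact: psi0.
Qed.

Lemma le_sqrt_norm_L2 f (x k : R) : 0 <= x -> 0 <= k -> x ^+ 2 <= k * ip om f f ->
  x <= Num.sqrt k * norm_L2 om f.
Proof.
by move=> x0 k0 xk; rewrite /norm_L2 -sqrtrM// -(ger0_norm x0) -sqrtr_sqr ler_wsqrtr.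
Qed.

(** The summands bound [M], [u] and [psi] in this order. The [1] accounts for the double divergence
    of [M], which is [f]; [psi] is measured by the norm of an extension. *)
Definition stability_constant : R := Num.sqrt (cb * (KP / ce ^+ 2) + 1) +
  Num.sqrt (KP ^+ 2 / ce ^+ 2) + Num.sqrt (KP ^+ 2 / ce ^+ 2 + KP / ce ^+ 2).

Lemma solution_properties f M u psi : L2 om f -> is_solution om E T C f M u psi ->
  [/\ sol_norm om T M u psi <= stability_constant * norm_L2 om f,
      H20 om E u,
      {ae leb2, forall x : plane, om x -> M x = C x (hess om u x)},
      eq_dual om T psi (gamma2 om T u) &
      kirchhoff_love om E C f u M].
Proof.
move=> Lf hs; have [[LM _] Lu _ _ _] := hs.
have [u0 h0] := kl_exists oom bom bdryE grad_bound hS KP0 poincare Lf.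
have [M0 uu0 psi0] := solution_kl Lf h0 hs.
have [Hu0 _] := h0; have [Lu0 _] := H20_hasH Hu0.
have LS := kl_L2S hS h0; have [Lg dS] := kl_dDiv oom bom bdryE grad_bound hS Lf h0.
have Hu := H20_ae_eq Lu Hu0 uu0.
have dM : is_dDiv om M f.
  split=> // phi tphi; rewrite -(dS _ tphi).
  have [Lc _] := hasH_L2S (hasH_smooth oom bom (test_smooth tphi)).
  by apply: (ipS_ae oom) => //; case: (is_hess_smooth oom bom (test_smooth tphi)).
have MC : {ae leb2, forall x : plane, om x -> M x = C x (hess om u x)}.
  rewrite (hess_ae_eq Lu Lu0 uu0); have := stress_eq hS (hess om u0).
  by apply: filterS2 M0 => x H1 H2 omx; rewrite H1.
have ce0 := stress_lower hS; have cb0 := stress_upper hS.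
have [ub hb Sb] := kl_bounds oom bom grad_bound hS KP0 poincare Lf h0.
have k2 : 0 <= KP / ce ^+ 2 by rewrite divr_ge0 ?exprn_ge0// ltW.
have k1 : 0 <= KP ^+ 2 / ce ^+ 2 by rewrite divr_ge0 ?exprn_ge0// ltW.
have kM : 0 <= cb * (KP / ce ^+ 2) by rewrite mulr_ge0// ltW.
split; [|exact: Hu|exact: MC| |].
- rewrite /sol_norm /stability_constant !mulrDl; apply: lerD; first apply: lerD.
  + apply: le_sqrt_norm_L2; [exact: sqrtr_ge0|exact: addr_ge0|].
    apply: (le_trans (norm_dDivT_le oom lip mesh LM dM)); rewrite mulrDl mul1r lerD2r.
    by rewrite (ipS_ae2 oom LM LS LM LS M0 M0).
  + apply: le_sqrt_norm_L2; [exact: sqrtr_ge0|exact: k1|].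
    rewrite sqr_sqrtr ?ip_ge0// (ip_ae oom Lu Lu0 Lu uu0) ip_sym (ip_ae oom Lu Lu0 Lu0 uu0).
    exact: ub.
  (* [norm3212] is an infimum over extensions of [psi], and [u0] is one of them. *)
  + apply: (@le_trans _ _ (norm2 om u0)).
      apply: ge_inf; first by exists 0 => r [v [_ _ ->]]; exact: sqrtr_ge0.
      by exists u0; split=> //; [case: Hu0|move=> Q HQ; rewrite psi0].
    apply: le_sqrt_norm_L2; [exact: sqrtr_ge0|exact: addr_ge0|].
    by rewrite norm2_sqr mulrDl; exact: lerD.
- by move=> Q HQ; rewrite psi0// (gamma2_ae_eq Lu Lu0 uu0 HQ).
- by split; [exact: dM|exact: MC|case: Hu].
Qed.

Lemma mixed_well_posed : well_posed om E T C.
Proof.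
split.
- move=> f Lf; have [u hu] := kl_exists oom bom bdryE grad_bound hS KP0 poincare Lf.
  by exists (S (hess om u)), u, (gamma2 om T u); exact: kl_is_solution.
- move=> f M u psi M' u' psi' Lf hs hs'.
  have [u0 h0] := kl_exists oom bom bdryE grad_bound hS KP0 poincare Lf.
  have [M0 uu0 psi0] := solution_kl Lf h0 hs; have [M0' uu0' psi0'] := solution_kl Lf h0 hs'.
  split.
  + by apply: filterS2 M0 M0' => x H H' omx; rewrite H// H'.
  + by apply: filterS2 uu0 uu0' => x H H' omx; rewrite H// H'.
  + by move=> Q HQ; rewrite psi0// psi0'.
exists stability_constant => f f' M u psi M' u' psi' Lf Lf' hs hs'.
have Lff : L2 om (f - f') by rewrite -scaleN1r; exact: L2_lin.
(* Continuous dependence is the stability estimate for the difference. *)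
by have [] := solution_properties Lff (is_solution_sub Lf Lf' hs hs').
Qed.

End MixedHybrid.

Theorem theorem20 (R : realType) (Omega : set (R * R)) (m : nat)
    (E : 'I_m -> (R * R) * (R * R))
    (C : R * R -> {linear 'M[R]_2 -> 'M[R]_2})
    (hOmega : lipschitz_polygon Omega E)
    (hC : elasticity_tensor Omega C) :
  exists2 K : R, 0 < K &
    forall (kappa : R) (N : nat) (T : 'I_N -> 'I_3 -> R * R),
      regular_mesh Omega kappa T ->
      well_posed Omega E T C /\
      forall f M u psi, L2 Omega f -> is_solution Omega E T C f M u psi ->
        [/\ sol_norm Omega T M u psi <= K * norm_L2 Omega f,
            H20 Omega E u,
            {ae leb2, forall x, Omega x -> M x = C x (hess Omega u x)},
            eq_dual Omega T psi (gamma2 Omega T u) &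
            kirchhoff_love Omega E C f u M].
Proof.
have [_ oom bom _ lip [_ bdryE _]] := hOmega.
have [S [cb [ce hS]]] := elasticity_stress oom bom hC.
have [KP KP0 poincare] := poincare_zero_trace oom bom bdryE.
(* Fixed before the mesh is introduced: [cb], [ce] and [KP] come from [C], [Omega] and [E] alone. *)
exists (stability_constant cb ce KP).
  rewrite /stability_constant ltr_wpDr ?sqrtr_ge0// ltr_wpDr ?sqrtr_ge0// sqrtr_gt0 ltr_wpDl//.
  by rewrite mulr_ge0 ?divr_ge0 ?exprn_ge0// ltW// ?(stress_upper hS)// (stress_lower hS).
move=> kappa N T mesh; split; first exact: (mixed_well_posed oom bom lip bdryE hS KP0 poincare mesh).
move=> f M u psi Lf hs.
exact: (solution_properties oom bom lip bdryE hS KP0 poincare mesh Lf hs).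
Qed.
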